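(* Let $0<\alpha<1/100$. For $D^2q<x^{\frac23-4\alpha}$ and $M_2\le x^{\frac13}$, and for any $\varepsilon$ with $0<\varepsilon<\alpha/4$, $$|\mathcal D_{\mathcal M,f}|\ll D^3x^\varepsilon q^{3\alpha}M_2^{\frac98}q^{-\frac18}x^{\frac14}+\frac{x}{q^{1+\frac{\alpha}{2}}}.$$
   Context: Setting: $x$ is large; $\chi$ is an exceptional character of conductor $D$, i.e. a quadratic primitive Dirichlet character modulo $D$ such that $L(s,\chi)$ has a real zero $\beta\ge 1-C/\log(2D)$ for a fixed small constant $C>0$; $a,q$ are positive integers with $(a,q)=1$. For $i=1,2,3$ let $\mathcal M_i=[M_i,M_i(1+\Delta))$, where $0<\Delta\ll\frac{1}{\log^8x}$, and the real numbers $M_1,M_2,M_3$ satisfy $$\frac{x}{\log^{12}x}<M_1M_2M_3\le x,\qquad \frac{x}{q^{\frac32+\alpha}}\le M_3\le M_2\le M_1\le Dq^{1+\alpha}.$$ Write $\mathcal M=(\mathcal M_1,\mathcal M_2,\mathcal M_3)$. Let $f=(f_1,f_2,f_3)$, where exactly one of the $f_i$ is $\chi$ and the other two are identically $1$. Define $$\mathcal D_{\mathcal M,f}=\sum_{\substack{t_1\in\mathcal M_1,\ t_2\in\mathcal M_2,\ t_3\in\mathcal M_3\\ t_1t_2t_3\equiv a\ (\mathrm{mod}\ q)}}f_1(t_1)f_2(t_2)f_3(t_3),$$ the sum being over integers $t_i$. The implied constant depends only on $\alpha$ and $\varepsilon$ (and the constant in the bound for $\Delta$). *)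

(* Defs.v *)
From HB Require Import structures.
From mathcomp Require Import all_boot all_order all_algebra.
From mathcomp Require Import all_classical all_reals all_analysis.

Set Implicit Arguments.
Unset Strict Implicit.
Unset Printing Implicit Defensive.

Import Order.TTheory GRing.Theory Num.Theory.
Import numFieldNormedType.Exports.
Local Open Scope classical_set_scope.
Local Open Scope ring_scope.

(* [chi 1 = 1] is not listed: it follows from multiplicativity and
   [chi 1 != 0]. *)
Definition dirichlet_character (K : fieldType) (D : nat) (chi : int -> K)
    : Prop :=
  [/\ (0 < D)%N,
      forall m n : int, (m = n %[mod D%:Z])%Z -> chi m = chi n,
      forall m n : int, chi (m * n) = chi m * chi n
    & forall n : int, (chi n != 0) = coprimez n D%:Z].

Definition principal_character (K : fieldType) (D : nat) : int -> K :=
  fun n => (coprimez n D%:Z)%:R.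

Definition induced_from (K : fieldType) (D d : nat) (chi : int -> K) : Prop :=
  exists2 psi : int -> K, dirichlet_character d psi
    & forall n : int, coprimez n D%:Z -> chi n = psi n.

Definition primitive_character (K : fieldType) (D : nat) (chi : int -> K)
    : Prop :=
  dirichlet_character D chi /\
  forall d : nat, (d %| D)%N -> (d < D)%N -> ~ induced_from D d chi.

(* The order of [chi] in the group of characters modulo [D] is exactly 2.
   Such a character only takes the values 0, 1 and -1, so nothing is lost by
   taking [K] to be the field of real numbers below. *)
Definition quadratic_character (K : fieldType) (D : nat) (chi : int -> K)
    : Prop :=
  [/\ dirichlet_character D chi,
      chi <> principal_character K D
    & (fun n => chi n ^+ 2) = principal_character K D].

(* L(s, chi) = sum_(n >= 1) chi(n) n^(-s).  For a non-principal [chi] the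
   series converges for every real s > 0, where its sum is the value of the
   analytic continuation; only that range of s is used. *)
Definition L_partial_sums (R : realType) (chi : int -> R) (s : R) : R^nat :=
  fun N => \sum_(1 <= n < N) chi n%:Z * n%:R `^ (- s).

Definition L_real_zero (R : realType) (chi : int -> R) (beta : R) : Prop :=
  0 < beta /\ L_partial_sums chi beta @ \oo --> (0 : R).

Definition exceptional_character (R : realType) (C : R) (D : nat)
    (chi : int -> R) : Prop :=
  [/\ quadratic_character D chi, primitive_character D chi
    & exists2 beta : R, 1 - C / ln (2 * D%:R) <= beta & L_real_zero chi beta].

Definition short_range (R : realType) (Delta M : R) : set int :=
  [set t : int | M <= t%:~R < M * (1 + Delta)].

(* A finitely supported sum: the index set is a bounded set of integer
   triples (t1, t2, t3). *)
Definition ternary_sum (R : realType) (Delta M1 M2 M3 : R)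
    (f1 f2 f3 : int -> R) (a q : nat) : R :=
  \sum_(t \in [set t : int * int * int |
      [/\ short_range Delta M1 t.1.1, short_range Delta M2 t.1.2,
          short_range Delta M3 t.2
        & (t.1.1 * t.1.2 * t.2 = a%:Z %[mod q%:Z])%Z]])
    f1 t.1.1 * f2 t.1.2 * f3 t.2.

Definition exactly_one_is (R : realType) (chi f1 f2 f3 : int -> R) : Prop :=
  let one := fun _ : int => 1 : R in
  [\/ [/\ f1 = chi, f2 = one & f3 = one],
      [/\ f1 = one, f2 = chi & f3 = one]
    | [/\ f1 = one, f2 = one & f3 = chi]].

(* Main.v *)
Require Import Defs.
From HB Require Import structures.
From mathcomp Require Import all_boot all_order all_algebra.
From mathcomp Require Import all_classical all_reals all_analysis.
From mathcomp Require Import zify ring lra.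

(** Let [u] denote inversion modulo [q].  Detecting [t1 = a u(t2) u(t3)] by
    additive characters modulo [q] and summing over [t1] first, the frequencies
    [h] with [D h = 0] give a main term, which is small because the sum of [chi]
    over an interval of integers prime to [q] is [O(D 2^omega(q))].

    For the other frequencies the transform of [f1] on its interval is at most
    [D min(N1, q / |D h|)].  By Hölder the remaining sum of
    [|F(h)| |B(a h u(t2))|], with [B(v) = sum_(t3) f3(t3) e(v u(t3) / q)], is
    bounded by the number of solutions of [h t2' = h' t2], which the divisor
    bound controls, and by the fourth moment of [B], i.e. by the number of
    solutions of [u(n1) + u(n2) = u(n3) + u(n4)] with [n_i <= N3].

    That energy is elementary (Heath-Brown).  To count [u(n1) + u(n2) = b], take
    a short nonzero vector [(r, s)] with [r b = s].  If [s <> 0], then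
    [(s n1 - r)(s n2 - r) = r^2 - s k q] for one of few [k], and the divisor
    bound applies; if [s = 0], then [b] shares a large divisor [g] with [q] and
    [g] divides [n1 + n2].

    This gives the claim when [M2 >= q^(1/3)]; otherwise the number of
    [n <= 27 x] with [n = a] modulo [q], weighted by the divisor bound, is already
    small enough. *)

Set Implicit Arguments.
Unset Strict Implicit.
Unset Printing Implicit Defensive.

Import Order.TTheory GRing.Theory Num.Theory.
Import numFieldNormedType.Exports.
Local Open Scope ring_scope.

(** * Counting and the divisor bound *)

(** Up to [x^eps] and powers of [D], Hölder bounds the fourth power of the error by three factors:
    [N2^2] for the squared total weight, [N1 N2 / q] for the equation in [h] and [t2], and [q E]
    with an energy [E] of size [N3^2 (1 + N3^(3/2) q^(-1/2))]. Once [M2^(3/2) >= q^(1/2)] the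
    product is at most [x M2^(9/2) q^(-1/2)]; this is where the threshold [q^(1/3)] comes from, and
    the fourth root is [x^(1/4) M2^(9/8) q^(-1/8)]. The frequencies with [D h = 0] are set apart
    because telescoping over a period [D] gives no decay there. When [f1] is constant the same
    scheme runs with period 1, and [chi] cancels in the sum over [t2] or [t3] instead. The main term
    is about [D^2 x / (q M3)]. It is negligible because [D^2 q < x^(2/3 - 4 alpha)] and the lower
    bound on [M3] together give [M3 >= D^3 x^(5 alpha)]. *)

Lemma size_fiber_le (X Y : eqType) (A : seq X) (g : X -> Y) (s : seq Y)
    (c : nat) :
  (forall x, x \in A -> g x \in s) ->
  (forall y, y \in s -> count (fun x => g x == y) A <= c)%N ->
  (size A <= c * size s)%N.
Proof.
move=> gAs fib; apply: (@leq_trans (\sum_(y <- s) count (fun x => g x == y) A)).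
  rewrite -sum1_size; under [leqRHS]eq_bigr do rewrite -sum1_count.
  under [leqRHS]eq_bigr do rewrite big_mkcond.
  rewrite exchange_big /= big_seq [leqRHS]big_seq; apply: leq_sum => x xA.
  rewrite -big_mkcond sum1_count -has_count; apply/hasP.
  by exists (g x); [exact: gAs|exact: eqxx].
rewrite big_seq (@leq_trans (\sum_(y <- s | y \in s) c)) //.
  exact: leq_sum.
by rewrite -big_seq big_const_seq count_predT iter_addn_0.
Qed.

Lemma size_inj_le (X Y : eqType) (A : seq X) (g : X -> Y) (s : seq Y) :
  uniq A -> {in A &, injective g} -> (forall x, x \in A -> g x \in s) ->
  (size A <= size s)%N.
Proof.
move=> uA inj gAs; rewrite -(size_map g); apply: uniq_leq_size.
  by rewrite map_inj_in_uniq.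
by move=> y /mapP[x xA ->]; exact: gAs.
Qed.

(* A prime [p >= 2^(1/delta)] satisfies [e + 1 <= p^(e delta)]; each of the
   finitely many smaller primes costs a bounded factor. *)
Lemma submultiplicative_bound (R : realType) (delta : R) : 0 < delta ->
  exists2 K : R, 1 <= K &
    forall f : nat -> nat, (f 1 <= 1)%N ->
    (forall p e m : nat, prime p -> (0 < e)%N -> (0 < m)%N -> coprime p m ->
       f (p ^ e * m)%N <= e.+1 * f m)%N ->
    forall n : nat, (0 < n)%N -> (f n)%:R <= K * n%:R `^ delta.
Proof.
move=> d0; have [y yE] : exists y : R, y = 2 `^ delta by exists (2 `^ delta).
have y1 : 1 < y by rewrite yE /powR ifF ?expR_gt1 ?mulr_gt0 ?ln_gt0//; lra.
have iy0 : 0 < (y - 1)^-1 by rewrite invr_gt0 subr_gt0.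
(* Bernoulli's inequality for [y ^+ e] shows that [1 + 1 / (y - 1)] is an admissible cost per small
   prime. *)
have [C C1 CP] : exists2 C : R, 1 <= C & forall e, (e.+1)%:R <= C * y ^+ e.
  exists (1 + (y - 1)^-1) => [|e]; first lra.
  have bern : 1 + (y - 1) *+ e <= y ^+ e.
    elim: e => [|e IH]; first by rewrite mulr0n expr0 addr0.
    rewrite exprS; have ye : 1 <= y ^+ e by rewrite exprn_ege1// ltW.
    rewrite mulrS; nra.
  have : (e.+1)%:R <= (1 + (y - 1)^-1) * (1 + (y - 1) *+ e).
    rewrite [leRHS](_ : _ = e%:R + 1 + (y - 1) * e%:R + (y - 1)^-1).
      rewrite -natr1 -addrA lerDl; apply: addr_ge0; last exact: ltW.
      by rewrite mulr_ge0// subr_ge0 ltW.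
    by rewrite -mulr_natr; field; lra.
  move=> /le_trans; apply; rewrite ler_pM2l//; lra.
have powRX (a : R) e : 0 <= a -> (a ^+ e) `^ delta = (a `^ delta) ^+ e.
  by move=> a0; rewrite -powR_mulrn// powRAC powR_mulrn// powR_ge0.
have [P big] : exists P : nat, forall p, (P <= p)%N -> 2 <= (p%:R : R) `^ delta.
  exists (Num.bound (2 `^ delta^-1 : R)) => p Pp.
  have -> : 2 = (2 `^ delta^-1) `^ delta :> R.
    by rewrite -powRrM mulVf ?lt0r_neq0// powRr1.
  apply: ge0_ler_powR; rewrite ?nnegrE ?powR_ge0 ?ler0n //; first exact: ltW.
  move: Pp; rewrite -(ler_nat R); apply: le_trans.
  by apply: ltW; apply: archi_boundP; exact: powR_ge0.
(* The number of primes below [P] dividing [n], that is, how often the factor [C] is paid. *)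
pose cnt n := count (fun i => prime i && (i %| n)%N) (iota 0 P).
exists (C ^+ P); first by rewrite exprn_ege1.
move=> f f1 fM n n0.
have main k : (0 < k)%N -> (f k)%:R <= C ^+ cnt k * k%:R `^ delta.
  have [N] := ubnP k; elim: N k => // N IH k kN k0.
  case: (ltnP 1 k) => [k1|]; last first.
    move=> k1; have -> : k = 1%N by lia.
    rewrite powR1 mulr1; apply: le_trans (_ : 1 <= _).
      by rewrite (ler_nat _ _ 1).
    by rewrite exprn_ege1.
  have pp := pdiv_prime k1; set p := pdiv k in pp.
  have [m pm km] := pfactor_coprime pp k0; set e := logn p k in km.
  have e0 : (0 < e)%N by rewrite logn_gt0 mem_primes pp k0 pdiv_dvd.
  have m0 : (0 < m)%N by rewrite km muln_gt0 in k0; case/andP: k0.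
  have pe1 : (1 < p ^ e)%N by rewrite -(exp1n e) ltn_exp2r// prime_gt1.
  have mk : (m < k)%N by rewrite km ltn_Pmulr.
  rewrite mulnC in km.
  have IHm := IH m (leq_trans mk (ltnSE kN)) m0.
  have cntk : (cnt m + (p < P) <= cnt k)%N.
    have -> : ((p < P) = count (pred1 p) (iota 0 P) :> nat)%N.
      by rewrite count_uniq_mem ?iota_uniq// mem_iota.
    rewrite -count_predUI [X in (_ + X)%N](_ : _ = 0%N) ?addn0; last first.
      apply/eqP; rewrite -leqn0 leqNgt -has_count; apply/hasPn => i _ /=.
      apply/negP => /andP[/andP[_ im] /eqP ip]; move: im; rewrite ip.
      by apply/negP; rewrite -prime_coprime.
    apply: sub_count => i /= /orP[/andP[-> im]|/eqP ->].
      by rewrite km dvdn_mull.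
    by rewrite pp pdiv_dvd.
  have fk : (f k)%:R <= (e.+1)%:R * (f m)%:R :> R.
    by rewrite -natrM ler_nat {1}km fM.
  have Cc : C ^+ (cnt m + (p < P)) <= C ^+ cnt k by rewrite ler_weXn2l.
  have kd : k%:R `^ delta = ((p%:R : R) `^ delta) ^+ e * m%:R `^ delta.
    by rewrite km natrM powRM ?ler0n// natrX powRX.
  have ep : (e.+1)%:R <= C ^+ (p < P)%N * ((p%:R : R) `^ delta) ^+ e.
    case: (ltnP p P) => [_|/big Pp].
      rewrite expr1; apply: le_trans (CP e) _; rewrite ler_pM2l; last by lra.
      apply: lerXn2r; rewrite ?nnegrE ?powR_ge0 //; first by rewrite yE powR_ge0.
      by rewrite yE; apply: ge0_ler_powR; rewrite ?nnegrE ?ler0n ?ler_nat ?prime_gt1// ltW.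
    rewrite expr0 mul1r; apply: le_trans (_ : 2 ^+ e <= _).
      by rewrite -natrX ler_nat ltn_expl.
    by apply: lerXn2r; rewrite ?nnegrE ?powR_ge0.
  apply: le_trans fk _; rewrite kd.
  apply: le_trans (_ : C ^+ (cnt m + (p < P)) * (((p%:R : R) `^ delta) ^+ e * m%:R `^ delta) <= _); last first.
    by rewrite ler_wpM2r// mulr_ge0 ?exprn_ge0 ?powR_ge0.
  rewrite exprD.
  have -> (a b c d : R) : a * b * (c * d) = (b * c) * (a * d) by ring.
  by apply: ler_pM.
apply: le_trans (main n n0) _; rewrite ler_wpM2r ?powR_ge0//.
by rewrite ler_weXn2l// (leq_trans (count_size _ _)) ?size_iota.
Qed.

Lemma size_divisors_bound (p e m : nat) : prime p -> (0 < m)%N -> coprime p m ->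
  (size (divisors (p ^ e * m)) <= e.+1 * size (divisors m))%N.
Proof.
move=> pp m0 pm; have pe0 : (0 < p ^ e)%N by rewrite expn_gt0 prime_gt0.
have n0 : (0 < p ^ e * m)%N by rewrite muln_gt0 pe0.
have -> : (e.+1 * size (divisors m))%N =
    size (allpairs pair (iota 0 e.+1) (divisors m)).
  by rewrite size_allpairs size_iota.
apply: (@size_inj_le nat (nat * nat)%type (divisors (p ^ e * m))
  (fun d => (logn p d, (d`_p^')%N))).
- exact: divisors_uniq.
- move=> d d' ; rewrite -!dvdn_divisors// => dn d'n [].
  have d0 := dvdn_gt0 n0 dn; have d'0 := dvdn_gt0 n0 d'n.
  by move=> h1 h2; rewrite -(partnC p d0) -(partnC p d'0) h2 !p_part h1.
- move=> d; rewrite -dvdn_divisors// => dn; have d0 := dvdn_gt0 n0 dn.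
  apply/allpairsP; exists (logn p d, (d`_p^')%N); split=> //.
    rewrite mem_iota add0n ltnS; apply: leq_trans (dvdn_leq_log _ n0 dn) _.
    by rewrite lognM// pfactorK// (@logn_coprime p m)// addn0.
  rewrite -dvdn_divisors//; have := partn_dvd p^' n0 dn.
  rewrite partnM// => /dvdn_trans; apply.
  rewrite [X in (X * _)%N](_ : _ = 1%N) ?mul1n ?dvdn_part//.
  by apply/part_p'nat; rewrite pnatNK pnatX pnat_id.
Qed.

(** The constant above is chosen before the function, so one [K] serves both the number of divisors
    and [2 ^ omega(n)]. *)
Lemma divisor_bound (R : realType) (delta : R) : 0 < delta ->
  exists2 K : R, 1 <= K & forall n : nat, (0 < n)%N ->
    (size (divisors n))%:R <= K * n%:R `^ delta /\
    (2 ^ size (primes n))%:R <= K * n%:R `^ delta.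
Proof.
move=> d0; have [K K1 KP] := submultiplicative_bound d0; exists K => // n n0.
split; first by apply: (KP (fun n => size (divisors n))) => // p e m pp _;
  exact: size_divisors_bound.
apply: (KP (fun n => 2 ^ size (primes n))%N) => // p e m pp e0 m0 pm.
have pe0 : (0 < p ^ e)%N by rewrite expn_gt0 prime_gt0.
apply: (@leq_trans (2 ^ (size (p :: primes m)))); last by rewrite expnS leq_mul.
rewrite leq_pexp2l//; apply: uniq_leq_size (primes_uniq _) _ => r.
rewrite (primesM _ pe0 m0) (primesX _ e0) (primes_prime pp).
by rewrite !inE => /orP[->|->]; rewrite ?orbT.
Qed.

(** * Residues modulo [q], written [q0.+2] so that ['Z_q0.+2] has exactly this modulus *)

Lemma natZp_eq0 (q0 n : nat) : ((n%:R : 'Z_q0.+2) == 0) = (q0.+2 %| n)%N.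
Proof. by rewrite -val_eqE /= val_Zp_nat. Qed.

Lemma natZp_modulus (q0 : nat) : q0.+2%:R = 0 :> 'Z_q0.+2.
Proof. by apply/eqP; rewrite natZp_eq0 dvdnn. Qed.

Lemma natZp_mod (q0 m n : nat) :
  m%:R = n%:R :> 'Z_q0.+2 -> m = n %[mod q0.+2].
Proof. by move=> /(congr1 val); rewrite /= !val_Zp_nat. Qed.

Lemma natZp_inj (q0 m n : nat) : (m < q0.+2)%N -> (n < q0.+2)%N ->
  m%:R = n%:R :> 'Z_q0.+2 -> m = n.
Proof.
by move=> mq nq /(congr1 val); rewrite /= !val_Zp_nat// !modn_small.
Qed.

Lemma intZp_eq0 (q0 : nat) (z : int) :
  ((z%:~R : 'Z_q0.+2) == 0) = (q0.+2%:Z %| z)%Z.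
Proof.
have absE : (z%:~R == 0 :> 'Z_q0.+2) = ((`|z|%N)%:R == 0 :> 'Z_q0.+2).
  by case: z => n; rewrite ?NegzE //= mulrNz oppr_eq0.
by rewrite absE natZp_eq0 dvdzE.
Qed.

Lemma natZp_unit (q0 t : nat) : coprime t q0.+2 ->
  (t%:R : 'Z_q0.+2) \is a GRing.unit.
Proof. by rewrite unitZpE// coprime_sym. Qed.

(** * Sums of two inverses modulo q *)

Definition unit_range (q0 N : nat) (s : seq nat) : Prop :=
  uniq s /\ (forall t, t \in s -> (0 < t <= N)%N && coprime t q0.+2).

Definition inverse_pairs (q0 : nat) (s : seq nat) (b : 'Z_q0.+2) :=
  [seq p <- allpairs pair s s | (p.1%:R)^-1 + (p.2%:R)^-1 == b :> 'Z_q0.+2].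

Lemma inverse_pairsP q0 s (b : 'Z_q0.+2) N p : unit_range q0 N s ->
  p \in inverse_pairs s b ->
  [/\ p.1 \in s, p.2 \in s, (p.1%:R : 'Z_q0.+2) \is a GRing.unit,
     (p.2%:R : 'Z_q0.+2) \is a GRing.unit &
     (p.1%:R)^-1 + (p.2%:R)^-1 = b :> 'Z_q0.+2].
Proof.
move=> [_ sP]; rewrite mem_filter => /andP[/eqP pb /allpairsP[[x y] /= [xs ys pE]]].
subst p; split => //; apply: natZp_unit.
  by have /andP[] := sP _ xs.
by have /andP[] := sP _ ys.
Qed.

Lemma inverse_pairs_uniq q0 s (b : 'Z_q0.+2) N : unit_range q0 N s ->
  uniq (inverse_pairs s b).
Proof.
move=> [us _]; apply: filter_uniq; apply: allpairs_uniq => //.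
by move=> [a c] [a' c'] _ _ /= [-> ->].
Qed.

Lemma unit_range_inj q0 s N x y : unit_range q0 N s -> (N < q0.+2)%N ->
  x \in s -> y \in s -> (x%:R)^-1 = (y%:R)^-1 :> 'Z_q0.+2 -> x = y.
Proof.
move=> [_ sP] Nq /sP/andP[/andP[_ xN] _] /sP/andP[/andP[_ yN] _] /invr_inj.
by apply: natZp_inj; [exact: leq_ltn_trans xN Nq|exact: leq_ltn_trans yN Nq].
Qed.

Lemma abszB_le (x y : int) : (`|(x - y)%R| <= `|x| + `|y|)%N.
Proof. lia. Qed.

(** The 2 counts the pairs where the factored product vanishes. Each of the [2 * Kb + 1] possible
    values of [k] then leaves at most [2 * T] signed divisors. *)
Lemma inverse_pairs_good (q0 N T Rn Sn Kb : nat) (s : seq nat) (b : 'Z_q0.+2)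
    (r z : int) :
  unit_range q0 N s -> (N < q0.+2)%N -> z != 0 ->
  r%:~R * b = z%:~R -> (`|r| <= Rn)%N -> (`|z| <= Sn)%N ->
  (2 * Rn * N + Sn * N ^ 2 <= Kb * q0.+2)%N ->
  (forall n, (0 < n)%N -> (n <= Rn ^ 2 + Sn * Kb * q0.+2)%N ->
     (size (divisors n) <= T)%N) ->
  (size (inverse_pairs s b) <= 2 + (2 * Kb + 1) * (2 * T))%N.
Proof.
move=> us Nq z0 rb rR zS KbP TP; set A := inverse_pairs s b.
have uA : uniq A := inverse_pairs_uniq _ us.
have AP p (pA : p \in A) := inverse_pairsP us pA.
clearbody A.
(* Where the product vanishes the divisor bound says nothing, but then [z p1 = r] or [z p2 = r].
   Either equation fixes one entry, and the sum of inverses fixes the other. *)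
pose nz (p : nat * nat) := (z * p.1%:Z - r) * (z * p.2%:Z - r) != 0.
rewrite -(count_predC (predC nz)) -!size_filter; apply: leq_add.
  apply: (@size_inj_le _ _ _ (fun p => z * p.1%:Z - r == 0) [:: true; false]).
  - exact: filter_uniq.
  - move=> p p'; rewrite !mem_filter /= /nz !negbK !mulf_eq0 => /andP[pz pA] /andP[p'z p'A].
    have [p1 p2 _ _ pb] := AP _ pA.
    have [p'1 p'2 _ _ p'b] := AP _ p'A.
    have can (x y : nat) : z * x%:Z - r = 0 -> z * y%:Z - r = 0 -> x = y.
      move=> /eqP; rewrite subr_eq0 => /eqP xr /eqP; rewrite subr_eq0 => /eqP yr.
      by have := mulfI z0 (etrans xr (esym yr)) => -[].
    move=> E; have [e1|n1] := eqVneq (z * p.1%:Z - r) 0.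
      have e2 : z * p'.1%:Z - r = 0 by apply/eqP; rewrite -E e1.
      have E1 := can _ _ e1 e2.
      rewrite [p]surjective_pairing [p']surjective_pairing -E1; congr pair.
      apply: (unit_range_inj us Nq) => //; apply: (addrI (p.1%:R)^-1).
      by rewrite pb E1 p'b.
    have n2 : z * p'.1%:Z - r != 0 by rewrite -E.
    rewrite (negbTE n1) in pz; rewrite (negbTE n2) in p'z.
    have E1 := can _ _ (eqP pz) (eqP p'z).
    rewrite [p]surjective_pairing [p']surjective_pairing -E1; congr pair.
    apply: (unit_range_inj us Nq) => //; apply: (addIr (p.2%:R)^-1).
    by rewrite pb E1 p'b.
  - by move=> p _; case: (_ == _).
set B := (X in (size X <= _)%N).
have BA p : p \in B -> nz p && (p \in A).
  by rewrite mem_filter /= negbK.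
have uB : uniq B by exact: filter_uniq.
(* Multiplying [u(p1) + u(p2) = b] by [r p1 p2] gives [r (p1 + p2) = z p1 p2] modulo [q]; [kk] is
   the quotient by [q] of the difference. *)
pose kk (p : nat * nat) : int := ((r * (p.1 + p.2)%:Z - z * (p.1 * p.2)%:Z) %/ q0.+2%:Z)%Z.
have kkP p : p \in B ->
    r * (p.1 + p.2)%:Z - z * (p.1 * p.2)%:Z = kk p * q0.+2%:Z.
  move=> /BA/andP[_ pA]; have [p1 p2 up1 up2 pb] := AP _ pA.
  rewrite divzK// -intZp_eq0; apply/eqP.
  rewrite rmorphB !rmorphM /= -rb -pb -!pmulrn ?natrD ?natrM.
  have : (p.1%:R : 'Z_q0.+2) * (p.1%:R)^-1 = 1 by rewrite divrr.
  have : (p.2%:R : 'Z_q0.+2) * (p.2%:R)^-1 = 1 by rewrite divrr.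
  move: (_^-1) (_^-1) => u1 u2 e2 e1.
  rewrite [LHS](_ : _ = r%:~R * (p.2%:R * (1 - p.1%:R * u1) + p.1%:R * (1 - p.2%:R * u2))).
    by rewrite e1 e2 subrr !mulr0 addr0 mulr0.
  by ring.
have kkle p : p \in B -> (`|kk p| <= Kb)%N.
  move=> pB; have /andP[_ pA] := BA _ pB.
  have [p1 p2 _ _ _] := AP _ pA.
  have [_ sP] := us.
  have /andP[/andP[_ p1N] _] := sP _ p1; have /andP[/andP[_ p2N] _] := sP _ p2.
  rewrite -(@leq_pmul2r q0.+2)//; apply: leq_trans KbP.
  have -> : (`|kk p| * q0.+2 = `|(r * (p.1 + p.2)%:Z - z * (p.1 * p.2)%:Z)%R|)%N.
    by rewrite (kkP p pB) abszM.
  apply: leq_trans (abszB_le _ _) _; rewrite !abszM /=; apply: leq_add.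
    have -> : (2 * Rn * N = Rn * (N + N))%N by lia.
    by rewrite leq_mul// leq_add.
  by rewrite leq_mul// expnS expn1 leq_mul.
pose ks : seq int := [seq i%:Z - Kb%:Z | i <- iota 0 (2 * Kb + 1)].
have sks : size ks = (2 * Kb + 1)%N by rewrite size_map size_iota.
rewrite -sks mulnC; apply: (@size_fiber_le _ _ _ kk).
  move=> p /kkle pK; apply/mapP; exists `|(kk p + Kb%:Z)%R|%N; last by lia.
  by rewrite mem_iota; lia.
move=> k kks; rewrite -size_filter.
set F := (X in (size X <= _)%N).
have FP p : p \in F -> [/\ p \in B & kk p = k].
  by rewrite mem_filter => /andP[/eqP -> ->].
have prodE p : p \in F -> (z * p.1%:Z - r) * (z * p.2%:Z - r) = r ^+ 2 - z * k * q0.+2%:Z.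
  move=> /FP[pB <-]; rewrite -[z * _ * _]mulrA -(kkP _ pB) PoszD PoszM; ring.
have uF : uniq F by exact: filter_uniq.
case: F FP prodE uF => [//|p0 F] FP prodE uF.
set m := r ^+ 2 - z * k * q0.+2%:Z.
have m0 : m != 0.
  rewrite /m -(prodE p0) ?mem_head//.
  by have [/BA/andP[]] := FP p0 (mem_head _ _).
have kK : (`|k| <= Kb)%N by have [/kkle + <-] := FP p0 (mem_head _ _).
have mT : (size (divisors `|m|) <= T)%N.
  apply: TP; first by rewrite absz_gt0.
  apply: leq_trans (abszB_le _ _) _; rewrite abszX !abszM /=.
  by rewrite leq_add ?leq_exp2r// !leq_mul.
pose ds : seq int := [seq Posz d | d <- divisors `|m|] ++ [seq - Posz d | d <- divisors `|m|].
have sds : size ds = (2 * size (divisors `|m|))%N.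
  by rewrite size_cat !size_map mul2n addnn.
apply: (@leq_trans (size ds)); last by rewrite sds leq_mul2l.
apply: (@size_inj_le _ _ _ (fun p => z * p.1%:Z - r)) => //.
  move=> p p' pF p'F /(addIr (- r))/(mulfI z0) [E1].
  rewrite [p]surjective_pairing [p']surjective_pairing -E1; congr pair.
  have := etrans (prodE _ pF) (esym (prodE _ p'F)).
  rewrite -E1; have /BA/andP[nzp _] : p \in B by have [] := FP _ pF.
  have : z * p.1%:Z - r != 0 by apply: contraNneq nzp => ->; rewrite mul0r.
  by move=> h /(mulfI h)/(addIr (- r))/(mulfI z0) [].
move=> p pF; set y := z * _ - r.
have yd : (`|y| \in divisors `|m|)%N.
  rewrite -dvdn_divisors ?absz_gt0// /m -(prodE _ pF) abszM dvdn_mulr//.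
rewrite mem_cat; case: (lerP 0 y) => y0.
  by apply/orP; left; apply/mapP; exists `|y|%N => //; lia.
by apply/orP; right; apply/mapP; exists `|y|%N => //; lia.
Qed.

(** Pigeonhole on the map [(i, j) -> i b - j] over a box with more than [q] points. As [Sn < q], a
    collision with [r = 0] would force [z = 0] as well; [z = 0] alone remains possible. *)
Lemma small_multiple (q0 Rn Sn : nat) (b : 'Z_q0.+2) :
  (q0.+2 < Rn.+1 * Sn.+1)%N -> (Sn < q0.+2)%N ->
  exists r z : int,
    [/\ r != 0, (`|r| <= Rn)%N, (`|z| <= Sn)%N & r%:~R * b = z%:~R].
Proof.
move=> qRS Sq.
pose f (p : 'I_Rn.+1 * 'I_Sn.+1) : 'Z_q0.+2 := (p.1 : nat)%:R * b - (p.2 : nat)%:R.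
have /injectivePn[p [p' pp' fE]] : ~~ injectiveb f.
  apply/injectiveP => /leq_card; rewrite card_prod !card_ord leqNgt => /negP.
  by apply; exact: qRS.
have e : ((p.1 : nat)%:Z - (p'.1 : nat)%:Z)%:~R * b = ((p.2 : nat)%:Z - (p'.2 : nat)%:Z)%:~R.
  rewrite !rmorphB /= -!pmulrn mulrBl; apply/eqP; rewrite -subr_eq0.
  move: fE; rewrite /f => /eqP; rewrite -subr_eq0 => /eqP fE.
  by apply/eqP; rewrite -[RHS]fE; ring.
exists ((p.1 : nat)%:Z - (p'.1 : nat)%:Z), ((p.2 : nat)%:Z - (p'.2 : nat)%:Z).
split => //; last 2 first.
- by have := ltn_ord p.1; have := ltn_ord p'.1; lia.
- by have := ltn_ord p.2; have := ltn_ord p'.2; lia.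
apply: contra_neq pp' => E; have p1 : p.1 = p'.1 by apply: ord_inj; lia.
move: e; rewrite E mul0r => /esym/eqP; rewrite intZp_eq0 => dv.
have p2 : p.2 = p'.2.
  apply: ord_inj; have := ltn_ord p.2; have := ltn_ord p'.2.
  case/dvdzP: dv => k kE; have [k0|k0] := eqVneq k 0; first by rewrite k0 mul0r in kE; lia.
  have : (1 <= `|k|)%N by rewrite absz_gt0.
  nia.
by rewrite [p]surjective_pairing [p']surjective_pairing p1 p2.
Qed.

(** The number of solutions of [u(n1) + u(n2) = u(n3) + u(n4)], grouped by the common value [b]. *)
Definition inverse_energy (q0 : nat) (s : seq nat) : nat :=
  \sum_(b : 'Z_q0.+2) size (inverse_pairs s b) ^ 2.

Lemma sum_inverse_pairs (q0 : nat) (s : seq nat) (P : pred 'Z_q0.+2) :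
  (\sum_(b : 'Z_q0.+2 | P b) size (inverse_pairs s b) =
   size [seq p <- allpairs pair s s | P ((p.1%:R)^-1 + (p.2%:R)^-1)%R])%N.
Proof.
transitivity (\sum_(b : 'Z_q0.+2 | P b) \sum_(p <- allpairs pair s s)
    if ((p.1%:R)^-1 + (p.2%:R)^-1 == b)%R then 1%N else 0%N)%N.
  by apply: eq_bigr => b _; rewrite -big_mkcond sum1_count size_filter.
rewrite size_filter -sum1_count.
rewrite exchange_big /= [RHS]big_mkcond; apply: eq_bigr => p _ /=.
set b0 : 'Z_q0.+2 := _ + _.
case: ifP => Pp.
  rewrite (bigD1 b0)//= eqxx big1 ?addn0// => b /andP[_ /negbTE].
  by rewrite eq_sym => ->.
by rewrite big1// => b Pb; case: eqP => // E; rewrite -E Pp in Pb.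
Qed.

Lemma unit_range_size q0 N s : unit_range q0 N s -> (size s <= N)%N.
Proof.
move=> [us sP]; rewrite -(size_iota 1 N); apply: uniq_leq_size => // t /sP.
by rewrite mem_iota => /andP[/andP[t0 tN] _]; lia.
Qed.

Lemma size_inverse_pairs_le (q0 N : nat) (s : seq nat) (b : 'Z_q0.+2) :
  unit_range q0 N s -> (N < q0.+2)%N -> (size (inverse_pairs s b) <= N)%N.
Proof.
move=> us Nq; apply: leq_trans (unit_range_size us).
apply: (@size_inj_le (nat * nat)%type nat _ (fun p => p.1)).
- exact: inverse_pairs_uniq us.
- move=> p p' /(inverse_pairsP us)[p1 p2 _ _ pb] /(inverse_pairsP us)[p'1 p'2 _ _ p'b] E.
  rewrite [p]surjective_pairing [p']surjective_pairing -E; congr pair.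
  by apply: (unit_range_inj us Nq) => //; apply: (addrI (p.1%:R)^-1); rewrite pb E p'b.
- by move=> p /(inverse_pairsP us)[].
Qed.

Lemma count_dvd_pairs (q0 N g : nat) (s : seq nat) :
  unit_range q0 N s -> (0 < g)%N ->
  (count (fun p : nat * nat => g %| p.1 + p.2) (allpairs pair s s)
     <= N * ((2 * N) %/ g))%N.
Proof.
move=> us g0; have [uns sP] := us.
rewrite -size_filter; set A := (X in (size X <= _)%N).
have AP p : p \in A -> [/\ (g %| p.1 + p.2)%N, p.1 \in s & p.2 \in s].
  rewrite mem_filter => /andP[-> /allpairsP[[x y] [xs ys ->]]] //.
have uA : uniq A.
  by apply: filter_uniq; apply: allpairs_uniq => // -[a c] [a' c'] _ _ /= [-> ->].
clearbody A.
apply: (@leq_trans (size (allpairs pair s (iota 1 ((2 * N) %/ g))))); last first.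
  by rewrite size_allpairs size_iota leq_mul// (unit_range_size us).
apply: (@size_inj_le (nat * nat)%type (nat * nat)%type _
  (fun p => (p.1, (p.1 + p.2) %/ g)%N)) => //.
  move=> p p' /AP[gp _ _] /AP[gp' _ _] [E1 E2].
  rewrite [p]surjective_pairing [p']surjective_pairing -E1; congr pair.
  apply: (@addnI p.1); rewrite -(divnK gp) E2 E1 divnK//.
move=> p /AP[gp p1 p2]; apply/allpairsP; exists (p.1, (p.1 + p.2) %/ g)%N.
split => //; rewrite mem_iota /= add1n ltnS.
have /andP[/andP[p10 p1N] _] := sP _ p1; have /andP[/andP[_ p2N] _] := sP _ p2.
rewrite divn_gt0// leq_div2r ?andbT; last by rewrite mul2n -addnn leq_add.
by apply: dvdn_leq => //; rewrite addn_gt0 p10.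
Qed.

(** One factor of each square is bounded uniformly (by [G], or trivially by [N]) and the other is
    summed over [b], so that pairs are counted. The [.+1] in the divisor hypothesis puts [q] itself
    in range, since its divisors are enumerated too. *)
Lemma inverse_energy_bound (q0 N T Rn Sn Kb : nat) (s : seq nat) :
  unit_range q0 N s -> (N < q0.+2)%N ->
  (q0.+2 < Rn.+1 * Sn.+1)%N -> (Sn < q0.+2)%N ->
  (2 * Rn * N + Sn * N ^ 2 <= Kb * q0.+2)%N ->
  (forall n, (0 < n)%N -> (n <= Rn ^ 2 + (Sn * Kb).+1 * q0.+2)%N ->
     (size (divisors n) <= T)%N) ->
  (inverse_energy q0 s <=
   (2 + (2 * Kb + 1) * (2 * T)) * N ^ 2 + N * (N * ((2 * N * Rn) %/ q0.+2) * T))%N.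
Proof.
move=> us Nq qRS Sq KbP TP; set G := (2 + _)%N.
have [uns sP] := us.
have sN := unit_range_size us.
(* If [z = 0] then [q] divides [r b], hence [r gcd(b, q)], so [q <= Rn * gcd(b, q)]; outside [bad]
   the short vector therefore has [z != 0]. *)
pose bad (b : 'Z_q0.+2) := (q0.+2 <= Rn * gcdn b q0.+2)%N.
have good b : ~~ bad b -> (size (inverse_pairs s b) <= G)%N.
  move=> nb; have [r [z [r0 rR zS rb]]] := small_multiple b qRS Sq.
  have [z0|z0] := eqVneq z 0; last first.
    apply: (inverse_pairs_good us Nq z0 rb rR zS KbP) => n n0 nle.
    by apply: TP => //; apply: leq_trans nle _; lia.
  case/negP: nb; rewrite /bad; move: rb; rewrite z0 => /eqP.
  rewrite -{1}[b]natr_Zp [(b : nat)%:R]pmulrn -rmorphM /= intZp_eq0 => /dvdzP[k kE].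
  have dv : (q0.+2 %| `|r| * b)%N by apply/dvdnP; exists `|k|%N; nia.
  have r0' : (0 < `|r|)%N by rewrite absz_gt0.
  apply: leq_trans (_ : `|r| * gcdn b q0.+2 <= _)%N; last by rewrite leq_mul2r rR orbT.
  rewrite muln_gcdr dvdn_leq// ?dvdn_gcd ?dv ?dvdn_mull//.
  by rewrite gcdn_gt0 orbC muln_gt0 r0'.
rewrite /inverse_energy (bigID bad) /= addnC; apply: leq_add.
  apply: (@leq_trans (\sum_(b : 'Z_q0.+2 | ~~ bad b) G * size (inverse_pairs s b))).
    by apply: leq_sum => b nb; rewrite expnS expn1 leq_mul// good.
  rewrite -big_distrr /= leq_mul2l; apply/orP; right.
  rewrite sum_inverse_pairs size_filter (leq_trans (count_size _ _))// size_allpairs.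
  by rewrite expnS expn1 leq_mul.
apply: (@leq_trans (\sum_(b : 'Z_q0.+2 | bad b) N * size (inverse_pairs s b))).
  by apply: leq_sum => b nb; rewrite expnS expn1 leq_mul// (size_inverse_pairs_le b us Nq).
rewrite -big_distrr /= leq_mul2l; apply/orP; right.
rewrite sum_inverse_pairs; set A := (X in (size X <= _)%N).
have AP p : p \in A -> [/\ bad ((p.1%:R)^-1 + (p.2%:R)^-1), p.1 \in s, p.2 \in s & p \in allpairs pair s s].
  rewrite mem_filter => /andP[bp pp]; have /allpairsP[[x y] /= [xs ys pE]] := pp.
  by split => //; rewrite pE.
pose gg (p : nat * nat) := gcdn ((p.1%:R)^-1 + (p.2%:R)^-1 : 'Z_q0.+2)%R q0.+2.
apply: (@leq_trans (N * ((2 * N * Rn) %/ q0.+2) * size [seq g <- divisors q0.+2 | (q0.+2 <= Rn * g)%N])%N); last first.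
  rewrite leq_mul2l; apply/orP; right; rewrite size_filter (leq_trans (count_size _ _))//.
  by apply: TP => //; rewrite mulSn addnCA leq_addr.
apply: (@size_fiber_le (nat * nat)%type nat _ gg).
  move=> p /AP[bp p1 p2 _]; rewrite mem_filter -dvdn_divisors//.
  apply/andP; split; first exact: bp.
  exact: dvdn_gcdr.
move=> g; rewrite mem_filter -dvdn_divisors// => /andP[qg gq].
have g0 : (0 < g)%N by exact: dvdn_gt0 gq.
apply: (@leq_trans (N * ((2 * N) %/ g))); last first.
  rewrite leq_mul2l; apply/orP; right; rewrite leq_divRL//.
  rewrite -(leq_pmul2r g0) mulnAC.
  apply: (@leq_trans (2 * N * q0.+2)); first by rewrite leq_mul// leq_divM.
  by rewrite -[leqRHS]mulnA leq_mul2l qg orbT.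
apply: leq_trans (count_dvd_pairs us g0).
rewrite count_filter -!size_filter; apply: uniq_leq_size.
  by apply: filter_uniq; apply: allpairs_uniq => // -[a c] [a' c'] _ _ /= [-> ->].
move=> p; rewrite !mem_filter => /andP[/andP[/eqP gE bp] pp]; rewrite pp andbT.
have [xs ys] : p.1 \in s /\ p.2 \in s.
  by have /allpairsP[[x y] /= [xs ys ->]] := pp.
have ux : (p.1%:R : 'Z_q0.+2) \is a GRing.unit by apply: natZp_unit; have /andP[] := sP _ xs.
have uy : (p.2%:R : 'Z_q0.+2) \is a GRing.unit by apply: natZp_unit; have /andP[] := sP _ ys.
set b := ((p.1%:R)^-1 + (p.2%:R)^-1 : 'Z_q0.+2) in gE bp.
rewrite /gg -/b in gE.
(* Clearing denominators in the definition of [b]; since [g] divides both [b] and [q], it divides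
   [p1 + p2]. *)
have bE : (p.1 + p.2)%:R = ((b : nat) * (p.1 * p.2))%:R :> 'Z_q0.+2.
  rewrite natrM natr_Zp natrM natrD /b mulrDl mulrA mulVr// mul1r.
  by rewrite mulrCA mulVr// mulr1 addrC.
have gb : (g %| b)%N by rewrite -gE dvdn_gcdl.
have mE := natZp_mod bE.
rewrite /dvdn -(modn_dvdm _ gq) mE (modn_dvdm _ gq).
exact: dvdn_mulr.
Qed.

(** * Frequencies weighted by the Fourier decay of an interval *)

Lemma sum_fiber_le (R : realType) (X Y : eqType) (A : seq X) (g : X -> Y)
    (s : seq Y) (w : Y -> R) (c : nat) :
  (forall y, y \in s -> 0 <= w y) ->
  (forall x, x \in A -> g x \in s) ->
  (forall y, y \in s -> count (fun x => g x == y) A <= c)%N ->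
  \sum_(x <- A) w (g x) <= c%:R * \sum_(y <- s) w y.
Proof.
move=> w0 gAs fib.
apply: (@le_trans _ _ (\sum_(y <- s) (count (fun x => g x == y) A)%:R * w y)).
  under [leRHS]eq_bigr => y _.
    rewrite -sum1_count natr_sum mulr_suml big_mkcond.
  over.
  rewrite exchange_big /= big_seq [leRHS]big_seq; apply: ler_sum => x xA.
  have xs := gAs x xA; rewrite (big_rem _ xs) /= eqxx mul1r lerDl.
  rewrite big_seq; apply: sumr_ge0 => y /mem_rem ys; case: ifP => // _.
  by rewrite mul1r w0.
rewrite mulr_sumr big_seq [leRHS]big_seq; apply: ler_sum => y ys.
by rewrite ler_wpM2r ?w0// ler_nat fib.
Qed.

(** The least absolute residue: [q] times the distance from [k / q] to the nearest integer. *)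
Definition zabs (q0 : nat) (k : 'Z_q0.+2) : nat := minn k (q0.+2 - k).

Lemma ltn_Zp (q0 : nat) (k : 'Z_q0.+2) : (k < q0.+2)%N.
Proof. exact: ltn_ord. Qed.

Lemma Zp_gt0 (q0 : nat) (k : 'Z_q0.+2) : k != 0 -> (0 < k)%N.
Proof. by move=> k0; rewrite lt0n; apply: contra k0 => /eqP k0; apply/eqP/val_inj. Qed.

Lemma val_oppZp (q0 : nat) (k : 'Z_q0.+2) : k != 0 ->
  (- k : 'Z_q0.+2) = (q0.+2 - k)%N :> nat.
Proof.
move=> k0; have k1 := Zp_gt0 k0; have kq := ltn_Zp k.
have -> : - k = (q0.+2 - k)%N%:R.
  rewrite natrB; last exact: ltnW.
  by rewrite natr_Zp natZp_modulus sub0r.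
by rewrite val_Zp_nat// modn_small//; lia.
Qed.

Lemma zabs_gt0 (q0 : nat) (k : 'Z_q0.+2) : k != 0 -> (0 < zabs k)%N.
Proof.
by move=> /Zp_gt0 k0; have kq := ltn_Zp k; rewrite /zabs leq_min k0 subn_gt0.
Qed.

Lemma zabsE (q0 : nat) (k : 'Z_q0.+2) :
  (zabs k)%:R = if (k <= q0.+2 - k)%N then k else - k.
Proof.
rewrite /zabs; case: leqP => h; first by rewrite natr_Zp.
rewrite natrB; last by rewrite ltnW// ltn_Zp.
by rewrite natr_Zp natZp_modulus sub0r.
Qed.

Lemma zabs_lt (q0 : nat) (k : 'Z_q0.+2) : (zabs k < q0.+2)%N.
Proof. by apply: leq_ltn_trans (geq_minl _ _) (ltn_Zp k). Qed.

Definition harm (R : realType) (n : nat) : R := \sum_(1 <= j < n) j%:R^-1.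

(** With [Y = N1 / q] this is the bound for the Fourier transform of an interval of length [N1],
    divided by [q]. *)
Definition freq_weight (R : realType) (q0 : nat) (Y : R) (k : 'Z_q0.+2) : R :=
  Num.min Y (zabs k)%:R^-1.

Lemma freq_weight_ge0 (R : realType) (q0 : nat) (Y : R) (k : 'Z_q0.+2) :
  0 <= Y -> 0 <= freq_weight Y k.
Proof. by move=> Y0; rewrite le_min Y0 invr_ge0 ler0n. Qed.

(* [freq_mass Y s z ^ 2] summed over [z] counts, with weights, the solutions of
   [k t = k' t']. *)
Definition freq_mass (R : realType) (q0 : nat) (Y : R) (s : seq nat)
    (z : 'Z_q0.+2) : R :=
  \sum_(p <- [seq p <- allpairs pair [seq k <- enum 'Z_q0.+2 | k != 0] s
                | p.1 * p.2%:R == z]) freq_weight Y p.1.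

Section FreqMass.
Variables (R : realType) (q0 N T : nat) (Y : R) (s : seq nat).
Hypotheses (us : unit_range q0 N s) (Nq : (N < q0.+2)%N) (Y0 : 0 <= Y).
Hypothesis TP : forall n, (0 < n)%N -> (n <= q0.+2 * N)%N ->
  (size (divisors n) <= T)%N.

(** Since [t <= N], the weight [1 / |k|] is at most [N / (|k| t)]: [g] bounds it through the product
    [n = |k| t] alone. *)
Let g (n : nat) : R := Num.min Y (N%:R / n%:R).

Let g0 n : 0 <= g n.
Proof. by rewrite le_min Y0 divr_ge0. Qed.

Lemma harm_ge0 n : 0 <= harm R n.
Proof. by apply: sumr_ge0 => j _; rewrite invr_ge0. Qed.

Lemma harm_le m n : (m <= n)%N -> harm R m <= harm R n.
Proof.
move=> mn; rewrite /harm; have [m1|m1] := leqP m 1.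
  by rewrite big_geq// harm_ge0.
rewrite (@big_cat_nat _ _ _ m 1 n) //=; last exact: ltnW.
by rewrite lerDl; apply: sumr_ge0 => j _; rewrite invr_ge0.
Qed.

Let progression (r : nat) := [seq (r + j * q0.+2)%N | j <- iota 0 N].

(** Only the term [j = 0] can be large; the others are at most [N / (j q)]. *)
Let sum_progression (r : nat) :
  \sum_(n <- progression r) g n <= g r + N%:R / q0.+2%:R * harm R q0.+2.
Proof.
rewrite /progression big_map; case: (posnP N) => [->|Np].
  by rewrite big_nil addr_ge0// !mul0r.
have -> : iota 0 N = index_iota 0 N by rewrite /index_iota subn0.
rewrite big_ltn// mul0n addn0 lerD2l.
apply: (@le_trans _ _ (N%:R / q0.+2%:R * harm R N)); last first.
  by rewrite ler_wpM2l ?divr_ge0// harm_le// ltnW.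
rewrite /harm mulr_sumr big_nat_cond [leRHS]big_nat_cond; apply: ler_sum => j.
rewrite andbT => /andP[j0 _]; rewrite ge_min; apply/orP; right.
rewrite -mulrA ler_wpM2l// -invfM lef_pV2 ?posrE ?mulr_gt0 ?ltr0n ?addn_gt0 ?muln_gt0 ?j0 ?orbT//.
by rewrite -natrM ler_nat mulnC leq_addl.
Qed.

(** If [k t = z], the integer [|k| t] is below [q N] and congruent to [z] or [- z], so it lies in
    one of two progressions of length [N]. It determines [(k, t)] up to a sign and the choice of a
    divisor, whence [2 * T]. *)
Lemma freq_mass_le (z : 'Z_q0.+2) : z != 0 ->
  freq_mass Y s z <=
    (2 * T)%:R * (g z + g (- z : 'Z_q0.+2) + 2 * (N%:R / q0.+2%:R * harm R q0.+2)).
Proof.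
move=> z0; rewrite /freq_mass; set A := (X in \sum_(p <- X) _).
have [uns sP] := us.
have AP p : p \in A -> [/\ p.1 != 0, p.2 \in s & p.1 * p.2%:R = z].
  rewrite mem_filter => /andP[/eqP pz /allpairsP[[k t] /= [ks ts pE]]].
  by move: ks; rewrite mem_filter pE => /andP[-> _]; rewrite -pz pE.
have uA : uniq A.
  apply: filter_uniq; apply: allpairs_uniq => //.
    by apply: filter_uniq; exact: enum_uniq.
  by move=> [a c] [a' c'] _ _ /= [-> ->].
clearbody A.
pose nn (p : 'Z_q0.+2 * nat) := (zabs p.1 * p.2)%N.
pose L := progression z ++ progression (- z : 'Z_q0.+2).
apply: (@le_trans _ _ (\sum_(p <- A) g (nn p))).
  rewrite big_seq [leRHS]big_seq; apply: ler_sum => p /AP[p0 ps _].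
  have /andP[/andP[t0 tN] _] := sP _ ps.
  rewrite /freq_weight /g le_min ge_min lexx /= ge_min; apply/orP; right.
  rewrite /nn natrM invfM mulrCA -{1}[_^-1]mulr1 ler_wpM2l ?invr_ge0//.
  by rewrite ler_pdivlMr ?ltr0n// mul1r ler_nat.
apply: (@le_trans _ _ ((2 * T)%:R * \sum_(n <- L) g n)); last first.
  rewrite ler_wpM2l// big_cat /=.
  have := lerD (sum_progression z) (sum_progression (- z : 'Z_q0.+2)).
  by move=> /le_trans; apply; rewrite mulr2n mulrDl mul1r addrACA.
have nn_lt p : p \in A -> (nn p < q0.+2 * N)%N.
  move=> /AP[p0 ps _]; have /andP[/andP[t0 tN] _] := sP _ ps.
  apply: leq_ltn_trans (leq_mul (leqnn _) tN) _.
  by rewrite ltn_pmul2r ?zabs_lt// (leq_trans t0).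
have nnL p : p \in A -> nn p \in L.
  move=> pA; have [p0 ps pz] := AP p pA; have nq := nn_lt p pA.
  have [e|e] : (nn p)%:R = z \/ (nn p)%:R = - z.
    rewrite /nn natrM zabsE; case: ifP => _; rewrite -pz ?mulNr; by [left|right].
    rewrite mem_cat; apply/orP; left; apply/mapP; exists (nn p %/ q0.+2)%N.
      by rewrite mem_iota /= add0n ltn_divLR// mulnC.
    by rewrite -e val_Zp_nat// addnC -divn_eq.
  rewrite mem_cat; apply/orP; right; apply/mapP; exists (nn p %/ q0.+2)%N.
    by rewrite mem_iota /= add0n ltn_divLR// mulnC.
  by rewrite -e val_Zp_nat// addnC -divn_eq.
apply: sum_fiber_le => // n nL; rewrite -size_filter.
set F := (X in (size X <= _)%N).
have FP p : p \in F -> p \in A /\ nn p = n.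
  by rewrite mem_filter => /andP[/eqP -> ->].
have uF : uniq F by exact: filter_uniq.
clearbody F; case: F FP uF => // p0 F FP uF.
have n0 : (0 < n)%N /\ (n <= q0.+2 * N)%N.
  have [/AP[k0 ts _] <-] := FP p0 (mem_head _ _).
  have /andP[/andP[t0 tN] _] := sP _ ts.
  by rewrite /nn muln_gt0 zabs_gt0// t0 leq_mul// ltnW// zabs_lt.
have [n1 n2] := n0.
apply: (@leq_trans (size (allpairs pair [:: true; false] (divisors n)))); last first.
  by rewrite size_allpairs leq_mul//= TP.
apply: (@size_inj_le ('Z_q0.+2 * nat)%type (bool * nat)%type _
  (fun p => ((p.1 <= q0.+2 - p.1)%N, zabs p.1))) => //.
  move=> p p' /FP[/AP[k0 _ _] pn] /FP[/AP[k'0 _ _] p'n] [E1 E2].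
  have K1 : p.1 = p'.1.
    have := congr1 (fun m => m%:R : 'Z_q0.+2) E2; rewrite !zabsE E1.
    by case: ifP => _ // /oppr_inj.
  rewrite [p]surjective_pairing [p']surjective_pairing -K1; congr pair.
  move: pn p'n; rewrite /nn -K1 => <- /esym/eqP.
  by rewrite eqn_pmul2l ?zabs_gt0// => /eqP.
move=> p /FP[/AP[k0 _ _] pn]; apply/allpairsP.
exists ((p.1 <= q0.+2 - p.1)%N, zabs p.1); split => //=.
  by case: (_ <= _)%N.
by rewrite -dvdn_divisors// -pn dvdn_mulr.
Qed.

Let sum_g2 : \sum_(z : 'Z_q0.+2 | z != 0) g z ^+ 2 <= Y * N%:R * harm R q0.+2.
Proof.
rewrite -(big_mkord (fun i => i != 0%N) (fun i => g i ^+ 2)) big_ltn_cond//=.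
rewrite /harm mulr_sumr big_mkcond /=; apply: ler_sum_nat => j /andP[j0 _].
rewrite -lt0n j0.
rewrite expr2 -mulrA; apply: ler_pM => //; first by rewrite ge_min lexx.
by rewrite ge_min lexx orbT.
Qed.

Let freq_mass0 : freq_mass Y s (0 : 'Z_q0.+2) = 0.
Proof.
rewrite /freq_mass big1_seq// => p /=.
rewrite mem_filter => /andP[/eqP pz /allpairsP[[k t] /= [ks ts pE]]].
have tu : (t%:R : 'Z_q0.+2) \is a GRing.unit.
  by apply: natZp_unit; have [_ sP] := us; have /andP[] := sP _ ts.
move: pz; rewrite pE /= => /(canRL (mulrK tu)); rewrite mul0r => k0.
by move: ks; rewrite mem_filter k0 eqxx.
Qed.

Lemma freq_mass_ge0 (z : 'Z_q0.+2) : 0 <= freq_mass Y s z.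
Proof. by apply: sumr_ge0 => p _; exact: freq_weight_ge0. Qed.

Lemma freq_mass_square_sum :
  \sum_(z : 'Z_q0.+2) freq_mass Y s z ^+ 2 <=
    24 * T%:R ^+ 2 * (Y * N%:R * harm R q0.+2
       + 2 * N%:R ^+ 2 * harm R q0.+2 ^+ 2 / q0.+2%:R).
Proof.
have H0 := harm_ge0 q0.+2; have sg := sum_g2.
move: (harm R q0.+2) H0 sg freq_mass_le => H H0 sg fm.
set c := N%:R / q0.+2%:R * H in fm *.
have c0 : 0 <= c by rewrite mulr_ge0.
rewrite (bigD1 0)//= freq_mass0 expr0n /= add0r.
have cE0 : c = N%:R / q0.+2%:R * H by [].
(* Cauchy-Schwarz for three terms costs 3 and the square of [2 * T] costs 4; the terms at [z] and
   [- z] have equal sums, and the resulting 2 makes the 24. *)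
apply: (@le_trans _ _ (\sum_(z : 'Z_q0.+2 | z != 0)
   (12 * T%:R ^+ 2) * (g z ^+ 2 + g (- z : 'Z_q0.+2) ^+ 2 + 4 * c ^+ 2))).
  apply: ler_sum => z z0.
  apply: (@le_trans _ _ (((2 * T)%:R * (g z + g (- z : 'Z_q0.+2) + 2 * c)) ^+ 2)).
    by apply: lerXn2r; rewrite ?nnegrE ?freq_mass_ge0 ?fm// mulr_ge0// !addr_ge0// mulr_ge0.
  rewrite natrM; move: (g (- z : 'Z_q0.+2)) (g z) (T%:R : R) => y x t; clearbody c.
  have : 0 <= t ^+ 2 * ((x - y) ^+ 2 + (x - 2 * c) ^+ 2 + (y - 2 * c) ^+ 2).
    by rewrite mulr_ge0 ?addr_ge0 ?sqr_ge0.
  move=> h; rewrite -subr_ge0.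
  rewrite [leRHS](_ : _ = 4 * (t ^+ 2 *
    ((x - y) ^+ 2 + (x - 2 * c) ^+ 2 + (y - 2 * c) ^+ 2))); last by ring.
  by rewrite mulr_ge0.
rewrite -mulr_sumr -[24]/(12 * 2)%:R natrM.
rewrite (mulrAC 12%:R 2%:R) -[leRHS]mulrA ler_wpM2l ?mulr_ge0 ?sqr_ge0//.
rewrite !big_split /= sumr_const.
have oppE : \sum_(z : 'Z_q0.+2 | z != 0) g (- z : 'Z_q0.+2) ^+ 2 =
    \sum_(z : 'Z_q0.+2 | z != 0) g z ^+ 2.
  rewrite [RHS](reindex_inj oppr_inj) /=; apply: eq_bigl => z.
  by rewrite oppr_eq0.
have cardq : (#|[pred z : 'Z_q0.+2 | z != 0%R]| <= q0.+2)%N.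
  by apply: leq_trans (max_card _) _; rewrite card_ord.
have cE : 4 * c ^+ 2 *+ #|[pred z : 'Z_q0.+2 | z != 0%R]| <= 4 * N%:R ^+ 2 * H ^+ 2 / q0.+2%:R.
  apply: (@le_trans _ _ (4 * c ^+ 2 * q0.+2%:R)).
    by rewrite -mulr_natr ler_wpM2l ?mulr_ge0 ?sqr_ge0// ler_nat.
  rewrite /c le_eqVlt; apply/orP; left; apply/eqP.
  have : (q0.+2%:R : R) != 0 by rewrite pnatr_eq0.
  by move: (q0.+2%:R : R) => Q Q0; field.
have -> : 2%:R * (Y * N%:R * H + 2 * N%:R ^+ 2 * H ^+ 2 / q0.+2%:R) =
  (Y * N%:R * H + Y * N%:R * H) + 4 * N%:R ^+ 2 * H ^+ 2 / q0.+2%:R :> R.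
  by rewrite mulrDr mulr_natl mulr2n !mulrA -natrM.
by rewrite lerD// oppE lerD.
Qed.
End FreqMass.

(** * Additive characters *)

Section AdditiveCharacter.
Variables (R : realType) (q0 : nat).
Local Notation Zq := 'Z_q0.+2.

(** The additive character [e(v / q)] is carried as its real part [ec] and imaginary part [es], so
    that all estimates stay in [R]. *)
Definition ec (v : Zq) : R := cos ((v : nat)%:R * (pi *+ 2 / q0.+2%:R)).
Definition es (v : Zq) : R := sin ((v : nat)%:R * (pi *+ 2 / q0.+2%:R)).

Lemma angleE (n : nat) : n%:R * (pi *+ 2 / q0.+2%:R) =
  (n %% q0.+2)%:R * (pi *+ 2 / q0.+2%:R) + pi *+ 2 *+ (n %/ q0.+2) :> R.
Proof.
have q1 : (q0.+2%:R : R) != 0 by rewrite pnatr_eq0.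
rewrite {1}(divn_eq n q0.+2) natrD natrM -[pi *+ 2 *+ _]mulr_natr.
by move: (q0.+2%:R : R) q1 => Q Q0; move: (pi *+ 2) => P; field.
Qed.

Lemma ec_nat (n : nat) : ec n%:R = cos (n%:R * (pi *+ 2 / q0.+2%:R)).
Proof.
rewrite /ec val_Zp_nat// [in RHS]angleE; elim: (n %/ _)%N => [|m IH].
  by rewrite mulr0n addr0.
by rewrite [pi *+ 2 *+ _.+1]mulrSr addrA cosD2pi.
Qed.

Lemma es_nat (n : nat) : es n%:R = sin (n%:R * (pi *+ 2 / q0.+2%:R)).
Proof.
rewrite /es val_Zp_nat// [in RHS]angleE; elim: (n %/ _)%N => [|m IH].
  by rewrite mulr0n addr0.
by rewrite [pi *+ 2 *+ _.+1]mulrSr addrA sinD2pi.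
Qed.

Lemma ecD (v w : Zq) : ec (v + w) = ec v * ec w - es v * es w.
Proof.
have -> : v + w = ((v : nat) + (w : nat))%:R by rewrite natrD !natr_Zp.
by rewrite ec_nat natrD mulrDl cosD.
Qed.

Lemma esD (v w : Zq) : es (v + w) = es v * ec w + ec v * es w.
Proof.
have -> : v + w = ((v : nat) + (w : nat))%:R by rewrite natrD !natr_Zp.
by rewrite es_nat natrD mulrDl sinD.
Qed.

Lemma ec0 : ec 0 = 1. Proof. by rewrite /ec mul0r cos0. Qed.
Lemma es0 : es 0 = 0. Proof. by rewrite /es mul0r sin0. Qed.

Lemma ec2Des2 (v : Zq) : ec v ^+ 2 + es v ^+ 2 = 1.
Proof. exact: cos2Dsin2. Qed.

Lemma ecB (v w : Zq) : ec (v - w) = ec v * ec w + es v * es w.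
Proof.
have h1 := ecD (v - w) w; have h2 := esD (v - w) w; rewrite subrK in h1 h2.
have h3 := ec2Des2 w.
by rewrite h1 h2 -[LHS]mulr1 -h3; ring.
Qed.

Lemma ecN (v : Zq) : ec (- v) = ec v.
Proof. by rewrite -sub0r ecB ec0 es0 mul1r mul0r addr0. Qed.

Lemma ec_le1 (v : Zq) : `|ec v| <= 1.
Proof. by rewrite ler_norml cos_geN1 cos_le1. Qed.

(* Doubling the angle at most doubles the chord [|1 - e(x)|], and some doubling
   of a nonzero angle lands in the half plane [cos <= 0]. *)
Lemma chord_ge (k : nat) : (0 < k)%N -> (2 * k <= q0.+2)%N ->
  4 * (k%:R / q0.+2%:R) ^+ 2 <= 2 - 2 * cos (k%:R * (pi *+ 2 / q0.+2%:R)) :> R.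
Proof.
have q1 : 0 < (q0.+2%:R : R) by rewrite ltr0n.
(* The angle doubles at each step, so it is the distance from [k] to [q] that decreases. *)
have [m] := ubnP (q0.+2 - k); elim: m k => // m IH k km k0 kq.
have kqR : 2 * (k%:R / q0.+2%:R) <= 1 :> R.
  by rewrite mulrA ler_pdivrMr// mul1r -natrM ler_nat.
have x0 : 0 <= k%:R / q0.+2%:R :> R by rewrite divr_ge0.
have [k4|k4] := ltnP (4 * k) q0.+2.
  have := IH (2 * k)%N _ _ _; rewrite natrM -!mulrA => h.
  have {}h : 4 * (2 * (k%:R / q0.+2%:R)) ^+ 2 <=
     2 - 2 * cos (2 * (k%:R * (pi *+ 2 / q0.+2%:R))) :> R by apply: h; lia.
  have dbl (y : R) : cos (2 * y) = 2 * cos y ^+ 2 - 1.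
    by rewrite mulr_natl mulr2n cosD -!expr2 sin2cos2; ring.
  move: h; rewrite dbl.
  move: (cos _) (cos_le1 (k%:R * (pi *+ 2 / q0.+2%:R) : R)) => c c1.
  by have := sqr_ge0 (c - 1); move: (k%:R / _) => x; nra.
have pi0 := pi_gt0 R.
have xq : (k%:R * (pi *+ 2 / q0.+2%:R) : R) = (2 * (k%:R / q0.+2%:R)) * pi.
  by rewrite -mulr_natr; move: (q0.+2%:R : R) q1 => Q Q0; field; lra.
have x4 : 1 <= 4 * (k%:R / q0.+2%:R) :> R.
  by rewrite mulrA ler_pdivlMr// mul1r -natrM ler_nat.
rewrite xq; move: (k%:R / _) x0 kqR x4 => x x0 kqR x4 {xq}.
have : 0 <= cos (2 * x * pi - pi).
  by apply: cos_ge0_pihalf; apply/andP; split; nra.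
have -> : cos (2 * x * pi) = - cos (2 * x * pi - pi).
  by rewrite -cosDpi subrK.
nra.
Qed.

Lemma ec_chord (v : Zq) : v != 0 ->
  4 * ((zabs v)%:R / q0.+2%:R) ^+ 2 <= 2 - 2 * ec v.
Proof.
move=> v0; have -> : ec v = ec (zabs v)%:R.
  by rewrite zabsE; case: ifP => _ //; rewrite ecN.
rewrite ec_nat; apply: chord_ge; first exact: zabs_gt0.
by rewrite /zabs; have := ltn_Zp v; lia.
Qed.

Lemma ec_neq1 (v : Zq) : v != 0 -> ec v < 1.
Proof.
move=> v0; have := ec_chord v0.
have : 0 < ((zabs v)%:R / q0.+2%:R : R) ^+ 2.
  by rewrite exprn_gt0// divr_gt0// ltr0n// zabs_gt0.
by move: (_ ^+ 2) => X; lra.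
Qed.

(** Translating [h] by [h0] preserves the index set and multiplies the complex sum by [e(h0 y / q)],
    which differs from 1. *)
Lemma sum_ec_translate (P : pred Zq) (h0 y : Zq) :
  (forall h, P (h + h0) = P h) -> h0 * y != 0 ->
  \sum_(h : Zq | P h) ec (h * y) = 0.
Proof.
move=> Ph y0; set S := LHS; pose S' := \sum_(h : Zq | P h) es (h * y).
have e1 : S = S * ec (h0 * y) - S' * es (h0 * y).
  rewrite {1}/S (reindex_inj (addIr h0)) /= mulr_suml mulr_suml -sumrB.
  by apply: eq_big => // h _; rewrite mulrDl ecD.
have e2 : S' = S' * ec (h0 * y) + S * es (h0 * y).
  rewrite {1}/S' (reindex_inj (addIr h0)) /= mulr_suml mulr_suml -big_split.
  by apply: eq_big => // h _; rewrite mulrDl esD.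
have c1 := ec_neq1 y0.
clearbody S S'; move: (ec _) (es _) c1 e1 e2 => c s c1 e1 e2.
(* The determinant of the real 2 by 2 system, namely the squared modulus of [1 - e(h0 y / q)]. *)
have h : ((1 - c) ^+ 2 + s ^+ 2) * S = 0.
  have E1 : (1 - c) * S = - (S' * s) by lra.
  have E2 : (1 - c) * S' = S * s by lra.
  rewrite mulrDl expr2 -mulrA E1.
  have -> : (1 - c) * - (S' * s) + s ^+ 2 * S = - ((1 - c) * S' - S * s) * s by ring.
  by rewrite E2 subrr oppr0 mul0r.
move/eqP: h; rewrite mulf_eq0 => /orP[|/eqP//].
by rewrite gt_eqF// ltr_wpDr ?sqr_ge0// exprn_gt0// subr_gt0.
Qed.

Lemma sum_ec (y : Zq) : \sum_(h : Zq) ec (h * y) = (q0.+2 * (y == 0))%:R.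
Proof.
have [->|y0] := eqVneq y 0.
  under eq_bigr do rewrite mulr0 ec0.
  by rewrite sumr_const card_ord muln1.
by rewrite muln0 (sum_ec_translate (h0 := 1)) ?mul1r.
Qed.

Lemma norm2_sum (I : Type) (r : seq I) (a : I -> R) (v : I -> Zq) :
  (\sum_(i <- r) a i * ec (v i)) ^+ 2 + (\sum_(i <- r) a i * es (v i)) ^+ 2 =
  \sum_(i <- r) \sum_(j <- r) a i * a j * ec (v i - v j).
Proof.
rewrite !expr2 !mulr_suml -big_split; apply: eq_bigr => i _ /=.
rewrite !mulr_sumr -big_split; apply: eq_bigr => j _ /=.
rewrite ecB; ring.
Qed.

Lemma norm2_sum_le (I : Type) (r : seq I) (a : I -> R) (v : I -> Zq) :
  (forall i, `|a i| <= 1) ->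
  (\sum_(i <- r) a i * ec (v i)) ^+ 2 + (\sum_(i <- r) a i * es (v i)) ^+ 2 <=
    (size r)%:R ^+ 2.
Proof.
move=> a1; rewrite norm2_sum.
apply: (@le_trans _ _ (\sum_(i <- r) \sum_(j <- r) (1 : R))).
  apply: ler_sum => i _; apply: ler_sum => j _.
  apply: le_trans (ler_norm _) _; rewrite !normrM.
  by rewrite mulr_ile1 ?mulr_ge0 ?ec_le1// mulr_ile1.
by rewrite !big_const_seq !count_predT !iter_addr_0 expr2 mulr_natr.
Qed.

End AdditiveCharacter.

Lemma cauchy_schwarz_sum (R : realType) (I : Type) (r : seq I) (a b : I -> R) :
  (\sum_(i <- r) a i * b i) ^+ 2 <=
    (\sum_(i <- r) a i ^+ 2) * (\sum_(i <- r) b i ^+ 2).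
Proof.
(* Lagrange's identity. *)
have : 0 <= \sum_(i <- r) \sum_(j <- r) (a i * b j - a j * b i) ^+ 2.
  by apply: sumr_ge0 => i _; apply: sumr_ge0 => j _; exact: sqr_ge0.
have -> : \sum_(i <- r) \sum_(j <- r) (a i * b j - a j * b i) ^+ 2 =
    \sum_(i <- r) \sum_(j <- r) a i ^+ 2 * b j ^+ 2
    + \sum_(i <- r) \sum_(j <- r) a j ^+ 2 * b i ^+ 2
    - 2 * \sum_(i <- r) \sum_(j <- r) (a i * b i) * (a j * b j).
  rewrite mulr_sumr -big_split -sumrB; apply: eq_bigr => i _ /=.
  rewrite mulr_sumr -big_split -sumrB; apply: eq_bigr => j _ /=; ring.
rewrite [X in _ + X - _]exchange_big /=.
under eq_bigr do rewrite -mulr_sumr.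
rewrite -mulr_suml.
under [X in 2 * X]eq_bigr do rewrite -mulr_sumr.
rewrite -mulr_suml expr2; lra.
Qed.

(** * Fourier transform of a periodic function on an interval *)

Lemma sum_square_fiber (R : realType) (X : eqType) (Z : finType) (r : seq X)
    (phi : X -> Z) (w : X -> R) :
  \sum_(z : Z) (\sum_(p <- r | phi p == z) w p) ^+ 2 =
  \sum_(p <- r) \sum_(p' <- r | phi p' == phi p) w p * w p'.
Proof.
transitivity (\sum_(z : Z) \sum_(p <- r | phi p == z)
    \sum_(p' <- r | phi p' == phi p) w p * w p').
  apply: eq_bigr => z _; rewrite expr2 mulr_suml; apply: eq_bigr => p /eqP ->.
  by rewrite mulr_sumr.
rewrite [RHS](partition_big phi xpredT) //=.
Qed.

Lemma sum_shift_diff (R : realType) (u : nat -> R) (lo hi D : nat) :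
  (lo <= hi)%N ->
  \sum_(lo <= t < hi) u t - \sum_(lo <= t < hi) u (t + D)%N =
  \sum_(lo <= t < lo + D) u t - \sum_(hi <= t < hi + D) u t.
Proof.
move=> lh.
have -> : \sum_(lo <= t < hi) u (t + D)%N = \sum_(lo + D <= t < hi + D) u t.
  by rewrite [RHS]big_addn addnK.
have h1 : \sum_(lo <= t < hi + D) u t =
    \sum_(lo <= t < hi) u t + \sum_(hi <= t < hi + D) u t.
  by rewrite (@big_cat_nat _ _ _ hi)//= leq_addr.
have h2 : \sum_(lo <= t < hi + D) u t =
    \sum_(lo <= t < lo + D) u t + \sum_(lo + D <= t < hi + D) u t.
  by rewrite (@big_cat_nat _ _ _ (lo + D))//= ?leq_addr// leq_add2r.
lra.
Qed.

Section Fourier.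
Variables (R : realType) (q0 : nat).
Local Notation Zq := 'Z_q0.+2.

Definition fourier_c (f : nat -> R) (lo hi : nat) (h : Zq) : R :=
  \sum_(lo <= t < hi) f t * ec R (h * t%:R).
Definition fourier_s (f : nat -> R) (lo hi : nat) (h : Zq) : R :=
  \sum_(lo <= t < hi) f t * es R (h * t%:R).
Definition fourier_norm2 f lo hi h : R :=
  fourier_c f lo hi h ^+ 2 + fourier_s f lo hi h ^+ 2.

Lemma fourier_norm2_trivial f lo hi h : (forall t, `|f t| <= 1) ->
  fourier_norm2 f lo hi h <= (hi - lo)%:R ^+ 2.
Proof.
by move=> f1; apply: le_trans (norm2_sum_le _ _ f1) _; rewrite size_iota.
Qed.

(** Multiplying the transform by [1 - e(D h / q)] telescopes, because [f] has period [D], and leaves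
    [D] terms at each end. The first factor is the squared modulus of that multiplier. *)
Lemma fourier_norm2_chord f lo hi (D : nat) h : (lo <= hi)%N ->
  (forall t, f (t + D)%N = f t) -> (forall t, `|f t| <= 1) ->
  (2 - 2 * ec R (D%:R * h)) * fourier_norm2 f lo hi h <= (2 * D)%:R ^+ 2.
Proof.
move=> lh fD f1.
(* The boolean marks the end of the interval and thereby the sign of the boundary term. *)
pose a (p : nat * bool) := (-1) ^+ (~~ p.2) * f p.1.
pose r := [seq (t, true) | t <- index_iota lo (lo + D)] ++
          [seq (t, false) | t <- index_iota hi (hi + D)].
have a1 p : `|a p| <= 1 by rewrite /a normrM normr_sign mul1r.
have rE (e : Zq -> R) : \sum_(p <- r) a p * e (h * p.1%:R) =
   \sum_(lo <= t < hi) f t * e (h * t%:R) -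
   \sum_(lo <= t < hi) f t * e (h * t%:R + D%:R * h).
  have := sum_shift_diff (fun t => f t * e (h * t%:R)) D lh.
  under [X in _ - X = _]eq_bigr => t _.
    rewrite fD natrD mulrDr [h * D%:R]mulrC.
  over.
  move=> ->; rewrite /r big_cat !big_map /=; congr (_ + _).
    by apply: eq_bigr => t _; rewrite /a /= expr0 mul1r.
  by rewrite -sumrN; apply: eq_bigr => t _; rewrite /a /= expr1 !mulN1r mulNr.
have := norm2_sum_le r (fun p => h * p.1%:R) a1.
rewrite !rE size_cat !size_map !size_iota !addKn addnn -mul2n.
apply: le_trans; set c := ec R _; set s := es R (D%:R * h).
have -> : \sum_(lo <= t < hi) f t * ec R (h * t%:R + D%:R * h) =
    fourier_c f lo hi h * c - fourier_s f lo hi h * s.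
  rewrite /fourier_c /fourier_s !mulr_suml -sumrB; apply: eq_bigr => t _.
  by rewrite ecD -/c -/s; ring.
have -> : \sum_(lo <= t < hi) f t * es R (h * t%:R + D%:R * h) =
    fourier_s f lo hi h * c + fourier_c f lo hi h * s.
  rewrite /fourier_c /fourier_s !mulr_suml -big_split; apply: eq_bigr => t _.
  by rewrite esD -/c -/s /=; ring.
have cs : c ^+ 2 + s ^+ 2 = 1 by exact: ec2Des2.
rewrite -/(fourier_c f lo hi h) -/(fourier_s f lo hi h) /fourier_norm2.
move: (fourier_c _ _ _ _) (fourier_s _ _ _ _) => x y; clearbody c s.
have -> : (x - (x * c - y * s)) ^+ 2 + (y - (y * c + x * s)) ^+ 2 =
  (1 - 2 * c + (c ^+ 2 + s ^+ 2)) * (x ^+ 2 + y ^+ 2) by ring.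
by rewrite cs le_eqVlt; apply/orP; left; apply/eqP; ring.
Qed.

Lemma fourier_norm2_ge0 f lo hi h : 0 <= fourier_norm2 f lo hi h.
Proof. by rewrite addr_ge0 ?sqr_ge0. Qed.

(** The smaller of the trivial and the chord estimates. The factor [D] is wasted on the first, so
    that a single weight covers both. *)
Lemma fourier_norm_le f lo hi (D : nat) h : (lo <= hi)%N -> (0 < D)%N ->
  (forall t, f (t + D)%N = f t) -> (forall t, `|f t| <= 1) ->
  D%:R * h != 0 ->
  Num.sqrt (fourier_norm2 f lo hi h) <=
   q0.+2%:R * (D%:R * freq_weight ((hi - lo)%:R / q0.+2%:R) (D%:R * h)).
Proof.
move=> lh D0 fD f1 Dh.
have q1 : 0 < (q0.+2%:R : R) by rewrite ltr0n.
have D1 : 1 <= (D%:R : R) by rewrite ler1n.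
rewrite mulrA /freq_weight minr_pMr ?mulr_ge0// le_min; apply/andP; split.
  apply: (@le_trans _ _ (hi - lo)%:R).
    rewrite -[leRHS]ger0_norm// -sqrtr_sqr ler_sqrt ?sqr_ge0//.
    exact: fourier_norm2_trivial.
  have : 0 <= ((hi - lo)%:R : R) by [].
  move: ((hi - lo)%:R : R) => n n0.
  rewrite [leRHS](_ : _ = D%:R * n); first by rewrite ler_peMl.
  by move: (q0.+2%:R : R) q1 => Q Q0; field; lra.
have z0 : 0 < ((zabs (D%:R * h))%:R : R) by rewrite ltr0n zabs_gt0.
set B := (X in _ <= X).
have B0 : 0 <= B by rewrite !mulr_ge0 ?invr_ge0// ltW.
rewrite -[leRHS]ger0_norm// -sqrtr_sqr ler_sqrt ?sqr_ge0//.
have h1 := fourier_norm2_chord h lh fD f1; have h2 := ec_chord R Dh.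
move: h1 h2; rewrite /B natrM; move: (fourier_norm2 _ _ _ _) (fourier_norm2_ge0 f lo hi h) => F F0.
move: (ec R _) => c; move: (_%:R) z0 (q0.+2%:R : R) q1 (D%:R : R) D1 => z z0 Q Q0 d d1 h1 h2.
have h3 : 4 * (z / Q) ^+ 2 * F <= (2 * d) ^+ 2 by apply: le_trans h1; exact: ler_wpM2r.
have zQ : 0 < z / Q by rewrite divr_gt0.
have -> : Q * d / z = d / (z / Q) by field; lra.
rewrite expr_div_n ler_pdivlMr ?exprn_gt0//; nra.
Qed.

(* Parseval for [B^2], whose transform is supported on sums of two inverses:
   [|B|^4 = |B^2|^2]. *)
Lemma sum_character_square_sq (s : seq nat) (f : nat -> R) :
  (forall t, `|f t| <= 1) ->
  \sum_(v : Zq) ((\sum_(t <- s) f t * ec R (v * (t%:R)^-1)) ^+ 2 +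
                 (\sum_(t <- s) f t * es R (v * (t%:R)^-1)) ^+ 2) ^+ 2 <=
   q0.+2%:R * (inverse_energy q0 s)%:R.
Proof.
move=> f1.
pose phi (p : nat * nat) : Zq := (p.1%:R)^-1 + (p.2%:R)^-1.
(* The coefficient of [e(v b / q)] in [B(v)^2]; it is at most the number of inverse pairs with sum
   [b]. *)
pose rho (b : Zq) := \sum_(p <- allpairs pair s s | phi p == b) f p.1 * f p.2.
have rho_le b : `|rho b| <= (size (inverse_pairs s b))%:R.
  rewrite /rho size_filter -sum1_count natr_sum.
  apply: le_trans (ler_norm_sum _ _ _) _; apply: ler_sum => p _.
  by rewrite normrM mulr_ile1.
have sq2 v : ((\sum_(t <- s) f t * ec R (v * (t%:R)^-1)) ^+ 2 +
              (\sum_(t <- s) f t * es R (v * (t%:R)^-1)) ^+ 2) ^+ 2 =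
   (\sum_(b : Zq) rho b * ec R (v * b)) ^+ 2 + (\sum_(b : Zq) rho b * es R (v * b)) ^+ 2.
  have rhoE (e : Zq -> R) : \sum_(b : Zq) rho b * e (v * b) =
      \sum_(t <- s) \sum_(t' <- s) f t * f t' * e (v * (t%:R)^-1 + v * (t'%:R)^-1).
    transitivity (\sum_(p <- allpairs pair s s)
        f p.1 * f p.2 * e (v * (p.1%:R)^-1 + v * (p.2%:R)^-1)); last first.
      by rewrite big_allpairs.
    rewrite [RHS](partition_big phi xpredT)//=; apply: eq_bigr => b _.
    by rewrite /rho mulr_suml; apply: eq_bigr => p /eqP <-; rewrite /phi mulrDr.
  rewrite !rhoE.
  set x := \sum_(t <- s) f t * ec R _; set y := \sum_(t <- s) f t * es R _.
  have -> : \sum_(t <- s) \sum_(t' <- s) f t * f t' * ec R (v * (t%:R)^-1 + v * (t'%:R)^-1) = x ^+ 2 - y ^+ 2.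
    rewrite !expr2 {1}/x {1}/y !mulr_suml -sumrB; apply: eq_bigr => t _.
    rewrite !mulr_sumr -sumrB; apply: eq_bigr => t' _; rewrite ecD; ring.
  have -> : \sum_(t <- s) \sum_(t' <- s) f t * f t' * es R (v * (t%:R)^-1 + v * (t'%:R)^-1) = x * y + y * x.
    rewrite {1}/x {2}/y !mulr_suml -big_split; apply: eq_bigr => t _.
    rewrite !mulr_sumr -big_split; apply: eq_bigr => t' _; rewrite esD /=; ring.
  by clearbody x y; ring.
under eq_bigr do rewrite sq2 (norm2_sum _ rho (fun b => _ * b)).
rewrite exchange_big /=.
under eq_bigr do rewrite exchange_big /=.
have inner b b' : \sum_(v : Zq) rho b * rho b' * ec R (v * b - v * b') =
   if b == b' then q0.+2%:R * rho b ^+ 2 else 0.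
  rewrite -mulr_sumr; under eq_bigr do rewrite -mulrBr.
  rewrite sum_ec subr_eq0; case: eqP => [->|_]; last by rewrite muln0 mulr0.
  by rewrite muln1 mulrC expr2.
rewrite [leLHS](_ : _ = \sum_(b : Zq) q0.+2%:R * rho b ^+ 2); last first.
  apply: eq_bigr => b _; under eq_bigr do rewrite inner.
  by rewrite -big_mkcond (big_pred1 b)// => b'; rewrite eq_sym.
rewrite -mulr_sumr ler_wpM2l// /inverse_energy natr_sum.
apply: ler_sum => b _; rewrite natrX -real_normK ?num_real//.
by apply: lerXn2r; rewrite ?nnegrE ?normr_ge0 ?ler0n ?rho_le.
Qed.

End Fourier.

(** * The nonzero frequencies *)

Section ErrorTerm.
Variables (R : realType) (q0 : nat).
Local Notation Zq := 'Z_q0.+2.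

Definition nonzero_freqs : seq Zq := [seq k <- enum Zq | k != 0].
Definition active_freqs (D : nat) : seq Zq := [seq h <- enum Zq | D%:R * h != 0].

(** On a fibre the residue of [D h] modulo [q] is fixed, so the quotient of [D h] by [q], which is
    below [D], determines [h]. *)
Lemma count_mul_fiber (D : nat) (k : Zq) (s : seq Zq) : (0 < D)%N -> uniq s ->
  (count (fun h => (D%:R * h)%R == k) s <= D)%N.
Proof.
move=> D0 us; rewrite -size_filter -[leqRHS](size_iota 0).
apply: (@size_inj_le Zq nat _ (fun h => (D * (h : nat)) %/ q0.+2)%N).
- exact: filter_uniq.
- move=> h h'; rewrite !mem_filter => /andP[/eqP hk _] /andP[/eqP hk' _] E.
  have m : (D * (h : nat) = D * (h' : nat) %[mod q0.+2])%N.
    by apply: natZp_mod; rewrite !natrM !natr_Zp hk hk'.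
  have : (D * (h : nat) = D * (h' : nat))%N.
    by rewrite (divn_eq (D * h) q0.+2) (divn_eq (D * h') q0.+2) E m.
  by move/eqP; rewrite eqn_pmul2l// => /eqP/val_inj.
- move=> h _; rewrite mem_iota /= add0n ltn_divLR// ltn_pmul2l//.
Qed.

Lemma sum_active_le (D : nat) (w : Zq -> R) : (0 < D)%N ->
  (forall k, 0 <= w k) ->
  \sum_(h <- active_freqs D) w (D%:R * h) <=
    D%:R * \sum_(k <- nonzero_freqs) w k.
Proof.
move=> D0 w0; apply: sum_fiber_le => //.
  by move=> h; rewrite mem_filter => /andP[Dh _]; rewrite mem_filter Dh mem_enum.
by move=> k _; apply: count_mul_fiber => //; apply: filter_uniq; exact: enum_uniq.
Qed.

Lemma sum_inv_val : \sum_(k : Zq | k != 0) ((k : nat)%:R)^-1 = harm R q0.+2.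
Proof.
rewrite -(big_mkord (fun i => i != 0%N) (fun i => (i%:R)^-1)) big_ltn_cond//=.
rewrite /harm big_nat_cond [RHS]big_nat_cond; apply: eq_bigl => j.
by rewrite andbT; case: (posnP j) => [->|j0]; rewrite ?andbF ?andbT.
Qed.

Lemma sum_freq_weight_le (Y : R) :
  \sum_(k <- nonzero_freqs) freq_weight Y k <= 2 * harm R q0.+2.
Proof.
rewrite /nonzero_freqs big_filter big_enum_cond /=.
apply: (@le_trans _ _ (\sum_(k : Zq | k != 0)
   (((k : nat)%:R)^-1 + ((- k : Zq) : nat)%:R^-1))).
  apply: ler_sum => k k0; rewrite /freq_weight ge_min; apply/orP; right.
  rewrite /zabs (val_oppZp k0); case: leqP => _.
    by rewrite lerDl invr_ge0.
  by rewrite lerDr invr_ge0.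
rewrite big_split /= [X in _ + X](_ : _ = harm R q0.+2).
  by rewrite sum_inv_val mulr2n mulrDl mul1r.
rewrite -sum_inv_val [RHS](reindex_inj oppr_inj) /=.
by apply: eq_bigl => k; rewrite oppr_eq0.
Qed.

Section Bound.
Variables (D N T : nat) (Y : R) (s s' : seq nat) (f : nat -> R) (a : Zq).
Hypotheses (D0 : (0 < D)%N) (us : unit_range q0 N s) (Nq : (N < q0.+2)%N).
Hypotheses (Y0 : 0 <= Y) (f1 : forall t, `|f t| <= 1).
Hypothesis au : a \is a GRing.unit.
Hypothesis TP : forall n, (0 < n)%N -> (n <= q0.+2 * N)%N ->
  (size (divisors n) <= T)%N.

Let H := harm R q0.+2.
Let w (h : Zq) : R := freq_weight Y (D%:R * h).
Let P (v : Zq) : R :=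
  (\sum_(t <- s') f t * ec R (v * (t%:R)^-1)) ^+ 2 +
  (\sum_(t <- s') f t * es R (v * (t%:R)^-1)) ^+ 2.
Let r := allpairs pair (active_freqs D) s.
Let phi (p : Zq * nat) : Zq := p.1 * a * (p.2%:R)^-1.

Let w0 h : 0 <= w h. Proof. exact: freq_weight_ge0. Qed.
Let P0 v : 0 <= P v. Proof. by rewrite addr_ge0 ?sqr_ge0. Qed.

Let sum_w : \sum_(p <- r) w p.1 <= 2 * D%:R * N%:R * H.
Proof.
rewrite /r big_allpairs /= .
under eq_bigr do rewrite big_const_seq count_predT iter_addr_0 -mulr_natr.
rewrite -mulr_suml; apply: (@le_trans _ _ ((D%:R * (2 * H)) * N%:R)).
  apply: ler_pM => //; first exact: sumr_ge0.
    apply: le_trans (sum_active_le D0 (fun k => freq_weight_ge0 k Y0)) _.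
    by rewrite ler_wpM2l// sum_freq_weight_le.
  by rewrite ler_nat (unit_range_size us).
by rewrite le_eqVlt; apply/orP; left; apply/eqP; ring.
Qed.

(** As [a] is a unit, [h a u(t) = h' a u(t')] means [h t' = h' t]. After multiplication by [D] only
    [k = D h] and [k' = D h'] matter, and each of them comes from at most [D] frequencies, whence
    [D^2]. *)
Let sum_A2 : \sum_(v : Zq) (\sum_(p <- r | phi p == v) w p.1) ^+ 2 <=
  D%:R ^+ 2 * \sum_(z : Zq) freq_mass Y s z ^+ 2.
Proof.
have [_ sP] := us.
have tu t : t \in s -> (t%:R : Zq) \is a GRing.unit.
  by move=> /sP/andP[_]; exact: natZp_unit.
rewrite sum_square_fiber.
under [X in _ <= _ * X]eq_bigr => z _ do rewrite /freq_mass big_filter.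
rewrite (sum_square_fiber _ (fun p => p.1 * p.2%:R) (fun p => freq_weight Y p.1)).
(* Cross-multiplication pairs [k] with [t'] and [k'] with [t], so [t] and [t'] trade places with
   respect to [freq_mass]. *)
pose G (t t' : nat) (k k' : Zq) : R :=
  if k' * t%:R == k * t'%:R then freq_weight Y k * freq_weight Y k' else 0.
have G0 t t' k k' : 0 <= G t t' k k'.
  by rewrite /G; case: ifP => // _; rewrite mulr_ge0 ?freq_weight_ge0.
rewrite [X in _ <= _ * X](_ : _ = \sum_(t <- s) \sum_(t' <- s)
    \sum_(k <- nonzero_freqs) \sum_(k' <- nonzero_freqs) G t t' k k'); last first.
  under eq_bigr do rewrite big_mkcond big_allpairs.
  rewrite big_allpairs /=.
  under eq_bigr do under eq_bigr do rewrite exchange_big.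
  under eq_bigr do rewrite exchange_big.
  rewrite exchange_big.
  by under eq_bigr do rewrite exchange_big.
under eq_bigr do rewrite big_mkcond big_allpairs.
rewrite /r big_allpairs /= exchange_big /=.
rewrite mulr_sumr big_seq [leRHS]big_seq; apply: ler_sum => t ts.
under eq_bigr do rewrite exchange_big /=.
rewrite exchange_big /=.
rewrite mulr_sumr big_seq [leRHS]big_seq; apply: ler_sum => t' ts'.
apply: (@le_trans _ _ (\sum_(h <- active_freqs D) \sum_(h' <- active_freqs D)
   G t t' (D%:R * h) (D%:R * h'))).
  apply: ler_sum => h _; apply: ler_sum => h' _; rewrite /phi /=.
  case: eqP => [E|_]; last exact: G0.
  rewrite /G ifT //; apply/eqP.
  have {}E : h' * t%:R = h * t'%:R.
    apply: (mulIr au); have ut := tu _ ts; have ut' := tu _ ts'.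
    have L : h' * a = h * a * (t%:R)^-1 * t'%:R by rewrite -E mulrVK.
    by rewrite mulrAC L [_ * t'%:R * t%:R]mulrAC mulrVK// mulrAC.
  by rewrite -mulrA E mulrA.
apply: (@le_trans _ _ (\sum_(h <- active_freqs D)
   D%:R * \sum_(k' <- nonzero_freqs) G t t' (D%:R * h) k')).
  by apply: ler_sum => h _; exact: sum_active_le.
rewrite -mulr_sumr expr2 -mulrA ler_wpM2l//.
apply: (@sum_active_le D (fun k => \sum_(k' <- nonzero_freqs) G t t' k k')) => // k.
by apply: sumr_ge0 => k' _; exact: G0.
Qed.

(** Hölder as two applications of Cauchy-Schwarz: one with the weights [w], then, after grouping the
    pairs by [v = h a u(t2)], one over [v]. *)
Lemma error_fourth_moment :
  (\sum_(p <- r) w p.1 * Num.sqrt (P (phi p))) ^+ 4 <=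
   (2 * D%:R * N%:R * H) ^+ 2 *
   (D%:R ^+ 2 * (24 * T%:R ^+ 2 * (Y * N%:R * H + 2 * N%:R ^+ 2 * H ^+ 2 / q0.+2%:R))) *
   (q0.+2%:R * (inverse_energy q0 s')%:R).
Proof.
set E1 := \sum_(p <- r) _.
have h1 : E1 ^+ 2 <= (\sum_(p <- r) w p.1) * (\sum_(p <- r) w p.1 * P (phi p)).
  have -> : E1 = \sum_(p <- r) Num.sqrt (w p.1) * (Num.sqrt (w p.1) * Num.sqrt (P (phi p))).
    by apply: eq_bigr => p _; rewrite mulrA -expr2 sqr_sqrtr.
  apply: le_trans (cauchy_schwarz_sum _ _ _) _.
  rewrite le_eqVlt; apply/orP; left; apply/eqP; congr (_ * _); apply: eq_bigr => p _.
    by rewrite sqr_sqrtr.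
  by rewrite exprMn !sqr_sqrtr.
have h2 : (\sum_(p <- r) w p.1 * P (phi p)) ^+ 2 <=
   (\sum_(v : Zq) (\sum_(p <- r | phi p == v) w p.1) ^+ 2) * (\sum_(v : Zq) P v ^+ 2).
  have -> : \sum_(p <- r) w p.1 * P (phi p) =
      \sum_(v : Zq) (\sum_(p <- r | phi p == v) w p.1) * P v.
    rewrite (partition_big phi xpredT)//=; apply: eq_bigr => v _.
    by rewrite mulr_suml; apply: eq_bigr => p /eqP ->.
  exact: cauchy_schwarz_sum.
have h3 := sum_character_square_sq q0 s' f1.
have h4 := sum_A2; have h5 := freq_mass_square_sum us Nq Y0 TP; have h6 := sum_w.
have W0 : 0 <= \sum_(p <- r) w p.1 by exact: sumr_ge0.
have A0 : 0 <= \sum_(v : Zq) (\sum_(p <- r | phi p == v) w p.1) ^+ 2.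
  by apply: sumr_ge0 => v _; exact: sqr_ge0.
have Q0 : 0 <= \sum_(v : Zq) P v ^+ 2 by apply: sumr_ge0 => v _; exact: sqr_ge0.
have B0 : 0 <= \sum_(p <- r) w p.1 * P (phi p).
  by apply: sumr_ge0 => p _; rewrite mulr_ge0.
rewrite -[4%N]/(2 * 2)%N exprM.
apply: (@le_trans _ _ (((\sum_(p <- r) w p.1) * (\sum_(p <- r) w p.1 * P (phi p))) ^+ 2)).
  by apply: lerXn2r h1; rewrite nnegrE; [exact: sqr_ge0|exact: mulr_ge0].
rewrite exprMn -mulrA; apply: ler_pM; rewrite ?sqr_ge0//.
  by apply: lerXn2r; rewrite ?nnegrE//; apply: le_trans h6.
apply: le_trans h2 _; apply: ler_pM => //.
by apply: le_trans h4 _; rewrite ler_wpM2l ?sqr_ge0.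
Qed.

End Bound.

(** For fixed [h] and [t2] the sum over [t3] is [f2 t2] times the real part of [F(h)] times the
    conjugate of [B(v)], hence at most the product of the moduli. *)
Lemma error_bound (D : nat) (s s' : seq nat) (lo hi : nat) (f1 f2 f3 : nat -> R) (a : Zq) :
  (0 < D)%N -> (lo <= hi)%N -> (forall t, f1 (t + D)%N = f1 t) ->
  (forall t, `|f1 t| <= 1) -> (forall t, `|f2 t| <= 1) ->
  `|\sum_(h <- active_freqs D) \sum_(t2 <- s) \sum_(t3 <- s')
     f2 t2 * f3 t3 *
     (fourier_c f1 lo hi h * ec R (h * a * (t2%:R)^-1 * (t3%:R)^-1) +
      fourier_s f1 lo hi h * es R (h * a * (t2%:R)^-1 * (t3%:R)^-1))| <=
  q0.+2%:R * D%:R *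
  \sum_(p <- allpairs pair (active_freqs D) s)
    freq_weight ((hi - lo)%:R / q0.+2%:R) (D%:R * p.1) *
    Num.sqrt ((\sum_(t <- s') f3 t * ec R (p.1 * a * (p.2%:R)^-1 * (t%:R)^-1)) ^+ 2 +
              (\sum_(t <- s') f3 t * es R (p.1 * a * (p.2%:R)^-1 * (t%:R)^-1)) ^+ 2).
Proof.
move=> D0 lh fD f11 f21; rewrite big_allpairs /= mulr_sumr.
apply: le_trans (ler_norm_sum _ _ _) _; rewrite big_seq [leRHS]big_seq.
apply: ler_sum => h; rewrite mem_filter => /andP[Dh _].
rewrite mulr_sumr; apply: le_trans (ler_norm_sum _ _ _) _.
apply: ler_sum => t2 _; set v := h * a * _.
set bc := \sum_(t <- s') f3 t * ec R _; set bs := \sum_(t <- s') f3 t * es R _.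
have -> : \sum_(t3 <- s') f2 t2 * f3 t3 *
     (fourier_c f1 lo hi h * ec R (v * (t3%:R)^-1) +
      fourier_s f1 lo hi h * es R (v * (t3%:R)^-1)) =
    f2 t2 * (fourier_c f1 lo hi h * bc + fourier_s f1 lo hi h * bs).
  rewrite /bc /bs !mulr_sumr -big_split mulr_sumr; apply: eq_bigr => t _ /=; ring.
rewrite normrM; apply: (@le_trans _ _ (1 * `|fourier_c f1 lo hi h * bc + fourier_s f1 lo hi h * bs|)).
  by rewrite ler_wpM2r.
rewrite mul1r mulrA.
apply: (@le_trans _ _ (Num.sqrt (fourier_norm2 f1 lo hi h) * Num.sqrt (bc ^+ 2 + bs ^+ 2))).
  rewrite -sqrtrM ?fourier_norm2_ge0// -sqrtr_sqr ler_sqrt; last first.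
    by rewrite mulr_ge0 ?fourier_norm2_ge0// addr_ge0 ?sqr_ge0.
  rewrite /fourier_norm2; move: (fourier_c _ _ _ _) (fourier_s _ _ _ _) bc bs => x y b c.
  have := sqr_ge0 (x * c - y * b); nra.
rewrite ler_wpM2r ?sqrtr_ge0// -mulrA.
exact: fourier_norm_le.
Qed.

End ErrorTerm.

(** * Periodic sums over coprime integers *)

Lemma sum_nat_bounded (R : realType) (F : nat -> R) (m n : nat) :
  (forall t, `|F t| <= 1) -> `|\sum_(m <= t < n) F t| <= (n - m)%:R.
Proof.
move=> F1; apply: le_trans (ler_norm_sum _ _ _) _.
apply: (@le_trans _ _ (\sum_(m <= t < n) (1 : R))); first exact: ler_sum.
by rewrite sumr_const_nat.
Qed.

Lemma periodicM (R : realType) (F : nat -> R) (D : nat) :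
  (forall t, F (t + D)%N = F t) -> forall t k, F (t + k * D)%N = F t.
Proof.
move=> FD t; elim=> [|k IH]; first by rewrite mul0n addn0.
by rewrite mulSn addnCA addnC FD.
Qed.

Lemma periodic_modn (R : realType) (F : nat -> R) (D : nat) :
  (forall t, F (t + D)%N = F t) -> forall t, F (t %% D)%N = F t.
Proof. by move=> FD t; rewrite {2}(divn_eq t D) addnC periodicM. Qed.

(** Every window of [D] consecutive terms sums to zero, so prefix sums have period [D]; reducing
    both endpoints modulo [D] leaves fewer than [D] terms. *)
Lemma sum_periodic_le (R : realType) (F : nat -> R) (D lo hi : nat) :
  (0 < D)%N -> (forall t, F (t + D)%N = F t) -> (forall t, `|F t| <= 1) ->
  \sum_(0 <= t < D) F t = 0 -> `|\sum_(lo <= t < hi) F t| <= D%:R.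
Proof.
move=> D0 FD F1 Fz; pose S n := \sum_(0 <= t < n) F t.
have SD n : S (n + D)%N = S n.
  rewrite /S (@big_cat_nat _ _ _ n)//= ?leq_addr//.
  have -> : \sum_(n <= t < n + D) F t = \sum_(0 <= t < D) F (t + n)%N.
    by rewrite -{1}[n]add0n big_addn addKn.
  suff -> : \sum_(0 <= t < D) F (t + n)%N = 0 by rewrite addr0.
  elim: n => [|n IH]; first by under eq_bigr do rewrite addn0.
  apply: etrans IH; case: D D0 FD Fz => // D _ FD _.
  rewrite [LHS]big_nat_recr//= [RHS]big_nat_recl//= addrC; congr (_ + _).
    by rewrite add0n -addSnnS addnC FD.
  by apply: eq_bigr => t _; rewrite addSnnS.
have Smod n : S n = S (n %% D)%N.
  rewrite {1}(divn_eq n D) addnC; elim: (n %/ D)%N => [|k IH].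
    by rewrite mul0n addn0.
  by rewrite mulSn addnCA addnC SD.
have [lh|hl] := leqP lo hi; last by rewrite (big_geq (ltnW hl)) normr0 ler0n.
have -> : \sum_(lo <= t < hi) F t = S hi - S lo.
  by rewrite /S (@big_cat_nat _ _ _ lo 0 hi)//= addrAC subrr add0r.
rewrite Smod (Smod lo).
have [ab|ba] := leqP (lo %% D) (hi %% D).
  rewrite /S (@big_cat_nat _ _ _ (lo %% D) 0 (hi %% D))//= addrAC subrr add0r.
  apply: le_trans (sum_nat_bounded _ _ F1) _; rewrite ler_nat.
  exact: leq_trans (leq_subr _ _) (ltnW (ltn_pmod _ D0)).
rewrite distrC /S (@big_cat_nat _ _ _ (hi %% D) 0 (lo %% D))//= ; last exact: ltnW.
rewrite addrAC subrr add0r.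
apply: le_trans (sum_nat_bounded _ _ F1) _; rewrite ler_nat.
exact: leq_trans (leq_subr _ _) (ltnW (ltn_pmod _ D0)).
Qed.

Lemma sum_multiples (R : realType) (F : nat -> R) (e lo hi : nat) : (0 < e)%N ->
  exists lo' hi' : nat, \sum_(lo <= t < hi | (e %| t)%N) F t =
    \sum_(0 <= t < hi') F (e * t)%N - \sum_(0 <= t < lo') F (e * t)%N.
Proof.
move=> e0.
have pre n : exists m : nat, (n <= m * e < n + e)%N /\
    \sum_(0 <= t < n | (e %| t)%N) F t = \sum_(0 <= t < m) F (e * t)%N.
  elim: n => [|n [m [/andP[nm mn] IH]]].
    by exists 0%N; rewrite mul0n add0n e0 !big_geq.
  rewrite big_mkcond big_nat_recr//= -big_mkcond IH.
  have [en|en] := boolP (e %| n)%N; last first.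
    exists m; rewrite addr0; split=> //; apply/andP; split; last by lia.
    rewrite ltn_neqAle nm andbT; apply: contra en => /eqP ->.
    exact: dvdn_mull.
  exists m.+1; have E : n = (m * e)%N.
    case/dvdnP: en => k kE; rewrite kE in nm mn *.
    have {}mn : (m * e < k.+1 * e)%N by rewrite mulSn addnC.
    rewrite leq_pmul2r// in nm; rewrite ltn_pmul2r// in mn.
    by congr (_ * _)%N; lia.
  by rewrite big_nat_recr//= (mulnC e m) -E; split=> //; lia.
have [m1 [_ E1]] := pre lo; have [m2 [_ E2]] := pre hi.
have [lh|hl] := leqP lo hi; last first.
  by exists 0%N, 0%N; rewrite (big_geq (ltnW hl)) subrr.
exists m1, m2; rewrite -E1 -E2.
by rewrite (@big_cat_nat _ _ _ lo 0 hi)//= addrAC subrr add0r.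
Qed.

(** Inclusion-exclusion one prime at a time, each doubling the bound. The divisor [e] is general
    because the terms removed for [p] are those divisible by [lcmn e p], a sum of the same shape. *)
Lemma sum_sieve (R : realType) (F : nat -> R) (lo hi : nat) (B : R) (ps : seq nat) :
  all (fun p => 0 < p)%N ps ->
  (forall e, (0 < e)%N -> `|\sum_(lo <= t < hi | (e %| t)%N) F t| <= B) ->
  forall e, (0 < e)%N ->
  `|\sum_(lo <= t < hi | (e %| t)%N && all (fun p => ~~ (p %| t)%N) ps) F t|
     <= 2 ^+ size ps * B.
Proof.
move=> + FB; elim: ps => [_|p ps IH /= /andP[p0 ps0]] e e0.
  by rewrite expr0 mul1r; under eq_bigl do rewrite andbT; exact: FB.
have -> : \sum_(lo <= t < hi | (e %| t)%N && (~~ (p %| t)%N && all (fun p => ~~ (p %| t)%N) ps)) F t =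
   \sum_(lo <= t < hi | (e %| t)%N && all (fun p => ~~ (p %| t)%N) ps) F t -
   \sum_(lo <= t < hi | (lcmn e p %| t)%N && all (fun p => ~~ (p %| t)%N) ps) F t.
  rewrite [X in _ = X - _](bigID (fun t => p %| t)%N) /=.
  have -> : \sum_(lo <= t < hi | (e %| t)%N && all (fun p => ~~ (p %| t)%N) ps && (p %| t)%N) F t =
      \sum_(lo <= t < hi | (lcmn e p %| t)%N && all (fun p => ~~ (p %| t)%N) ps) F t.
    by apply: eq_bigl => t; rewrite dvdn_lcm andbAC.
  rewrite addrC addrK; apply: eq_bigl => t; by rewrite andbA andbAC.
apply: le_trans (ler_normB _ _) _; rewrite exprS -mulrA mulr_natl mulr2n.
by apply: lerD; apply: IH => //; rewrite lcmn_gt0 e0.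
Qed.

Lemma coprime_all_primes (t q : nat) : (0 < q)%N ->
  coprime t q = all (fun p => ~~ (p %| t)%N) (primes q).
Proof.
move=> q0; apply/idP/allP => [cop p|H].
  rewrite mem_primes => /and3P[pp _ pq]; apply/negP => pt.
  have : (p %| gcdn t q)%N by rewrite dvdn_gcd pt.
  by move: cop; rewrite /coprime => /eqP ->; rewrite Euclid_dvd1.
rewrite /coprime; apply/negPn/negP => g1.
have g0 : (0 < gcdn t q)%N by rewrite gcdn_gt0 q0 orbT.
have g2 : (1 < gcdn t q)%N by rewrite ltn_neqAle eq_sym g1.
have := H (pdiv (gcdn t q)); rewrite mem_primes pdiv_prime// q0 /=.
have := pdiv_dvd (gcdn t q); rewrite dvdn_gcd => /andP[-> ->].
by move=> /(_ isT).
Qed.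

(** The mean is required to vanish along every dilation because the sieve restricts to multiples of
    [e], where the function becomes [t -> F(e t)], again of period [D]. *)
Lemma sum_coprime_periodic_le (R : realType) (F : nat -> R) (D q lo hi : nat) :
  (0 < D)%N -> (0 < q)%N ->
  (forall t, F (t + D)%N = F t) -> (forall t, `|F t| <= 1) ->
  (forall e, (0 < e)%N -> \sum_(0 <= t < D) F (e * t)%N = 0) ->
  `|\sum_(lo <= t < hi | coprime t q) F t| <= 2 ^+ size (primes q) * D%:R.
Proof.
move=> D0 q0 FD F1 Fz.
have H e : (0 < e)%N -> `|\sum_(lo <= t < hi | (e %| t)%N) F t| <= D%:R.
  move=> e0; have [lo' [hi' ->]] := sum_multiples F lo hi e0.
  have FeD t : F (e * (t + D))%N = F (e * t)%N by rewrite mulnDr periodicM.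
  have [lh|hl] := leqP lo' hi'.
    rewrite (@big_cat_nat _ _ _ lo' 0 hi')//= addrAC subrr add0r.
    by apply: sum_periodic_le => //; exact: Fz.
  rewrite distrC (@big_cat_nat _ _ _ hi' 0 lo')//= ; last exact: ltnW.
  rewrite addrAC subrr add0r.
  by apply: sum_periodic_le => //; exact: Fz.
have pos : all (fun p => 0 < p)%N (primes q).
  by apply/allP => p; rewrite mem_primes => /andP[/prime_gt0].
have := sum_sieve pos H (ltn0Sn 0).
rewrite (eq_bigl (fun t => coprime t q)) // => t.
by rewrite dvd1n coprime_all_primes.
Qed.

Lemma sum_period_mul (R : realType) (F : nat -> R) (D b : nat) : (0 < D)%N ->
  (forall t, F (t + D)%N = F t) -> coprime b D ->
  \sum_(0 <= t < D) F (b * t)%N = \sum_(0 <= t < D) F t.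
Proof.
case: D => // D _ FD bD; rewrite !big_mkord.
pose g (t : 'I_D.+1) : 'I_D.+1 := inord ((b * t) %% D.+1).
have gE t : g t = ((b * t) %% D.+1)%N :> nat by rewrite inordK// ltn_pmod.
rewrite [RHS](reindex_inj (h := g)) /=; last first.
  move=> t t' /(congr1 (fun x : 'I_D.+1 => x : nat)); rewrite !gE => /eqP.
  have wlg (x y : 'I_D.+1) : (x <= y)%N -> (b * x == b * y %[mod D.+1]) -> x = y.
    move=> xy; rewrite eq_sym eqn_mod_dvd ?leq_mul// -mulnBr Gauss_dvdr; last first.
      by rewrite coprime_sym.
    move=> dv; apply: ord_inj; apply/eqP; rewrite eqn_leq xy /= -subn_eq0.
    rewrite eqn0Ngt; apply/negP => yx; have := dvdn_leq yx dv.
    by have := ltn_ord y; lia.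
  move=> E; case/orP: (leq_total t t') => tt; first exact: wlg.
  by apply/esym; apply: wlg => //; rewrite eq_sym.
by apply: eq_bigr => t _; rewrite gE (periodic_modn FD).
Qed.

Section Character.
Variables (R : realType) (D : nat) (chi : int -> R).
Hypothesis qc : quadratic_character D chi.

Lemma quadratic_character_props :
  [/\ (0 < D)%N, forall t : nat, chi (t + D)%N%:Z = chi t%:Z,
      forall t : nat, `|chi t%:Z| <= 1,
      forall t : nat, chi t%:Z != 0 -> coprime t D &
      forall e : nat, \sum_(0 <= t < D) chi (e * t)%N%:Z = 0].
Proof.
have [[D0 per mul nz] np sq] := qc.
have perN (t : nat) : chi (t + D)%N%:Z = chi t%:Z.
  by apply: per; rewrite PoszD modzDr.
have copN (t : nat) : coprimez t%:Z D%:Z = coprime t D by [].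
have sqE t : chi t ^+ 2 = (coprimez t D%:Z)%:R by have := congr1 (fun f => f t) sq.
have le1 (t : nat) : `|chi t%:Z| <= 1.
  have : `|chi t%:Z| ^+ 2 <= 1 ^+ 2.
    by rewrite real_normK ?num_real// sqE expr1n; case: coprimez.
  by rewrite ler_pXn2r ?nnegrE.
split => //.
  by move=> t; rewrite nz.
have zero : \sum_(0 <= t < D) chi t%:Z = 0.
  (* A non-principal character takes a value other than 1 at some unit [b]; dilating the period by
     [b] gives [S = chi(b) S]. *)
  have [b bD b1] : exists2 b : nat, coprime b D & chi b%:Z != 1.
    apply/not_exists2P => H; apply: np; apply/funext => n.
    rewrite /principal_character; have [cn|cn] := boolP (coprimez n D%:Z); last first.
      by apply/eqP; rewrite -[_ == _]negbK nz.
    have nE : (n = (`|(n %% D%:Z)%Z|)%N%:Z %[mod D%:Z])%Z.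
      by rewrite gez0_abs ?modz_ge0 ?modz_mod// -lt0n.
    rewrite (per _ _ nE); have [c|/negP] := H (`|(n %% D%:Z)%Z|)%N; last by rewrite negbK => /eqP.
    case: c; rewrite -copN -nz -(per _ _ nE) nz; exact: cn.
  have := sum_period_mul D0 (F := fun t => chi t%:Z) perN bD.
  under eq_bigr do rewrite PoszM mul.
  rewrite -mulr_sumr; move: (\sum_(_ <= _ < _) _) => S E.
  have /eqP : (chi b%:Z - 1) * S = 0 by rewrite mulrBl mul1r E subrr.
  by rewrite mulf_eq0 subr_eq0 (negbTE b1) => /eqP.
by move=> e; under eq_bigr do rewrite PoszM mul; rewrite -mulr_sumr zero mulr0.
Qed.

End Character.

(** * The zero frequencies *)

Section MainTerm.
Variables (R : realType) (q0 : nat).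
Local Notation Zq := 'Z_q0.+2.

Definition killed_sum (D : nat) (y : Zq) : R :=
  \sum_(h : Zq | D%:R * h == 0) ec R (h * y).

(** With [d = gcd(D, q)] the frequencies killed by [D] form the subgroup of multiples of [q / d].
    The character [h -> e(h y / q)] sums over it to its order if trivial there, and to 0
    otherwise. *)
Lemma killed_sumE (D : nat) (y : Zq) : (0 < D)%N ->
  killed_sum D y = if (q0.+2 %/ gcdn D q0.+2)%:R * y == 0
    then #|[pred h : Zq | (D%:R * h == 0)%R]|%:R else 0.
Proof.
move=> D0; set d := gcdn D q0.+2; set q' := (q0.+2 %/ d)%N.
have d0 : (0 < d)%N by rewrite gcdn_gt0 D0.
have qE : q0.+2 = (q' * d)%N by rewrite divnK// dvdn_gcdr.
have DE : D = (D %/ d * d)%N by rewrite divnK// dvdn_gcdl.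
case: ifPn => y0.
  rewrite /killed_sum -sum1_card natr_sum; apply: eq_bigr => h /eqP Dh.
  suff -> : h * y = 0 by rewrite ec0.
  have : (q0.+2 %| D * (h : nat))%N by rewrite -natZp_eq0 natrM natr_Zp Dh.
  rewrite {1}qE {1}DE mulnAC dvdn_pmul2r// Gauss_dvdr; last first.
    rewrite coprime_sym /coprime -(eqn_pmul2r d0) mul1n muln_gcdl -qE -DE.
    by rewrite eqxx.
  case/dvdnP => m hE; rewrite -[h]natr_Zp hE natrM -mulrA (eqP y0).
  by rewrite mulr0.
apply: (@sum_ec_translate R q0 (fun h => D%:R * h == 0) q'%:R) => // h.
rewrite mulrDr [X in _ + X](_ : _ = 0) ?addr0//.
by rewrite -natrM DE mulnAC -mulnA -qE natrM natZp_modulus mulr0.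
Qed.

Lemma card_killed_le (D : nat) : (0 < D)%N ->
  (#|[pred h : Zq | (D%:R * h == 0)%R]| <= D)%N.
Proof.
move=> D0; rewrite cardE.
apply: leq_trans (count_mul_fiber (0 : Zq) D0 (enum_uniq Zq)).
rewrite -size_filter; apply: uniq_leq_size (enum_uniq _) _ => h.
rewrite mem_enum => hk; rewrite mem_filter; apply/andP; split; first exact: hk.
by rewrite mem_enum.
Qed.

(** Orthogonality over all [h], split according to [D h = 0]. Here [D] is free; it will be a period
    of [f1]. *)
Lemma ternary_completion (D lo hi : nat) (s s' : seq nat) (f1 f2 f3 : nat -> R)
    (a : Zq) :
  q0.+2%:R * (\sum_(lo <= t1 < hi) \sum_(t2 <- s) \sum_(t3 <- s')
     if t1%:R == a * (t2%:R)^-1 * (t3%:R)^-1 then f1 t1 * f2 t2 * f3 t3 else 0) =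
  \sum_(lo <= t1 < hi) \sum_(t2 <- s) \sum_(t3 <- s')
     f1 t1 * f2 t2 * f3 t3 * killed_sum D (t1%:R - a * (t2%:R)^-1 * (t3%:R)^-1) +
  \sum_(h <- active_freqs q0 D) \sum_(t2 <- s) \sum_(t3 <- s')
     f2 t2 * f3 t3 *
     (fourier_c f1 lo hi h * ec R (h * a * (t2%:R)^-1 * (t3%:R)^-1) +
      fourier_s f1 lo hi h * es R (h * a * (t2%:R)^-1 * (t3%:R)^-1)).
Proof.
have -> : \sum_(h <- active_freqs q0 D) \sum_(t2 <- s) \sum_(t3 <- s')
     f2 t2 * f3 t3 *
     (fourier_c f1 lo hi h * ec R (h * a * (t2%:R)^-1 * (t3%:R)^-1) +
      fourier_s f1 lo hi h * es R (h * a * (t2%:R)^-1 * (t3%:R)^-1)) =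
   \sum_(lo <= t1 < hi) \sum_(t2 <- s) \sum_(t3 <- s')
     f1 t1 * f2 t2 * f3 t3 *
     \sum_(h : Zq | D%:R * h != 0) ec R (h * (t1%:R - a * (t2%:R)^-1 * (t3%:R)^-1)).
  rewrite exchange_big [RHS]exchange_big /=; apply: eq_bigr => t2 _.
  rewrite exchange_big [RHS]exchange_big /=; apply: eq_bigr => t3 _.
  under [RHS]eq_bigr do rewrite mulr_sumr.
  rewrite [RHS]exchange_big /= /active_freqs big_filter big_enum_cond /=.
  apply: eq_bigr => h _.
  rewrite /fourier_c /fourier_s !mulr_suml -big_split mulr_sumr /=.
  apply: eq_bigr => t1 _; rewrite mulrBr !mulrA ecB; ring.
rewrite mulr_sumr -big_split; apply: eq_bigr => t1 _ /=.
rewrite mulr_sumr -big_split; apply: eq_bigr => t2 _ /=.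
rewrite mulr_sumr -big_split; apply: eq_bigr => t3 _ /=.
rewrite -mulrDr; set y := t1%:R - _.
have -> : killed_sum D y + \sum_(h : Zq | D%:R * h != 0) ec R (h * y) =
    (q0.+2 * (y == 0))%:R.
  by rewrite -sum_ec /killed_sum [RHS](bigID (fun h : Zq => D%:R * h == 0)).
rewrite /y subr_eq0; case: ifP => _; rewrite ?muln1 ?muln0 ?mulr0//.
by rewrite mulrC.
Qed.

(** With period 1 only [h = 0] is killed and the variables separate. This serves the cases where
    [chi] sits at [t2] or [t3]. *)
Lemma main_term_split (lo hi : nat) (s s' : seq nat) (f1 f2 f3 : nat -> R) (a : Zq) :
  \sum_(lo <= t1 < hi) \sum_(t2 <- s) \sum_(t3 <- s')
     f1 t1 * f2 t2 * f3 t3 * killed_sum 1 (t1%:R - a * (t2%:R)^-1 * (t3%:R)^-1) =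
  (\sum_(lo <= t1 < hi) f1 t1) * (\sum_(t2 <- s) f2 t2) * (\sum_(t3 <- s') f3 t3).
Proof.
have K1 y : killed_sum 1 y = 1.
  rewrite /killed_sum (big_pred1 0) ?mul0r ?ec0// => h.
  by rewrite mul1r.
rewrite -mulrA mulr_suml; apply: eq_bigr => t1 _.
rewrite mulr_suml mulr_sumr; apply: eq_bigr => t2 _.
rewrite !mulr_sumr; apply: eq_bigr => t3 _.
by rewrite K1 mulr1 mulrA.
Qed.

Definition coprime_range (lo hi : nat) : seq nat :=
  [seq t <- index_iota lo hi | coprime t q0.+2].

Lemma natZp_cofactor (d m n : nat) : (d %| q0.+2)%N ->
  ((q0.+2 %/ d)%:R * (m%:R - n%:R) == 0 :> Zq) = (m == n %[mod d]).
Proof.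
move=> dq; have d0 : (0 < d)%N := dvdn_gt0 (ltn0Sn _) dq.
have q'0 : (0 < q0.+2 %/ d)%N by rewrite divn_gt0// dvdn_leq.
have wlg (x y : nat) : (y <= x)%N ->
    ((q0.+2 %/ d)%:R * (x%:R - y%:R) == 0 :> Zq) = (x == y %[mod d]).
  move=> yx; rewrite -natrB// -natrM natZp_eq0 eqn_mod_dvd//.
  by rewrite -{1}(divnK dq) dvdn_pmul2l.
have [nm|mn] := leqP n m; first exact: wlg.
by rewrite -oppr_eq0 -mulrN opprB (wlg _ _ (ltnW mn)) eq_sym.
Qed.

(* The inner sum over [t3] hardly depends on the class of [t1 t2] modulo
   [gcd(D, q)], so the cancellation comes from summing [f] over [t1]. *)
Lemma main_term_character (D lo hi lo' hi' N : nat) (s : seq nat) (f : nat -> R)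
    (a : nat) : (0 < D)%N -> unit_range q0 N s -> coprime a q0.+2 ->
  (forall t, f (t + D)%N = f t) -> (forall t, `|f t| <= 1) ->
  (forall t, f t != 0 -> coprime t D) -> \sum_(0 <= t < D) f t = 0 ->
  `|\sum_(lo <= t1 < hi) \sum_(t2 <- s) \sum_(t3 <- coprime_range lo' hi')
     f t1 * 1 * 1 * killed_sum D (t1%:R - a%:R * (t2%:R)^-1 * (t3%:R)^-1)| <=
  D%:R ^+ 2 * N%:R * ((hi' - lo')%:R + (hi - lo)%:R * 2 ^+ size (primes q0.+2)).
Proof.
move=> D0 us aq fD f1 fcop fz; have [_ sP] := us.
set d := gcdn D q0.+2; set w := 2 ^+ _.
have dq : (d %| q0.+2)%N by exact: dvdn_gcdr.
have dD : (d %| D)%N by exact: dvdn_gcdl.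
have d0 : (0 < d)%N by rewrite gcdn_gt0 D0.
set kap : R := #|[pred h : Zq | (D%:R * h == 0)%R]|%:R.
pose G (b : nat) : R := \sum_(t <- coprime_range lo' hi') (b * t == a %[mod d])%:R.
(* For [b] prime to [d], multiplication by [b] permutes the residues modulo [d]. The difference of
   the two indicators thus has mean zero along every dilation, and the sieve bound applies with
   period [d]. *)
have GB b : coprime b d -> `|G b - G 1%N| <= w * d%:R.
  move=> bd; rewrite /G -sumrB /coprime_range big_filter.
  pose F t : R := (b * t == a %[mod d])%:R - (1 * t == a %[mod d])%:R.
  have per (c : nat) t : (c * (t + d) == a %[mod d]) = (c * t == a %[mod d]).
    by rewrite mulnDr addnC modnMDl.
  apply: (sum_coprime_periodic_le (F := F)) => //.
  - by move=> t; rewrite /F !per.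
  - move=> t; rewrite /F; case: (_ == _); case: (_ == _);
      by rewrite ?subrr ?subr0 ?sub0r ?normrN ?normr0 ?normr1.
  - move=> e e0; rewrite /F sumrB.
    have := sum_period_mul (F := fun t => (e * t == a %[mod d])%:R : R) d0 _ bd.
    under eq_bigr do rewrite mulnCA; under [X in _ - X]eq_bigr do rewrite mul1n.
    by move=> -> //; [rewrite subrr|move=> t; rewrite per].
have kapD : `|kap| <= D%:R.
  by rewrite ger0_norm ?ler0n// ler_nat card_killed_le.
have inner t1 t2 : t2 \in s -> \sum_(t3 <- coprime_range lo' hi')
     f t1 * 1 * 1 * killed_sum D (t1%:R - a%:R * (t2%:R)^-1 * (t3%:R)^-1) =
    kap * (f t1 * G (t1 * t2)%N).
  move=> t2s; have t2u : (t2%:R : Zq) \is a GRing.unit.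
    by apply: natZp_unit; have /andP[] := sP _ t2s.
  rewrite mulrA mulr_sumr big_seq [RHS]big_seq; apply: eq_bigr => t3.
  rewrite mem_filter => /andP[/natZp_unit t3u _].
  rewrite !mulr1 killed_sumE// -/kap -/d -(natZp_cofactor _ _ dq).
  have -> : ((q0.+2 %/ d)%:R * (t1%:R - a%:R * t2%:R^-1 * t3%:R^-1) == 0 :> Zq) =
      ((q0.+2 %/ d)%:R * ((t1 * t2 * t3)%:R - a%:R) == 0 :> Zq).
    rewrite -(mulIr_eq0 _ (mulIr t2u)) -(mulIr_eq0 _ (mulIr t3u)).
    congr (_ == 0); rewrite -!mulrA; congr (_ * _).
    rewrite !natrM; have := mulVr t2u; have := mulVr t3u.
    move: ((t2%:R : Zq)^-1) ((t3%:R : Zq)^-1) => u2 u3 e3 e2.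
    transitivity (t1%:R * t2%:R * t3%:R - a%:R * (u2 * t2%:R) * (u3 * t3%:R) : Zq).
      by ring.
    by rewrite e2 e3 !mulr1.
  by case: ifP => _; rewrite ?mulr1 ?mulr0// mulrC.
rewrite exchange_big /= big_seq.
under eq_bigr => t2 t2s do under eq_bigr do rewrite (inner _ _ t2s).
rewrite -big_seq.
apply: le_trans (ler_norm_sum _ _ _) _.
apply: (@le_trans _ _ (\sum_(t2 <- s) (D%:R * (D%:R * ((hi' - lo')%:R + (hi - lo)%:R * w))))).
  rewrite big_seq [leRHS]big_seq; apply: ler_sum => t2 t2s.
  rewrite -mulr_sumr normrM; apply: ler_pM => //.
  (* Replacing [G (t1 * t2)] by the constant [G 1] leaves a sum of [f] over an interval, at most
     [D], and an error of at most [w * D] for each [t1]. *)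
  have -> : \sum_(lo <= t1 < hi) f t1 * G (t1 * t2)%N =
     G 1%N * (\sum_(lo <= t1 < hi) f t1) + \sum_(lo <= t1 < hi) f t1 * (G (t1 * t2)%N - G 1%N).
    by rewrite mulr_sumr -big_split; apply: eq_bigr => t _ /=; ring.
  apply: le_trans (ler_normD _ _) _; rewrite mulrDr; apply: lerD.
    rewrite normrM mulrC; apply: ler_pM => //; first exact: sum_periodic_le.
    rewrite /G /coprime_range big_filter big_mkcond; apply: sum_nat_bounded => t.
    by case: ifP => _; rewrite ?normr0// normr_nat lern1 leq_b1.
  apply: le_trans (ler_norm_sum _ _ _) _.
  apply: (@le_trans _ _ (\sum_(lo <= t1 < hi) w * D%:R)); last first.
    by rewrite sumr_const_nat -mulr_natr le_eqVlt; apply/orP; left; apply/eqP; ring.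
  apply: ler_sum => t1 _; have [->|ft] := eqVneq (f t1) 0.
    by rewrite mul0r normr0 mulr_ge0 ?exprn_ge0.
  rewrite normrM -[leRHS]mul1r; apply: ler_pM => //.
  apply: (@le_trans _ _ (w * d%:R)); last first.
    by rewrite ler_wpM2l ?exprn_ge0// ler_nat dvdn_leq.
  apply: GB; rewrite coprimeMl (coprime_dvdr dD (fcop _ ft)) /=.
  by apply: coprime_dvdr dq _; have /andP[] := sP _ t2s.
rewrite big_const_seq count_predT iter_addr_0 -[_ *+ size s]mulr_natr.
have sN : ((size s)%:R : R) <= N%:R by rewrite ler_nat (unit_range_size us).
set B := (X in X * (size s)%:R); have B0 : 0 <= B by rewrite !mulr_ge0 ?addr_ge0 ?mulr_ge0 ?exprn_ge0.
apply: (@le_trans _ _ (B * N%:R)); first exact: ler_wpM2l.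
by rewrite /B le_eqVlt; apply/orP; left; apply/eqP; ring.
Qed.

End MainTerm.

(** * The ternary sum over natural numbers *)

(** For [M >= 0], [M <= t < M'] means [natceil M <= t < natceil M'], so the real intervals become
    half-open ranges of naturals. *)
Definition natceil (R : realType) (x : R) : nat := `|Num.ceil x|%N.

Lemma natceil_le (R : realType) (x : R) (n : nat) : 0 <= x ->
  (natceil x <= n)%N = (x <= n%:R).
Proof.
move=> x0; rewrite /natceil -lez_nat gez0_abs; last first.
  by rewrite -(ceil0 R) le_ceil.
by rewrite real_ceil_le_int ?num_real.
Qed.

Lemma natceil_ge (R : realType) (x : R) : 0 <= x -> x <= (natceil x)%:R.
Proof. by move=> x0; rewrite -natceil_le. Qed.

Lemma natceil_ltD1 (R : realType) (x : R) : 0 <= x -> (natceil x)%:R < x + 1.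
Proof.
move=> x0; have [->|n0] := posnP (natceil x); first by rewrite ltr_wpDl.
have : ~~ (natceil x <= (natceil x).-1)%N by rewrite -ltnNge prednK.
by rewrite natceil_le// -ltNge -{2}(prednK n0) -natr1 ltrD2r.
Qed.

Definition nat_ternary (R : realType) (l1 h1 l2 h2 l3 h3 : nat)
    (f1 f2 f3 : nat -> R) (a q : nat) : R :=
  \sum_(l1 <= t1 < h1) \sum_(l2 <= t2 < h2) \sum_(l3 <= t3 < h3)
    if (t1 * t2 * t3 == a %[mod q])%N then f1 t1 * f2 t2 * f3 t3 else 0.

Lemma short_rangeP (R : realType) (Delta M : R) (t : int) :
  0 < Delta -> 0 < M -> short_range Delta M t <->
  exists2 n : nat, n \in index_iota (natceil M) (natceil (M * (1 + Delta))) & t = n%:Z.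
Proof.
move=> D0 M0; have MD0 : 0 <= M * (1 + Delta) by rewrite mulr_ge0 ?ltW// addr_gt0.
have M0' := ltW M0.
split=> [/andP[Mt tM]|[n + ->]].
  have t0 : 0 <= t by rewrite -(ler_int R) (le_trans M0').
  exists `|t|%N; last by rewrite gez0_abs.
  rewrite mem_index_iota natceil_le// ltnNge natceil_le// -ltNge.
  by rewrite -[(`|t|%N)%:R]/((`|t|%N%:Z)%:~R) gez0_abs// Mt tM.
rewrite mem_index_iota natceil_le// ltnNge natceil_le// -ltNge => /andP[Mn nM].
by apply/andP.
Qed.

Lemma ternary_sumE (R : realType) (Delta M1 M2 M3 : R) (f1 f2 f3 : int -> R)
    (a q : nat) : 0 < Delta -> 0 < M1 -> 0 < M2 -> 0 < M3 ->
  ternary_sum Delta M1 M2 M3 f1 f2 f3 a q =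
  nat_ternary (natceil M1) (natceil (M1 * (1 + Delta)))
    (natceil M2) (natceil (M2 * (1 + Delta)))
    (natceil M3) (natceil (M3 * (1 + Delta)))
    (fun t => f1 t%:Z) (fun t => f2 t%:Z) (fun t => f3 t%:Z) a q.
Proof.
move=> D0 M10 M20 M30; rewrite /ternary_sum /nat_ternary.
set I1 := index_iota (natceil M1) _; set I2 := index_iota (natceil M2) _.
set I3 := index_iota (natceil M3) _.
pose P (t : nat * nat * nat) := (t.1.1 * t.1.2 * t.2 == a %[mod q])%N.
pose L := [seq t <- allpairs pair (allpairs pair I1 I2) I3 | P t].
pose z (t : nat * nat * nat) : int * int * int := (t.1.1%:Z, t.1.2%:Z, t.2%:Z).
have congE (t : nat * nat * nat) : P t <->
    (t.1.1%:Z * t.1.2%:Z * t.2%:Z = a%:Z %[mod q%:Z])%Z.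
  rewrite -!PoszM !modz_nat /P; split=> [/eqP -> //|[/eqP]] //.
have zinj : injective z.
  by move=> [[x y] w] [[x' y'] w'] [-> -> ->].
have uL : uniq (map z L).
  rewrite map_inj_uniq//; apply: filter_uniq; apply: allpairs_uniq.
  - apply: allpairs_uniq; rewrite ?iota_uniq// => -[x y] [x' y'] _ _ /= [-> ->] //.
  - exact: iota_uniq.
  - by move=> [x y] [x' y'] _ _ /= [-> ->].
have memL (t : nat * nat * nat) : (t \in L) = [&& P t, t.1.1 \in I1, t.1.2 \in I2 & t.2 \in I3].
  rewrite mem_filter; case: (P t) => //=; apply/allpairsP/and3P.
    by move=> [[u w] /= [/allpairsP[[x y] /= [xI yI ->]] wI ->]].
  move=> [h1 h2 h3]; exists (t.1, t.2); split=> //=; last by case: t {h1 h2 h3}.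
  by apply/allpairsP; exists t.1; split=> //; case: t.1.
have setE : [set t : int * int * int | [/\ short_range Delta M1 t.1.1,
    short_range Delta M2 t.1.2, short_range Delta M3 t.2 &
    (t.1.1 * t.1.2 * t.2 = a%:Z %[mod q%:Z])%Z]]%classic = [set` map z L]%classic.
  apply/seteqP; split=> t /=.
    move=> [/(short_rangeP _ D0 M10)[n1 n1I e1] /(short_rangeP _ D0 M20)[n2 n2I e2]].
    move=> /(short_rangeP _ D0 M30)[n3 n3I e3] c.
    have -> : t = z (n1, n2, n3).
      by rewrite [t]surjective_pairing [t.1]surjective_pairing e1 e2 e3.
    rewrite map_f// memL /= n1I n2I n3I !andbT; apply/congE.
    by rewrite /= -e1 -e2 -e3.
  move=> /mapP[n + ->]; rewrite memL => /and4P[/congE c n1 n2 n3].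
  split=> //=; [apply/(short_rangeP _ D0 M10)|apply/(short_rangeP _ D0 M20)|
    apply/(short_rangeP _ D0 M30)]; by [exists n.1.1|exists n.1.2|exists n.2].
by rewrite setE -fsbig_seq// big_map /L big_filter big_mkcond !big_allpairs.
Qed.

(** Triples are grouped by their product, which runs over one class modulo [q]; a product with at
    most [T] divisors has at most [T * T] factorisations into three factors. *)
Lemma nat_ternary_trivial (R : realType) (l1 h1 l2 h2 l3 h3 T : nat)
    (f1 f2 f3 : nat -> R) (a q : nat) : (0 < q)%N ->
  (0 < l1)%N -> (0 < l2)%N -> (0 < l3)%N ->
  (forall t, `|f1 t| <= 1) -> (forall t, `|f2 t| <= 1) -> (forall t, `|f3 t| <= 1) ->
  (forall n, (0 < n)%N -> (n <= h1 * h2 * h3)%N -> (size (divisors n) <= T)%N) ->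
  `|nat_ternary l1 h1 l2 h2 l3 h3 f1 f2 f3 a q| <=
    ((T * T) * ((h1 * h2 * h3) %/ q).+1)%:R.
Proof.
move=> q0 l10 l20 l30 f11 f21 f31 TP; rewrite /nat_ternary.
set I1 := index_iota l1 h1; set I2 := index_iota l2 h2; set I3 := index_iota l3 h3.
set X := (h1 * h2 * h3)%N in TP *.
pose P (t : nat * nat * nat) := (t.1.1 * t.1.2 * t.2 == a %[mod q])%N.
pose L := [seq t <- allpairs pair (allpairs pair I1 I2) I3 | P t].
apply: (@le_trans _ _ (\sum_(t <- L) (1 : R))).
  rewrite /L big_filter [leRHS]big_mkcond !big_allpairs /P /=.
  apply: le_trans (ler_norm_sum _ _ _) _; apply: ler_sum => t1 _.
  apply: le_trans (ler_norm_sum _ _ _) _; apply: ler_sum => t2 _.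
  apply: le_trans (ler_norm_sum _ _ _) _; apply: ler_sum => t3 _.
  case: ifP => _; last by rewrite normr0.
  by rewrite !normrM mulr_ile1 ?mulr_ge0// mulr_ile1.
rewrite big_const_seq count_predT iter_addr_0 ler_nat.
have memL (t : nat * nat * nat) : t \in L -> [&& P t, t.1.1 \in I1, t.1.2 \in I2 & t.2 \in I3].
  rewrite mem_filter; case: (P t) => //= /allpairsP.
  by move=> [[u w] /= [/allpairsP[[x y] /= [xI yI ->]] wI ->]]; apply/and3P.
have uL : uniq L.
  apply: filter_uniq; apply: allpairs_uniq.
  - by apply: allpairs_uniq; rewrite ?iota_uniq// => -[x y] [x' y'] _ _ /= [-> ->].
  - exact: iota_uniq.
  - by move=> [x y] [x' y'] _ _ /= [-> ->].
clearbody L.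
pose g (t : nat * nat * nat) := (t.1.1 * t.1.2 * t.2)%N.
have gP t : t \in L -> (0 < g t)%N /\ (g t < X)%N.
  move=> /memL/and4P[_]; rewrite !mem_index_iota => /andP[a1 b1] /andP[a2 b2] /andP[a3 b3].
  rewrite /g !muln_gt0 (leq_trans l10 a1) (leq_trans l20 a2) (leq_trans l30 a3).
  split => //; rewrite /X.
  apply: (@leq_ltn_trans (h1 * h2 * t.2)); first by rewrite !leq_mul// ltnW.
  by rewrite ltn_pmul2l// muln_gt0 (leq_ltn_trans _ b1)// (leq_ltn_trans _ b2).
rewrite -[(X %/ q).+1](size_iota 0) -(size_map (fun j => a %% q + j * q)%N).
apply: (@size_fiber_le (nat * nat * nat)%type nat _ g).
  move=> t tL; have [g0 gX] := gP t tL; apply/mapP; exists (g t %/ q)%N.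
    by rewrite mem_iota /= add0n ltnS leq_div2r// ltnW.
  have /and4P[/eqP c _ _ _] := memL t tL.
  by rewrite -c -/(g t) addnC -divn_eq.
move=> n _; rewrite -size_filter.
set F := (X in (size X <= _)%N).
have FP t : t \in F -> t \in L /\ g t = n.
  by rewrite mem_filter => /andP[/eqP -> ->].
have uF : uniq F by exact: filter_uniq.
clearbody F; case: F FP uF => // t0 F FP uF.
have [t0L t0n] := FP t0 (mem_head _ _); have [n0 nX] := gP _ t0L; rewrite t0n in n0 nX.
apply: (@leq_trans (size (allpairs pair (divisors n) (divisors n)))); last first.
  by rewrite size_allpairs leq_mul// TP// ltnW.
apply: (@size_inj_le (nat * nat * nat)%type (nat * nat)%type _ (fun t => t.1)) => //.
  move=> t t' /FP[tL tn] /FP[t'L t'n] E.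
  rewrite [t]surjective_pairing [t']surjective_pairing -E; congr pair.
  have g0 : (0 < t.1.1 * t.1.2)%N.
    by have [+ _] := gP _ tL; rewrite /g muln_gt0 => /andP[].
  by apply/eqP; rewrite -(eqn_pmul2l g0); apply/eqP; move: tn t'n; rewrite /g -E => -> ->.
move=> t /FP[tL tn]; apply/allpairsP; exists t.1; split; last by case: t.1.
  by rewrite -dvdn_divisors// -tn /g -mulnA dvdn_mulr.
by rewrite -dvdn_divisors// -tn /g mulnAC dvdn_mull.
Qed.

Lemma coprime_range_unit (q0 lo hi N : nat) : (0 < lo)%N -> (hi <= N.+1)%N ->
  unit_range q0 N (coprime_range q0 lo hi).
Proof.
move=> lo0 hN; split; first by apply: filter_uniq; exact: iota_uniq.
move=> t; rewrite mem_filter mem_index_iota => /andP[-> /andP[lt th]].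
by rewrite andbT (leq_trans lo0 lt) -ltnS (leq_trans th).
Qed.

(** Since [a] is prime to [q], the congruence forces [t2] and [t3] to be units, and it can be solved
    for [t1]. *)
Lemma nat_ternary_unit (R : realType) (l1 h1 l2 h2 l3 h3 : nat)
    (f1 f2 f3 : nat -> R) (a q0 : nat) : coprime a q0.+2 ->
  nat_ternary l1 h1 l2 h2 l3 h3 f1 f2 f3 a q0.+2 =
  \sum_(l1 <= t1 < h1) \sum_(t2 <- coprime_range q0 l2 h2)
    \sum_(t3 <- coprime_range q0 l3 h3)
     if t1%:R == a%:R * (t2%:R)^-1 * (t3%:R)^-1 :> 'Z_q0.+2
     then f1 t1 * f2 t2 * f3 t3 else 0.
Proof.
move=> aq; apply: eq_bigr => t1 _; rewrite /coprime_range big_filter [RHS]big_mkcond.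
have cong (m : nat) : (m == a %[mod q0.+2]) -> coprime m q0.+2.
  by move=> /eqP E; rewrite -coprime_modl E coprime_modl.
apply: eq_bigr => t2 _; case: ifP => c2; last first.
  apply: big1 => t3 _; case: ifP => // /cong.
  by rewrite !coprimeMl c2 andbF.
rewrite big_filter [RHS]big_mkcond; apply: eq_bigr => t3 _.
case c3: (coprime t3 q0.+2); last first.
  by case: ifP => // /cong; rewrite !coprimeMl c3 andbF.
congr (if _ then _ else _).
have u2 := natZp_unit c2; have u3 := natZp_unit c3.
rewrite -(inj_eq (mulIr u3)) mulrVK// -(inj_eq (mulIr u2)) mulrVK//.
rewrite mulrAC -!natrM; apply/eqP/eqP => [E|/natZp_mod //].
by apply: val_inj; rewrite /= !val_Zp_nat.
Qed.

(** The Hölder bound for the fourth power of the error as a function of real parameters, with [Y]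
    replaced by [N1 / q]. *)
Definition error_majorant (R : realType) (q D T N1 N2 E : R) (H : R) : R :=
  (2 * D * N2 * H) ^+ 2 *
   (D ^+ 2 * (24 * T ^+ 2 * (N1 / q * N2 * H + 2 * N2 ^+ 2 * H ^+ 2 / q))) *
   (q * E).

Lemma range_size_le (l h N : nat) : (0 < l)%N -> (h <= N.+1)%N -> (h - l <= N)%N.
Proof. lia. Qed.

(** * The bound for all three positions of the character *)

Section Equidistribution.
Variables (R : realType) (q0 l1 h1 l2 h2 l3 h3 N1 N2 N3 T a : nat).
Hypotheses (l10 : (0 < l1)%N) (l20 : (0 < l2)%N) (l30 : (0 < l3)%N).
Hypotheses (lh1 : (l1 <= h1)%N) (hN1 : (h1 <= N1.+1)%N) (hN2 : (h2 <= N2.+1)%N).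
Hypotheses (hN3 : (h3 <= N3.+1)%N) (N32 : (N3 <= N2)%N) (N21 : (N2 <= N1)%N).
Hypotheses (N2q : (N2 < q0.+2)%N) (aq : coprime a q0.+2).
Hypothesis TP : forall n, (0 < n)%N -> (n <= q0.+2 * N2)%N ->
  (size (divisors n) <= T)%N.

Let s2 := coprime_range q0 l2 h2.
Let s3 := coprime_range q0 l3 h3.
Let q : R := q0.+2%:R.
Let En : R := (inverse_energy q0 s3)%:R.
Let H : R := harm R q0.+2.
Let w : R := 2 ^+ size (primes q0.+2).

(** The zero-frequency part is left unevaluated because its treatment depends on which of the three
    functions is [chi]. *)
Lemma completed_bound (D : nat) (f1 f2 f3 : nat -> R) : (0 < D)%N ->
  (forall t, f1 (t + D)%N = f1 t) ->
  (forall t, `|f1 t| <= 1) -> (forall t, `|f2 t| <= 1) -> (forall t, `|f3 t| <= 1) ->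
  exists2 E1 : R, 0 <= E1 /\ E1 ^+ 4 <= error_majorant q D%:R T%:R N1%:R N2%:R En H &
   q * `|nat_ternary l1 h1 l2 h2 l3 h3 f1 f2 f3 a q0.+2| <=
   `|\sum_(l1 <= t1 < h1) \sum_(t2 <- s2) \sum_(t3 <- s3)
     f1 t1 * f2 t2 * f3 t3 *
     @killed_sum R q0 D (t1%:R - a%:R * (t2%:R)^-1 * (t3%:R)^-1)|
   + q * D%:R * E1.
Proof.
move=> D0 fD f11 f21 f31.
have us2 : unit_range q0 N2 s2 by exact: coprime_range_unit.
pose Y : R := (h1 - l1)%:R / q.
have q1 : 0 < q by rewrite ltr0n.
have Y0 : 0 <= Y by rewrite divr_ge0// ltW.
have au : (a%:R : 'Z_q0.+2) \is a GRing.unit by exact: natZp_unit.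
have moment := error_fourth_moment s3 D0 us2 N2q Y0 f31 au TP.
have err := error_bound s2 s3 f3 a%:R D0 lh1 fD f11 f21.
set E1 := \sum_(p <- _) _ in moment.
exists E1.
  split.
    by apply: sumr_ge0 => p _; rewrite mulr_ge0 ?sqrtr_ge0 ?freq_weight_ge0.
  apply: le_trans moment _; rewrite -/q -/En -/H /error_majorant.
  have H0 : 0 <= H by exact: harm_ge0.
  have E0 : 0 <= En by rewrite ler0n.
  apply: ler_wpM2r; first by rewrite mulr_ge0// ltW.
  apply: ler_wpM2l; first exact: sqr_ge0.
  apply: ler_wpM2l; first exact: sqr_ge0.
  apply: ler_wpM2l; first by rewrite mulr_ge0 ?sqr_ge0.
  rewrite lerD2r; apply: ler_wpM2r => //; apply: ler_wpM2r => //.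
  by rewrite /Y ler_wpM2r ?invr_ge0 ?(ltW q1)// ler_nat range_size_le.
rewrite nat_ternary_unit// -[X in X * `|_|](ger0_norm (ltW q1)) -normrM.
rewrite (ternary_completion D); apply: le_trans (ler_normD _ _) _.
by rewrite lerD2l.
Qed.

Lemma error_majorant_le (D : nat) (H0 : R) : (0 < D)%N -> 0 <= H0 ->
  error_majorant q 1 T%:R N1%:R N2%:R En H0 <= error_majorant q D%:R T%:R N1%:R N2%:R En H0.
Proof.
move=> D0 HH; have D1 : 1 <= (D%:R : R) by rewrite ler1n.
have q1 : 0 <= q by rewrite ler0n.
have D2 : 1 <= (D%:R : R) ^+ 2 by rewrite exprn_ege1.
rewrite /error_majorant; set A := 24 * _ * _.
have A0 : 0 <= A.
  by rewrite !mulr_ge0 ?addr_ge0 ?mulr_ge0 ?invr_ge0 ?sqr_ge0.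
apply: ler_wpM2r; first by rewrite mulr_ge0 ?ler0n.
rewrite expr1n mul1r; apply: ler_pM => //; first exact: sqr_ge0.
  apply: lerXn2r; rewrite ?nnegrE ?mulr_ge0//.
  by rewrite ler_wpM2r// ler_wpM2r// ler_wpM2l.
by rewrite ler_peMl.
Qed.

(** If [chi] is [f1], completion is done with period [D]. Otherwise it is done with period 1, where
    [chi] cancels over integers prime to [q], and the smaller majorant is raised to the common
    one. *)
Lemma equidistribution_bound (D : nat) (chi f1 f2 f3 : int -> R) :
  quadratic_character D chi -> exactly_one_is chi f1 f2 f3 ->
  exists2 E1 : R, 0 <= E1 /\ E1 ^+ 4 <= error_majorant q D%:R T%:R N1%:R N2%:R En H &
   `|nat_ternary l1 h1 l2 h2 l3 h3 (fun t => f1 t%:Z) (fun t => f2 t%:Z)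
      (fun t => f3 t%:Z) a q0.+2| <=
   2 * D%:R ^+ 2 * N1%:R * N2%:R * w / q + D%:R * E1.
Proof.
move=> qc one; have [D0 chiD chi1 chicop chisum] := quadratic_character_props qc.
have q1 : 0 < q by rewrite ltr0n.
have w1 : 1 <= w by rewrite exprn_ege1// ler1n.
have D1 : 1 <= (D%:R : R) by rewrite ler1n.
have us2 : unit_range q0 N2 s2 by exact: coprime_range_unit.
have us3 : unit_range q0 N3 s3 by exact: coprime_range_unit.
have H0 : 0 <= H by exact: harm_ge0.
have N3R : (N3%:R : R) <= N2%:R by rewrite ler_nat.
have N2R : (N2%:R : R) <= N1%:R by rewrite ler_nat.
have n1N : ((h1 - l1)%:R : R) <= N1%:R by rewrite ler_nat range_size_le.
have n2N : ((size s2)%:R : R) <= N2%:R by rewrite ler_nat (unit_range_size us2).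
have n3N : ((size s3)%:R : R) <= N3%:R by rewrite ler_nat (unit_range_size us3).
have one1 (t : nat) : `|(fun=> 1 : R) t%:Z| <= 1 by rewrite normr1.
have chis (lo hi : nat) : `|\sum_(t <- coprime_range q0 lo hi) chi t%:Z| <= w * D%:R.
  by rewrite big_filter; apply: (sum_coprime_periodic_le (F := fun t => chi t%:Z)) => // e _.
have ones (s : seq nat) : `|\sum_(t <- s) (1 : R)| = (size s)%:R.
  by rewrite big_const_seq count_predT iter_addr_0 normr_nat.
suff [E1 [E10 E14] key] : exists2 E1 : R, 0 <= E1 /\
    E1 ^+ 4 <= error_majorant q D%:R T%:R N1%:R N2%:R En H &
   q * `|nat_ternary l1 h1 l2 h2 l3 h3 (fun t => f1 t%:Z) (fun t => f2 t%:Z)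
      (fun t => f3 t%:Z) a q0.+2| <= 2 * D%:R ^+ 2 * N1%:R * N2%:R * w + q * D%:R * E1.
  exists E1 => //; rewrite -(ler_pM2l q1); apply: le_trans key _.
  by rewrite mulrDr le_eqVlt; apply/orP; left; apply/eqP; field; rewrite gt_eqF.
have split_case (g1 g2 g3 : int -> R) :
    (forall t : nat, g1 (t + 1)%N%:Z = g1 t%:Z) ->
    (forall t : nat, `|g1 t%:Z| <= 1) -> (forall t : nat, `|g2 t%:Z| <= 1) ->
    (forall t : nat, `|g3 t%:Z| <= 1) ->
    `|(\sum_(l1 <= t1 < h1) g1 t1%:Z) * (\sum_(t2 <- s2) g2 t2%:Z) * (\sum_(t3 <- s3) g3 t3%:Z)|
      <= 2 * D%:R ^+ 2 * N1%:R * N2%:R * w ->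
    exists2 E1 : R, 0 <= E1 /\
    E1 ^+ 4 <= error_majorant q D%:R T%:R N1%:R N2%:R En H &
   q * `|nat_ternary l1 h1 l2 h2 l3 h3 (fun t => g1 t%:Z) (fun t => g2 t%:Z)
      (fun t => g3 t%:Z) a q0.+2| <= 2 * D%:R ^+ 2 * N1%:R * N2%:R * w + q * D%:R * E1.
  move=> g1p g11 g21 g31 bnd.
  have [E1 [E10 E14]] := completed_bound (ltn0Sn 0) (f1 := fun t => g1 t%:Z)
    (f2 := fun t => g2 t%:Z) (f3 := fun t => g3 t%:Z) g1p g11 g21 g31.
  rewrite main_term_split => key; exists E1.
    by split=> //; apply: le_trans E14 _; exact: error_majorant_le.
  apply: le_trans key _; apply: lerD => //.
  by rewrite ler_wpM2r// ler_wpM2l// ltW.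
have DD : D%:R <= (D%:R : R) ^+ 2 by rewrite expr2 ler_peMl.
case: one => [[-> -> ->]|[-> -> ->]|[-> -> ->]].
- have [E1 [E10 E14] key] := completed_bound D0 (f1 := fun t => chi t%:Z)
    (f2 := fun=> 1) (f3 := fun=> 1) chiD chi1 (fun=> one1 0%N) (fun=> one1 0%N).
  exists E1 => //; apply: le_trans key _; rewrite lerD2r.
  have chisum1 : \sum_(0 <= t < D) chi t%:Z = 0.
    by have := chisum 1%N; under eq_bigr do rewrite mul1n.
  apply: le_trans (main_term_character l1 h1 l3 h3 D0 us2 aq chiD chi1 chicop chisum1) _.
  (* The 2 makes room for both contributions of the main term, each at most [N1 * w]. *)
  have -> : 2 * D%:R ^+ 2 * N1%:R * N2%:R * w = D%:R ^+ 2 * N2%:R * (N1%:R * w + N1%:R * w).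
    by ring.
  apply: ler_wpM2l; first by rewrite mulr_ge0 ?sqr_ge0.
  apply: lerD; last by rewrite ler_wpM2r// (le_trans ler01).
  apply: (@le_trans _ _ N1%:R); last by rewrite ler_peMr.
  by rewrite ler_nat (leq_trans (range_size_le l30 hN3))// (leq_trans N32).
- apply: (split_case (fun=> 1) chi (fun=> 1)) => //; rewrite !normrM !ones size_iota.
  have -> : 2 * D%:R ^+ 2 * N1%:R * N2%:R * w = N1%:R * (w * D%:R ^+ 2) * N2%:R + D%:R ^+ 2 * N1%:R * N2%:R * w.
    by ring.
  rewrite -[leLHS]addr0; apply: lerD; last by rewrite !mulr_ge0 ?sqr_ge0// (le_trans ler01).
  apply: ler_pM; rewrite ?mulr_ge0 ?normr_ge0//; last exact: le_trans n3N N3R.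
  apply: ler_pM; rewrite ?normr_ge0//.
  apply: le_trans (chis _ _) _; rewrite ler_wpM2l// (le_trans ler01)//.
- apply: (split_case (fun=> 1) (fun=> 1) chi) => //; rewrite !normrM !ones size_iota.
  have -> : 2 * D%:R ^+ 2 * N1%:R * N2%:R * w = N1%:R * N2%:R * (w * D%:R ^+ 2) + D%:R ^+ 2 * N1%:R * N2%:R * w.
    by ring.
  rewrite -[leLHS]addr0; apply: lerD; last by rewrite !mulr_ge0 ?sqr_ge0// (le_trans ler01).
  apply: ler_pM; rewrite ?mulr_ge0 ?normr_ge0//; first by apply: ler_pM.
  apply: le_trans (chis _ _) _; rewrite ler_wpM2l// (le_trans ler01)//.
Qed.

End Equidistribution.

(** * Numerical bounds *)

(** Subject to [Rn Sn >= q], the terms [Rn N] and [Sn N^2] balance at [Rn = sqrt(q N)] and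
    [Sn = sqrt(q / N)], and both are then [q^(1/2) N^(3/2)]. *)
Lemma inverse_energy_real (R : realType) (q0 N T : nat) (s : seq nat) :
  unit_range q0 N s -> (0 < N)%N -> (N < q0.+2)%N -> (4 <= q0.+2)%N ->
  (forall n, (0 < n)%N -> (n <= 19 * q0.+2 ^ 3)%N -> (size (divisors n) <= T)%N) ->
  (inverse_energy q0 s)%:R <=
    28 * N%:R ^+ 2 * T%:R * (1 + Num.sqrt N%:R ^+ 3 / Num.sqrt q0.+2%:R) :> R.
Proof.
move=> us N0 Nq q4 TP.
have T1 : (1 <= (T%:R : R)).
  by rewrite ler1n; apply: leq_trans (TP 1%N isT _) => //; rewrite muln_gt0 expn_gt0.
set sq : R := Num.sqrt q0.+2%:R; set m : R := Num.sqrt N%:R.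
have sqE : sq ^+ 2 = q0.+2%:R by rewrite sqr_sqrtr.
have mE : m ^+ 2 = N%:R by rewrite sqr_sqrtr.
have m1 : 1 <= m by rewrite -sqrtr1 ler_sqrt ?ler1n.
have sq2 : 2 <= sq.
  have -> : 2 = Num.sqrt (2 ^+ 2) :> R by rewrite sqrtr_sqr ger0_norm.
  by rewrite ler_sqrt// -natrX ler_nat.
have msq : m < sq by rewrite ltr_sqrt ?ltr_nat ?ltr0n.
have smge : 1 <= sq / m by rewrite ler_pdivlMr; lra.
have ssm0 : 0 <= sq * m by nra.
have ssd0 : 0 <= sq / m by lra.
pose Rn := natceil (sq * m); pose Sn := natceil (sq / m).
have Rn1 : sq * m <= Rn%:R by exact: natceil_ge.
have Sn1 : sq / m <= Sn%:R by exact: natceil_ge.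
have Rn2 : Rn%:R <= 2 * (sq * m) :> R by have := natceil_ltD1 ssm0; rewrite -/Rn; nra.
have Sn2' : Sn%:R < sq / m + 1 :> R by have := natceil_ltD1 ssd0.
have Sn2 : Sn%:R <= 2 * (sq / m) :> R by lra.
have sm_le : sq / m <= sq by rewrite ler_pdivrMr; nra.
clearbody sq m Rn Sn.
have qRS : (q0.+2 < Rn.+1 * Sn.+1)%N.
  suff h : (q0.+2 <= Rn * Sn)%N.
    apply: leq_ltn_trans h _.
    by rewrite mulSn mulnS addSn ltnS addnA leq_addl.
  rewrite -(ler_nat R) natrM -sqE.
  have -> : sq ^+ 2 = sq * m * (sq / m) by field; lra.
  by apply: ler_pM.
have Sq : (Sn < q0.+2)%N by rewrite -(ltr_nat R) -sqE; nra.
pose Kb := ((2 * Rn * N + Sn * N ^ 2) %/ q0.+2).+1.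
have KbP : (2 * Rn * N + Sn * N ^ 2 <= Kb * q0.+2)%N by rewrite ltnW// ltn_ceil.
set u := m ^+ 3 / sq.
have u0 : 0 <= u by rewrite divr_ge0 ?exprn_ge0//; lra.
have uN : u <= q0.+2%:R.
  by rewrite /u ler_pdivrMr -?sqE; nra.
have Kb6 : Kb%:R <= 6 * u + 1 :> R.
  rewrite /Kb -natr1 lerD2r.
  apply: (@le_trans _ _ ((2 * Rn * N + Sn * N ^ 2)%:R / q0.+2%:R)).
    by rewrite ler_pdivlMr ?ltr0n// -natrM ler_nat leq_divM.
  rewrite ler_pdivrMr ?ltr0n//.
  rewrite (_ : (2 * Rn * N + Sn * N ^ 2)%:R =
    2 * Rn%:R * m ^+ 2 + Sn%:R * (m ^+ 2) ^+ 2); last first.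
    by rewrite natrD mE -natrX -!natrM.
  rewrite -sqE.
  have -> : 6 * u * sq ^+ 2 = 2 * (2 * (sq * m)) * m ^+ 2 + 2 * (sq / m) * (m ^+ 2) ^+ 2.
    by rewrite /u; field; lra.
  apply: lerD; apply: ler_wpM2r; rewrite ?sqr_ge0//.
  by rewrite ler_wpM2l.
(* The argument is at most [4 q^2 + 14 q^3 + q], and [4 q^2 <= q^3] because [q >= 4]. *)
have TP' n : (0 < n)%N -> (n <= Rn ^ 2 + (Sn * Kb).+1 * q0.+2)%N ->
    (size (divisors n) <= T)%N.
  move=> n0 nle; apply: TP => //; apply: leq_trans nle _.
  rewrite -(ler_nat R) (_ : (19 * q0.+2 ^ 3)%:R = 19 * q0.+2%:R ^+ 3); last first.
    by rewrite natrM natrX.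
  rewrite (_ : (Rn ^ 2 + (Sn * Kb).+1 * q0.+2)%:R =
    Rn%:R ^+ 2 + (Sn%:R * Kb%:R + 1) * q0.+2%:R); last first.
    by rewrite natrD natrM -[(Sn * Kb).+1%:R]natr1 natrM natrX.
  have q1 : 4 <= (q0.+2%:R : R) by rewrite (ler_nat _ 4).
  have NN : (N%:R : R) <= q0.+2%:R by rewrite ler_nat ltnW.
  have R2 : Rn%:R ^+ 2 <= 4 * q0.+2%:R ^+ 2 :> R.
    apply: (@le_trans _ _ ((2 * (sq * m)) ^+ 2)).
      by apply: lerXn2r; rewrite ?nnegrE// mulr_ge0.
    have -> : (2 * (sq * m)) ^+ 2 = 4 * (sq ^+ 2 * m ^+ 2) by ring.
    by rewrite ler_wpM2l// sqE mE expr2 ler_wpM2l.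
  have SK : Sn%:R * Kb%:R <= 2 * q0.+2%:R * (7 * q0.+2%:R) :> R.
    apply: ler_pM => //; last by nra.
    by apply: le_trans Sn2 _; rewrite -sqE; nra.
  move: (Rn%:R ^+ 2 : R) (Sn%:R * Kb%:R) (q0.+2%:R : R) R2 SK q1 => r k Q R2 SK q1.
  have Q0 : 0 <= Q by lra.
  have e1 : k * Q <= 2 * Q * (7 * Q) * Q by exact: ler_wpM2r.
  have e2 : 4 * Q ^+ 2 <= Q * Q ^+ 2 by rewrite ler_wpM2r ?sqr_ge0.
  have e3 : 1 * Q <= Q ^+ 2 * Q by rewrite ler_wpM2r// exprn_ege1//; lra.
  lra.
have main := inverse_energy_bound us Nq qRS Sq KbP TP'.
move: main; rewrite -(ler_nat R) => /le_trans; apply.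
set e0 := (_ %/ _)%N.
rewrite (_ : ((2 + (2 * Kb + 1) * (2 * T)) * N ^ 2 + N * (N * e0 * T))%:R =
  (2 + (2 * Kb%:R + 1) * (2 * T%:R)) * N%:R ^+ 2 + N%:R * (N%:R * e0%:R * T%:R));
  last first.
  rewrite natrD; congr (_ + _); last by rewrite !natrM.
  by rewrite natrM natrX natrD natrM natrD !natrM.
have dv : e0%:R <= 4 * u :> R.
  apply: (@le_trans _ _ ((2 * N * Rn)%:R / q0.+2%:R)).
    by rewrite ler_pdivlMr ?ltr0n// -natrM ler_nat leq_divM.
  rewrite ler_pdivrMr ?ltr0n// !natrM -mE -sqE.
  have -> : 4 * u * sq ^+ 2 = 2 * m ^+ 2 * (2 * (sq * m)).
    by rewrite /u; field; lra.
  by rewrite ler_wpM2l// mulr_ge0 ?sqr_ge0.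
clearbody e0 Kb.
move: (e0%:R : R) dv (Kb%:R : R) Kb6 (T%:R : R) T1 => e e4 k k6 t t1.
have -> : N%:R * (N%:R * e * t) = e * t * N%:R ^+ 2 by ring.
rewrite -mulrDl; have -> : 28 * N%:R ^+ 2 * t * (1 + u) = (28 * t * (1 + u)) * N%:R ^+ 2 by ring.
apply: ler_wpM2r; first exact: sqr_ge0.
(* The 28 collects [24 * u] from the residues with a nondegenerate short vector and [4 * u] from the
   bad ones; the constant terms fit below it. *)
clearbody u; have h1 : (2 * k + 1) * (2 * t) <= (12 * u + 3) * (2 * t).
  by apply: ler_wpM2r; lra.
have h2 : e * t <= 4 * u * t by apply: ler_wpM2r; lra.
nra.
Qed.

Lemma harm_le_ln (R : realType) (n : nat) : (0 < n)%N -> harm R n <= 1 + ln n%:R.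
Proof.
move=> n0; apply: (@le_trans _ _ (harm R n.+1)); first exact: harm_le.
case: n n0 => // n _; elim: n => [|n IH].
  by rewrite /harm big_nat1 invr1 ln1 addr0.
rewrite /harm big_nat_recr//= -/(harm R n.+2).
have b0 : 0 < (n.+2%:R : R) by rewrite ltr0n.
have b1 : (n.+2%:R : R)^-1 < 1 by rewrite invf_lt1// ltr1n.
have step : ln (n.+1%:R : R) <= ln n.+2%:R - n.+2%:R^-1.
  have -> : (n.+1%:R : R) = n.+2%:R * (1 + - n.+2%:R^-1).
    rewrite mulrDr mulr1 mulrN divff ?gt_eqF//.
    by rewrite -[n.+2%:R]natr1 addrK.
  rewrite lnM ?posrE ?subr_gt0// lerD2l; apply: le_ln1Dx.
  by rewrite ltrN2.
move: (harm _ _) (ln _) (ln _) (_^-1) IH step => h l2 l1 i; lra.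
Qed.

(** Of the constant, 288 is [24 * 4 * 3], 28 comes from the energy, 729 is [3 ^ 6] from
    [N_i <= 3 M_i], and 9 from [1 + 8 v <= 9 v]. The last step needs [v >= 1], that is,
    [M2 >= q^(1/3)]. *)
Lemma error_majorant_power (R : realType)
    (q D T H E N1 N2 N3 M1 M2 M3 x : R) :
  0 < q -> 0 <= D -> 1 <= T -> 1 <= H -> 1 <= M3 -> M3 <= M2 -> M2 <= M1 ->
  0 <= N1 <= 3 * M1 -> 0 <= N2 <= 3 * M2 -> 0 <= N3 <= 3 * M3 -> N2 <= N1 ->
  M1 * M2 * M3 <= x -> Num.sqrt q <= Num.sqrt M2 ^+ 3 ->
  E <= 28 * N3 ^+ 2 * T * (1 + Num.sqrt N3 ^+ 3 / Num.sqrt q) ->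
  error_majorant q D T N1 N2 E H <=
    (288 * 28 * 729 * 9) * (D ^+ 4 * T ^+ 3 * H ^+ 4) *
    (x * M2 ^+ 3 * (Num.sqrt M2 ^+ 3 / Num.sqrt q)).
Proof.
move=> q0 D0 T1 H1 M31 M32 M21 /andP[N10 N1M] /andP[N20 N2M] /andP[N30 N3M] N21 Mx vq EN.
have sq0 : 0 < Num.sqrt q by rewrite sqrtr_gt0.
have sM0 : 0 <= Num.sqrt M2 by exact: sqrtr_ge0.
have s3 : Num.sqrt N3 <= 2 * Num.sqrt M2.
  have -> : 2 * Num.sqrt M2 = Num.sqrt (2 ^+ 2 * M2).
    by rewrite sqrtrM ?sqr_ge0// sqrtr_sqr ger0_norm.
  by rewrite ler_sqrt ?mulr_ge0 ?sqr_ge0//; lra.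
set v := Num.sqrt M2 ^+ 3 / Num.sqrt q.
have v1 : 1 <= v by rewrite ler_pdivlMr// mul1r.
have u8 : Num.sqrt N3 ^+ 3 / Num.sqrt q <= 8 * v.
  rewrite /v mulrA ler_wpM2r ?invr_ge0 ?(ltW sq0)//.
  rewrite [8 * _](_ : _ = (2 * Num.sqrt M2) ^+ 3); last by ring.
  by apply: lerXn2r; rewrite ?nnegrE ?sqrtr_ge0 ?mulr_ge0.
have T0 : 0 <= T by lra.
have H0 : 0 <= H by lra.
have E9 : E <= 28 * N3 ^+ 2 * T * (9 * v).
  apply: le_trans EN _; apply: ler_wpM2l; last lra.
  by rewrite !mulr_ge0 ?sqr_ge0.
clearbody v.
have Y3 : N1 * N2 * H + 2 * N2 ^+ 2 * H ^+ 2 <= 3 * (N1 * N2 * H ^+ 2).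
  have e1 : N1 * N2 * H * 1 <= N1 * N2 * H * H by rewrite ler_wpM2l// !mulr_ge0.
  have e2 : N2 * (N2 * H ^+ 2) <= N1 * (N2 * H ^+ 2).
    by rewrite ler_wpM2r// mulr_ge0// sqr_ge0.
  by rewrite (_ : N1 * N2 * H ^+ 2 = N1 * N2 * H * H); [nra|ring].
rewrite (_ : error_majorant q D T N1 N2 E H =
  (96 * D ^+ 4 * N2 ^+ 2 * H ^+ 2 * T ^+ 2) *
  (N1 * N2 * H + 2 * N2 ^+ 2 * H ^+ 2) * E); last first.
  by rewrite /error_majorant; field; lra.
set A := 96 * _ * _ * _ * _.
have A0 : 0 <= A by rewrite /A !mulr_ge0 ?exprn_ge0.
apply: (@le_trans _ _ (A * (3 * (N1 * N2 * H ^+ 2)) * (28 * N3 ^+ 2 * T * (9 * v)))).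
  apply: (@le_trans _ _ (A * (N1 * N2 * H + 2 * N2 ^+ 2 * H ^+ 2) * (28 * N3 ^+ 2 * T * (9 * v)))).
    by apply: ler_wpM2l => //; rewrite mulr_ge0 ?addr_ge0 ?mulr_ge0 ?sqr_ge0.
  apply: ler_wpM2r; last by rewrite ler_wpM2l.
  by rewrite !mulr_ge0 ?sqr_ge0//; lra.
have M10 : 0 <= M1 by lra.
(* The six factors [N1 N2^3 N3^2] are next regrouped as [M1 M2 M3 <= x] times [M2^2 M3 <= M2^3]. *)
have M20 : 0 <= M2 by lra.
have M30 : 0 <= M3 by lra.
have N6 : N1 * N2 ^+ 3 * N3 ^+ 2 <= 729 * (x * M2 ^+ 3).
  apply: (@le_trans _ _ ((3 * M1) * (3 * M2) ^+ 3 * (3 * M3) ^+ 2)).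
    apply: ler_pM; rewrite ?mulr_ge0 ?exprn_ge0//; last first.
      by apply: lerXn2r; rewrite ?nnegrE ?mulr_ge0.
    apply: ler_pM; rewrite ?exprn_ge0//.
    by apply: lerXn2r; rewrite ?nnegrE ?mulr_ge0.
  rewrite (_ : 3 * M1 * (3 * M2) ^+ 3 * (3 * M3) ^+ 2 =
    729 * ((M1 * M2 * M3) * (M2 ^+ 2 * M3))); last by ring.
  apply: ler_wpM2l; first exact: ler0n.
  have M2M3 : 0 <= M2 ^+ 2 * M3 by rewrite mulr_ge0 ?sqr_ge0.
  have M123 : 0 <= M1 * M2 * M3 by rewrite !mulr_ge0.
  have M2c : M2 ^+ 2 * M3 <= M2 ^+ 3 by rewrite [leRHS]exprSr ler_wpM2l ?sqr_ge0.
  exact: ler_pM.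
rewrite (_ : A * _ * _ = (288 * 28 * 9) * (D ^+ 4 * T ^+ 3 * H ^+ 4) * v *
   (N1 * N2 ^+ 3 * N3 ^+ 2)); last by rewrite /A; ring.
rewrite [leRHS](_ : _ = (288 * 28 * 9) * (D ^+ 4 * T ^+ 3 * H ^+ 4) * v *
   (729 * (x * M2 ^+ 3))); last by ring.
apply: ler_wpM2l N6; have v0 : 0 <= v by lra.
by rewrite mulr_ge0 ?mulr_ge0 ?ler0n ?exprn_ge0.
Qed.

(** * Passage to logarithms, where all comparisons become linear *)

Lemma powR_expR (R : realType) (a b : R) : (expR a) `^ b = expR (b * a).
Proof. by rewrite /powR gt_eqF ?expR_gt0// expRK. Qed.

Lemma sqrt_expR (R : realType) (a : R) : Num.sqrt (expR a) = expR (a / 2).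
Proof.
have -> : expR a = expR (a / 2) ^+ 2.
  by rewrite -expRM_natl; congr expR; field.
by rewrite sqrtr_sqr ger0_norm// expR_ge0.
Qed.

Lemma ln_le_subr1 (R : realType) (y : R) : 0 < y -> ln y <= y - 1.
Proof.
move=> y0; have := @le_ln1Dx R (y - 1).
by rewrite (_ : 1 + (y - 1) = y); [apply; lra|ring].
Qed.

Lemma le_powR_ln (R : realType) (delta x : R) : 0 < delta -> 0 < x ->
  ln x <= delta^-1 * x `^ delta.
Proof.
move=> d0 x0; rewrite [leRHS]mulrC ler_pdivlMr// [leLHS]mulrC -ln_powR.
have y0 : 0 < x `^ delta by exact: powR_gt0.
by apply: le_trans (ln_le_subr1 y0) _; lra.
Qed.

Lemma ln_ln_small (R : realType) (c eta : R) : 0 < c -> 0 < eta ->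
  exists2 y0 : R, 0 < y0 & forall y, y0 <= y -> c * ln y <= eta * y.
Proof.
(* With this [k], [ln (k y) <= k y] gives [ln y <= k y - ln k <= 2 k y] once [y] exceeds
   [- ln k / k]. *)
move=> c0 e0; pose k := eta / (2 * c).
have k0 : 0 < k by rewrite divr_gt0// mulr_gt0.
exists (Num.max 1 (- ln k / k)) => [|y]; first by rewrite lt_max ltr01.
rewrite ge_max => /andP[y1 yk]; have y0 : 0 < y by lra.
have h := ln_le_subr1 (mulr_gt0 k0 y0).
rewrite lnM ?posrE// in h.
have {}yk : - ln k <= k * y by rewrite mulrC -ler_pdivrMr.
have cE : eta * y = 2 * c * (k * y) by rewrite /k; field; lra.
by rewrite cE; nra.
Qed.

(** The variables are logarithms, and multiples of [alpha / 10] pay for powers of [ln x] and for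
    divisor bounds. The last three conclusions serve the main term, the fourth power of the error,
    and the trivial count for small [M2]. *)
Lemma exponent_inequalities (R : realType) (alpha eps lx lq lD m1 m2 m3 : R) :
  0 < alpha < 1 / 100 -> 0 < eps -> 20 <= lx -> 0 <= lD -> 0 <= lq ->
  lx - alpha / 10 * lx <= m1 + m2 + m3 -> m1 + m2 + m3 <= lx ->
  lx - (3 / 2 + alpha) * lq <= m3 -> m3 <= m2 -> m2 <= m1 ->
  m1 <= lD + (1 + alpha) * lq -> 2 * lD + lq < (2 / 3 - 4 * alpha) * lx ->
  m2 <= 1 / 3 * lx ->
  [/\ 44 / 100 * lx <= lq /\ lq <= 2 / 3 * lx, 0 <= m3,
      2 * lD + alpha / 10 * lq + lx - m3 - lq <= lx - (1 + alpha / 2) * lq,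
      8 * lD + 13 * (alpha / 10 * lx) <= 12 * lD + 4 * (eps * lx) + 12 * (alpha * lq)
    & m2 < lq / 3 -> 6 * (alpha / 10 * lx) + lx - lq <=
        3 * lD + eps * lx + 3 * (alpha * lq) + 9 / 8 * m2 - 1 / 8 * lq + 1 / 4 * lx].
Proof.
move=> /andP[a0 a1] e0 x0 D0 q0 H1 H2 H3 H32 H21 H4 H5 H6.
have ax0 : 0 <= alpha * lx by rewrite mulr_ge0 ?ltW//; lra.
have ex0 : 0 <= eps * lx by rewrite mulr_ge0 ?ltW//; lra.
have aq0 : 0 <= alpha * lq by apply: mulr_ge0 => //; lra.
have aq1 : alpha * lq <= 1 / 100 * lq by apply: ler_wpM2r => //; lra.
(* From [x / q^(3/2 + alpha) <= M3 <= M2 <= x^(1/3)], since [(2/3) / 1.51 > 0.44]. *)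
have F1 : 44 / 100 * lx <= lq by lra.
have F3 : lq <= 2 / 3 * lx by lra.
have aqx : alpha * lq <= alpha * (2 / 3 * lx) by rewrite ler_wpM2l// ltW.
have axq : alpha * (44 / 100 * lx) <= alpha * lq by rewrite ler_wpM2l// ltW.
(* The hypothesis on [D^2 q], multiplied by 3/2, meets the exponent 3/2 in the lower bound for
   [M3]. *)
have F2 : 3 * lD + 5 * (alpha * lx) <= m3 by lra.
(* For the last item: three quarters of [lx - alpha / 10 * lx <= lD + (1 + alpha) * lq + 2 * m2],
   with [3 / 8 * m2 <= lq / 8], leaves exactly the coefficient 7/8 of [lq]. *)
split; [by []|lra|lra|lra|move=> m2q; lra].
Qed.

Lemma harm_ge1 (R : realType) (n : nat) : (2 <= n)%N -> 1 <= harm R n.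
Proof.
by move=> n2; apply: le_trans (harm_le R n2); rewrite /harm big_nat1 invr1.
Qed.

Lemma harm_le_powR (R : realType) (delta x : R) (n : nat) :
  0 < delta -> 1 <= x -> (0 < n)%N -> n%:R <= x ->
  harm R n <= (1 + delta^-1) * x `^ delta.
Proof.
move=> d0 x1 n0 nx; have x0 : 0 < x by lra.
apply: le_trans (harm_le_ln R n0) _.
have h1 : ln (n%:R : R) <= ln x by rewrite ler_ln ?posrE ?ltr0n.
have h2 := le_powR_ln d0 x0.
have h3 : 1 <= x `^ delta by rewrite -(powRr0 x) ler_powR// ltW.
by rewrite mulrDl mul1r; apply: lerD => //; apply: le_trans h1 h2.
Qed.

(** * Choice of constants and comparison of exponents *)

Theorem lemma13p1 (R : realType) (alpha eps cDelta : R)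
    (halpha : 0 < alpha < 1 / 100) (heps : 0 < eps < alpha / 4)
    (hcDelta : 0 < cDelta) :
  exists K x0 : R, 0 < K /\
  forall (C x Delta M1 M2 M3 : R) (D q a : nat) (chi f1 f2 f3 : int -> R),
    x0 <= x ->
    0 < C < 1 -> exceptional_character C D chi ->
    (0 < a)%N -> (0 < q)%N -> coprime a q ->
    0 < Delta <= cDelta / ln x ^+ 8 ->
    x / ln x ^+ 12 < M1 * M2 * M3 <= x ->
    x / q%:R `^ (3 / 2 + alpha) <= M3 -> M3 <= M2 -> M2 <= M1 ->
    M1 <= D%:R * q%:R `^ (1 + alpha) ->
    exactly_one_is chi f1 f2 f3 ->
    D%:R ^+ 2 * q%:R < x `^ (2 / 3 - 4 * alpha) ->
    M2 <= x `^ (1 / 3) ->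
    `|ternary_sum Delta M1 M2 M3 f1 f2 f3 a q| <=
      K * (D%:R ^+ 3 * x `^ eps * q%:R `^ (3 * alpha) * M2 `^ (9 / 8)
             * q%:R `^ (- (1 / 8)) * x `^ (1 / 4)
           + x / q%:R `^ (1 + alpha / 2)).
Proof.
have [a0 a1] := andP halpha; have [e0 e1] := andP heps.
pose delta := alpha / 10; have d0 : 0 < delta by rewrite /delta; clear -a0; lra.
have [Kd Kd1 KdP] := divisor_bound d0.
have [y0 y00 y0P] := ln_ln_small (c := 12) (eta := alpha / 10) ltac:(lra) d0.
(* The divisor bound is used up to [100 * x ^+ 3], which gives [T <= KT * x^(3 delta)]; the 1
   absorbs rounding up. *)
pose KT := Kd * 100 `^ delta + 1.
have KT1 : 1 <= KT by rewrite lerDr mulr_ge0 ?powR_ge0//; lra.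
pose KH := 1 + delta^-1.
have KH1 : 1 <= KH by rewrite lerDl invr_ge0 ltW.
pose K4 : R := (288 * 28 * 729 * 9) * (KT ^+ 3 * KH ^+ 4).
have K41 : 1 <= K4.
  apply: mulr_ege1; first lra.
  by apply: mulr_ege1; apply: exprn_ege1.
(* One summand each for the main term, the trivial count and the error. *)
pose K := 18 * Kd + 28 * KT ^+ 2 + K4.
have K0 : 0 < K by rewrite /K; have := sqr_ge0 KT; lra.
(* [cDelta] makes [Delta <= 1], [y0] makes [ln x ^ 12 <= x^(alpha / 10)], and 20 covers numerical
   needs such as [3 <= x^(1/10)]. *)
exists K, (expR (20 + cDelta + y0)); split=> //.
move=> C x Delta M1 M2 M3 D q a chi f1 f2 f3 xx0 _ [qc _ _] _ q0 aq.
move=> /andP[Delta0 DeltaC] /andP[Mlow Mup] M3low M32 M21 M1up one Dq M2up.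
have x0 : 0 < x by apply: lt_le_trans xx0; exact: expR_gt0.
set lx := ln x; have xE : x = expR lx by rewrite lnK.
have lx20 : 20 + cDelta + y0 <= lx by rewrite -ler_expR -xE.
have lxge : 20 <= lx by clear -lx20 hcDelta y00; lra.
have lxpos : 0 < lx by clear -lxge; lra.
have Delta1 : Delta <= 1.
  apply: le_trans DeltaC _; rewrite ler_pdivrMr ?exprn_gt0// mul1r -/lx.
  apply: (@le_trans _ _ lx); first by clear -lx20 hcDelta y00; lra.
  by rewrite -{1}[lx]expr1 ler_weXn2l//; clear -lxge; lra.
have [[[D0 _ _ _] _ _] _] := (qc, tt).
have qR : 0 < (q%:R : R) by rewrite ltr0n.
set lq := ln (q%:R : R); have qE : q%:R = expR lq by rewrite lnK.
have lq0 : 0 <= lq by rewrite ln_ge0// ler1n.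
have DR : 0 < (D%:R : R) by rewrite ltr0n.
set lD := ln (D%:R : R); have DE : D%:R = expR lD by rewrite lnK.
have lD0 : 0 <= lD by rewrite ln_ge0// ler1n.
have M30 : 0 < M3 by apply: lt_le_trans M3low; rewrite divr_gt0 ?powR_gt0.
have M20 : 0 < M2 by exact: lt_le_trans M30 M32.
have M10 : 0 < M1 by exact: lt_le_trans M20 M21.
set m1 := ln M1; have M1E : M1 = expR m1 by rewrite lnK.
set m2 := ln M2; have M2E : M2 = expR m2 by rewrite lnK.
set m3 := ln M3; have M3E : M3 = expR m3 by rewrite lnK.
have H1 : lx - alpha / 10 * lx <= m1 + m2 + m3.
  have lE : lx = expR (ln lx) by rewrite lnK.
  move: Mlow; rewrite -/lx {1}lE -expRM_natl xE M1E M2E M3E -expRN -!expRD ltr_expR.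
  have := y0P lx (le_trans _ lx20); move=> /(_ ltac:(clear -hcDelta; lra)); clear; lra.
have H2 : m1 + m2 + m3 <= lx by rewrite -ler_expR !expRD -M1E -M2E -M3E -xE.
have H3 : lx - (3 / 2 + alpha) * lq <= m3.
  by move: M3low; rewrite {1}xE qE powR_expR M3E -expRN -expRD ler_expR.
have H32 : m3 <= m2 by rewrite -ler_expR -M3E -M2E.
have H21 : m2 <= m1 by rewrite -ler_expR -M2E -M1E.
have H4 : m1 <= lD + (1 + alpha) * lq.
  by move: M1up; rewrite qE powR_expR DE M1E -expRD ler_expR.
have H5 : 2 * lD + lq < (2 / 3 - 4 * alpha) * lx.
  by move: Dq; rewrite xE qE powR_expR DE -expRM_natl -expRD ltr_expR.
have H6 : m2 <= 1 / 3 * lx by move: M2up; rewrite M2E xE powR_expR ler_expR.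
have [[Fq Fqx] m30 X1 X2 X3] :=
  exponent_inequalities halpha e0 lxge lD0 lq0 H1 H2 H3 H32 H21 H4 H5 H6.
clearbody lx lq lD m1 m2 m3.
pose t1 := expR (3 * lD + eps * lx + 3 * (alpha * lq) + 9 / 8 * m2 - 1 / 8 * lq + 1 / 4 * lx).
pose t2 := expR (lx - (1 + alpha / 2) * lq).
have -> : D%:R ^+ 3 * x `^ eps * q%:R `^ (3 * alpha) * M2 `^ (9 / 8)
             * q%:R `^ (- (1 / 8)) * x `^ (1 / 4) = t1.
  rewrite xE qE DE M2E !powR_expR -expRM_natl -!expRD /t1; congr expR; ring.
have -> : x / q%:R `^ (1 + alpha / 2) = t2.
  by rewrite xE qE powR_expR -expRN -expRD.
have t10 : 0 < t1 by exact: expR_gt0.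
have t20 : 0 < t2 by exact: expR_gt0.
have qx : q%:R <= x by rewrite xE qE ler_expR; clear -Fqx lxpos; lra.
have x1 : 1 <= x by rewrite xE -expR0 ler_expR ltW.
have M31 : 1 <= M3 by rewrite M3E -expR0 ler_expR.
have q4 : (4 <= q)%N.
  rewrite -(ler_nat R) qE; by apply: le_trans (expR_ge1Dx lq); clear -Fq lxge; lra.
have [p qp] : exists p, q = p.+2 by clear -q4; exists (q - 2)%N; lia.
rewrite ternary_sumE//.
set l1 := natceil M1; set l2 := natceil M2; set l3 := natceil M3.
set h1 := natceil (M1 * _); set h2 := natceil (M2 * _); set h3 := natceil (M3 * _).
(* Since [Delta <= 1], [2 * M_i] is beyond the end of each range; [M_i >= 1] then gives
   [N_i <= 3 M_i]. *)
pose N1 := natceil (2 * M1); pose N2 := natceil (2 * M2); pose N3 := natceil (2 * M3).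
have lpos (M : R) : 0 < M -> (0 < natceil M)%N.
  by move=> M0; rewrite ltnNge natceil_le; [rewrite -ltNge|exact: ltW].
have hN (M : R) : 0 < M -> (natceil (M * (1 + Delta)) <= natceil (2 * M))%N.
  move=> M0; rewrite natceil_le; last by clear -M0 Delta0; apply: mulr_ge0; lra.
  apply: le_trans (natceil_ge _); last by clear -M0; lra.
  by rewrite mulrC ler_pM2r//; clear -Delta1; lra.
have N3M (M : R) : 1 <= M -> (natceil (2 * M))%:R <= 3 * M.
  move=> M1'; have M0' : 0 <= 2 * M by clear -M1'; lra.
  by have := natceil_ltD1 M0'; clear -M1'; lra.
have NN (M M' : R) : 0 < M -> M <= M' -> (natceil (2 * M) <= natceil (2 * M'))%N.
  move=> M0 MM'; have M0' : 0 <= 2 * M by clear -M0; lra.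
  have M0'' : 0 <= 2 * M' by clear -M0 MM'; lra.
  rewrite natceil_le//; apply: le_trans (natceil_ge M0'').
  by rewrite ler_pM2l.
have M21' : 1 <= M2 by exact: le_trans M31 M32.
have M11 : 1 <= M1 by exact: le_trans M21' M21.
have N1M := N3M M1 M11; have N2M := N3M M2 M21'.
have N3M' := N3M M3 M31.
rewrite -/N1 in N1M; rewrite -/N2 in N2M; rewrite -/N3 in N3M'.
have N32 : (N3 <= N2)%N by exact: NN.
have N21 : (N2 <= N1)%N by exact: NN.
(* One [T] for all uses of the divisor bound, whose arguments are at most [27 x], [q N2] and
   [19 q^3]. *)
pose T := natceil (Kd * (100 * x ^+ 3) `^ delta).
have B0 : 0 <= 100 * x ^+ 3 by rewrite mulr_ge0// exprn_ge0// ltW.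
have TB0 : 0 <= Kd * (100 * x ^+ 3) `^ delta by rewrite mulr_ge0 ?powR_ge0//; clear -Kd1; lra.
have TP n : (0 < n)%N -> n%:R <= 100 * x ^+ 3 -> (size (divisors n) <= T)%N.
  move=> n0 nle; rewrite -(ler_nat R); apply: le_trans (natceil_ge TB0).
  have [h _] := KdP n n0; apply: le_trans h _; rewrite ler_wpM2l//; first by clear -Kd1; lra.
  by apply: ge0_ler_powR; rewrite ?nnegrE ?ler0n// ltW.
have TKT : T%:R <= KT * expR (3 * (delta * lx)).
  have := natceil_ltD1 TB0; rewrite -/T.
  rewrite powRM ?exprn_ge0 ?ler0n ?(ltW x0)// xE -expRM_natl powR_expR.
  rewrite (_ : delta * (3%:R * lx) = 3 * (delta * lx)); last by ring.
  have : 1 <= expR (3 * (delta * lx)).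
    by rewrite -expR0 ler_expR !mulr_ge0// ltW.
  rewrite /KT mulrDl mulrA mul1r; clear; lra.
have x3 : 1 <= x ^+ 3 by rewrite exprn_ege1.
have xx3 : x <= x ^+ 3 by rewrite -{1}[x]expr1 ler_weXn2l.
have hM (M : R) : 1 <= M -> (natceil (M * (1 + Delta)))%:R <= 3 * M.
  move=> M1'; apply: le_trans (N3M M M1'); rewrite ler_nat hN//; clear -M1'; lra.
have hprod : ((h1 * h2 * h3)%:R : R) <= 27 * x.
  apply: (@le_trans _ _ ((3 * M1) * (3 * M2) * (3 * M3))).
    by rewrite !natrM; apply: ler_pM => //; [apply: ler_pM => //|]; apply: hM.
  rewrite (_ : 3 * M1 * (3 * M2) * (3 * M3) = 27 * (M1 * M2 * M3)); last by ring.
  by rewrite ler_pM2l.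
have [qc_D chiD chi1 _ _] := quadratic_character_props qc.
have fle (f : int -> R) : [\/ f = chi | f = (fun=> 1)] -> forall t : nat, `|f t%:Z| <= 1.
  by case=> -> t; rewrite ?chi1 ?normr1.
have [m2q|m2q] := ltP m2 (lq / 3).
  have triv : `|nat_ternary l1 h1 l2 h2 l3 h3 (fun t => f1 t%:Z) (fun t => f2 t%:Z)
      (fun t => f3 t%:Z) a q| <= ((T * T) * ((h1 * h2 * h3) %/ q).+1)%:R.
    apply: nat_ternary_trivial; rewrite ?lpos//.
    - by apply: fle; case: one => -[-> _ _]; [left|right|right].
    - by apply: fle; case: one => -[_ -> _]; [right|left|right].
    - by apply: fle; case: one => -[_ _ ->]; [right|right|left].
    - move=> n n0 nle; apply: TP => //.
      by apply: (@le_trans _ _ (27 * x)); [apply: le_trans hprod; rewrite ler_nat|clear -xx3 x1; lra].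
  apply: le_trans triv _.
  have cnt : (((h1 * h2 * h3) %/ q).+1%:R : R) <= 28 * (x / q%:R).
    rewrite -natr1; apply: (@le_trans _ _ (27 * x / q%:R + x / q%:R)); last by clear; lra.
    apply: lerD; last by rewrite ler_pdivlMr// mul1r.
    rewrite ler_pdivlMr//; apply: le_trans hprod.
    by rewrite -natrM ler_nat leq_divM.
  rewrite !natrM.
  apply: (@le_trans _ _ ((KT * expR (3 * (delta * lx))) ^+ 2 * (28 * (x / q%:R)))).
    by rewrite expr2; apply: ler_pM => //; apply: ler_pM.
  rewrite (_ : (KT * _) ^+ 2 * _ = 28 * KT ^+ 2 * expR (6 * (delta * lx) + lx - lq)); last first.
    rewrite xE qE expRD expRN expRD exprMn -expRM_natl.
    rewrite (_ : 2%:R * (3 * (delta * lx)) = 6 * (delta * lx)); last by ring.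
    by ring.
  apply: (@le_trans _ _ (28 * KT ^+ 2 * t1)).
    apply: ler_wpM2l; first by rewrite mulr_ge0 ?sqr_ge0.
    by rewrite /t1 ler_expR; exact: X3.
  apply: (@le_trans _ _ (K * t1)); last by rewrite ler_pM2l// lerDl ltW.
  by rewrite ler_pM2r// /K; clear -Kd1 K41; lra.
have pR : (p.+2%:R : R) = q%:R by rewrite qp.
have N2q : (N2 < p.+2)%N.
  rewrite -qp -(ltr_nat R); apply: le_lt_trans N2M _; rewrite M2E qE.
  (* The factor 3 costs [x^(1/10)], and [1/3 + 1/10] is still below 0.44. *)
  have h3' : 3 <= expR (10 / 100 * lx).
    by apply: le_trans (expR_ge1Dx _); clear -lxge; lra.
  apply: (@le_lt_trans _ _ (expR (10 / 100 * lx) * expR m2)).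
    by rewrite ler_wpM2r ?expR_ge0.
  by rewrite -expRD ltr_expR; clear -lxge H6 Fq; lra.
have N2qR : (N2%:R : R) <= q%:R by rewrite qp ler_nat ltnW.
have qq : (q%:R : R) * q%:R <= x * x by apply: ler_pM.
have xxx : x * x <= x ^+ 3 by rewrite exprS expr2 ler_peMl// mulr_ge0 ?(ltW x0).
have q3 : (q%:R : R) ^+ 3 <= x ^+ 3 by apply: lerXn2r; rewrite ?nnegrE ?ler0n ?(ltW x0).
have qN2 : (q * N2)%:R <= 100 * x ^+ 3 :> R.
  rewrite natrM; apply: (@le_trans _ _ (q%:R * q%:R)); first by rewrite ler_wpM2l.
  clear -qq xxx x3; lra.
have lh1 : (l1 <= h1)%N.
  rewrite natceil_le; last exact: ltW.
  apply: le_trans (natceil_ge _); last by apply: mulr_ge0; [exact: ltW|clear -Delta0; lra].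
  by rewrite ler_peMr; [|exact: ltW|clear -Delta0; lra].
have aq' : coprime a p.+2 by rewrite -qp.
have TPq n : (0 < n)%N -> (n <= p.+2 * N2)%N -> (size (divisors n) <= T)%N.
  move=> n0; rewrite -qp => nle; apply: TP => //; apply: le_trans qN2.
  by rewrite ler_nat.
have [E1 [E10 E14] key] := @equidistribution_bound R p l1 h1 l2 h2 l3 h3 N1 N2 N3 T a
  (lpos _ M10) (lpos _ M20) (lpos _ M30) lh1 (leqW (hN _ M10)) (leqW (hN _ M20))
  (leqW (hN _ M30)) N32 N21 N2q aq' TPq D chi f1 f2 f3 qc one.
rewrite qp; apply: le_trans key _; rewrite pR.
have wle : (2 : R) ^+ size (primes p.+2) <= Kd * expR (delta * lq).
  have [_] := KdP p.+2 isT; rewrite natrX => /le_trans; apply.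
  by rewrite pR qE powR_expR.
have mainle : 2 * D%:R ^+ 2 * N1%:R * N2%:R * 2 ^+ size (primes p.+2) / q%:R <= 18 * Kd * t2.
  apply: (@le_trans _ _ (2 * D%:R ^+ 2 * (3 * M1) * (3 * M2) * (Kd * expR (delta * lq)) / q%:R)).
    apply: ler_wpM2r; first by rewrite invr_ge0.
    apply: ler_pM => //; rewrite ?exprn_ge0 ?mulr_ge0 ?sqr_ge0//.
    apply: ler_pM => //; rewrite ?mulr_ge0 ?sqr_ge0//.
    by apply: ler_wpM2l => //; rewrite mulr_ge0 ?sqr_ge0.
  rewrite (_ : 2 * D%:R ^+ 2 * _ * _ * _ / _ =
     18 * Kd * expR (2 * lD + m1 + m2 + delta * lq - lq)); last first.
    rewrite DE M1E M2E qE expRD expRN !expRD -expRM_natl; ring.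
  apply: ler_wpM2l; first by clear -Kd1; lra.
  by rewrite /t2 ler_expR; move: X1; rewrite /delta; clear -H2; lra.
have errle : D%:R * E1 <= K4 * t1.
  have N30 : (0 < N3)%N by apply: lpos; clear -M30; lra.
  have us : unit_range p N3 (coprime_range p l3 h3).
    by apply: coprime_range_unit; [exact: lpos|exact: leqW (hN _ M30)].
  have TP3 n : (0 < n)%N -> (n <= 19 * p.+2 ^ 3)%N -> (size (divisors n) <= T)%N.
    move=> n0; rewrite -(ler_nat R) natrM natrX pR => nle; apply: TP => //.
    by apply: le_trans nle _; clear -q3 x3; lra.
  have En := inverse_energy_real R us N30 (leq_ltn_trans N32 N2q)
     (eq_ind q (fun m => 4 <= m)%N q4 p.+2 qp) TP3.
  have T1 : (1 : R) <= T%:R.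
    by rewrite ler1n; apply: leq_trans (TP 1%N isT _) => //; clear -x3; lra.
  have H1' := @harm_ge1 R p.+2 isT.
  have vq : Num.sqrt (p.+2%:R : R) <= Num.sqrt M2 ^+ 3.
    by rewrite pR qE M2E !sqrt_expR -expRM_natl ler_expR; clear -m2q; lra.
  have N2R : (N2%:R : R) <= N1%:R by rewrite ler_nat.
  have qp0 : 0 < (p.+2%:R : R) by rewrite ltr0n.
  have maj := @error_majorant_power R p.+2%:R D%:R T%:R (harm R p.+2)
    (inverse_energy p (coprime_range p l3 h3))%:R N1%:R N2%:R N3%:R M1 M2 M3 x
    qp0 (ler0n _ _) T1 H1' M31 M32 M21
    (introT andP (conj (ler0n _ _) N1M)) (introT andP (conj (ler0n _ _) N2M))
    (introT andP (conj (ler0n _ _) N3M')) N2R Mup vq En.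
  have HK : harm R p.+2 <= KH * expR (delta * lx).
    have := @harm_le_powR R delta x p.+2 d0 x1 isT; rewrite pR => /(_ qx).
    by rewrite {1}xE powR_expR.
  (* Fourth powers avoid extracting roots. In the exponents, 8 is [4 + 4], 13 is [3 * 3 + 4] from
     [T^3] and [H^4], and 9/2 is [3 + 3/2]; since [K4 >= 1], [K4 <= K4 ^+ 4]. *)
  have DE1 : (D%:R * E1) ^+ 4 <= (K4 * t1) ^+ 4.
    rewrite exprMn; apply: (@le_trans _ _ (D%:R ^+ 4 * ((288 * 28 * 729 * 9) *
       (D%:R ^+ 4 * (KT * expR (3 * (delta * lx))) ^+ 3 * (KH * expR (delta * lx)) ^+ 4) *
       (x * M2 ^+ 3 * (Num.sqrt M2 ^+ 3 / Num.sqrt p.+2%:R))))).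
      apply: ler_wpM2l; first exact: exprn_ge0.
      apply: le_trans E14 _; apply: le_trans maj _.
      apply: ler_wpM2r.
        by rewrite !mulr_ge0 ?exprn_ge0 ?invr_ge0 ?sqrtr_ge0// ltW.
      apply: ler_wpM2l; first by rewrite !mulr_ge0 ?ler0n.
      have HH0 : 0 <= harm R p.+2 by exact: harm_ge0.
      apply: ler_pM; rewrite ?mulr_ge0 ?exprn_ge0//.
        apply: ler_wpM2l; first exact: exprn_ge0.
        by apply: lerXn2r; rewrite ?nnegrE ?mulr_ge0 ?expR_ge0//; clear -KT1; lra.
      by apply: lerXn2r; rewrite ?nnegrE ?mulr_ge0 ?expR_ge0//; clear -KH1; lra.
    rewrite (_ : D%:R ^+ 4 * _ = K4 * expR (8 * lD + 13 * (delta * lx) + lx + 9 / 2 * m2 - lq / 2)); last first.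
      rewrite /K4 pR DE xE M2E qE !sqrt_expR !exprMn -!expRM_natl -expRN.
      set c := 288 * 28 * 729 * 9.
      rewrite (_ : 8 * lD + _ + lx + _ - _ = 4%:R * lD + (4%:R * lD + 3%:R * (3 * (delta * lx)) + 4%:R * (delta * lx)) + (lx + 3%:R * m2 + (3%:R * (m2 / 2) + - (lq / 2)))); last by field.
      rewrite !expRD; ring.
    rewrite exprMn; apply: ler_pM; rewrite ?expR_ge0//; first by clear -K41; lra.
      by rewrite -{1}[K4]expr1 ler_weXn2l.
    rewrite /t1 -expRM_natl ler_expR; move: X2; rewrite /delta; clear; lra.
  have nn1 : D%:R * E1 \is Num.nneg by rewrite nnegrE mulr_ge0.
  have nn2 : K4 * t1 \is Num.nneg.
    by rewrite nnegrE; apply: mulr_ge0; [clear -K41; lra|exact: ltW].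
  by rewrite -(ler_pXn2r (isT : (0 < 4)%N) nn1 nn2).
apply: le_trans (lerD mainle errle) _.
have KT0 : 0 <= 28 * KT ^+ 2 by rewrite mulr_ge0 ?sqr_ge0.
have e2 : 18 * Kd * t2 <= K * t2 by rewrite ler_pM2r// /K; clear -KT0 K41; lra.
have e3 : K4 * t1 <= K * t1 by rewrite ler_pM2r// /K; clear -KT0 Kd1; lra.
by rewrite mulrDr addrC lerD.
Qed.
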